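(* Let $\xi,\gamma,\omega,\nu,\tau,z,x_0,\sigma_\pm$, the functions $F^\pm(x;\alpha,\beta,\mu,\delta)$ composing the normal inverse Gaussian cumulative distribution function $F(x;\alpha,\beta,\mu,\delta)=F^+(x;\alpha,\beta,\mu,\delta)+F^-(x;\alpha,\beta,\mu,\delta)$, and the coefficients $d_k(\rho)$ be as defined in the context. Then $F^\pm$ have the asymptotic expansions $$F^\pm(x;\alpha,\beta,\mu,\delta)\sim\frac{e^{z\sigma_+^2}}{4\pi}\left(2\pi e^{-z\sigma_\pm^2}\,\mathrm{erfc}\left(i\sigma_\pm\sqrt z\right)-2\tan\left(\tfrac14(\nu\mp\tau)\right)\sqrt{\frac{\pi}{z}}\sum_{k=0}^\infty\frac{d_k(\sigma_\pm)}{z^k}\right),$$ or $$F^+(x;\alpha,\beta,\mu,\delta)\sim \tfrac12\,\mathrm{erfc}(\zeta_+)-e^{-\zeta_+^2}\,\frac{\tan\left(\frac14(\nu-\tau)\right)}{2\sqrt{\pi z}}\sum_{k=0}^\infty\frac{d_k(\sigma_+)}{z^k},$$ $$F^-(x;\alpha,\beta,\mu,\delta)\sim \tfrac12 e^{2\gamma\delta}\,\mathrm{erfc}(\zeta_-)-e^{-\zeta_+^2}\,\frac{\tan\left(\frac14(\nu+\tau)\right)}{2\sqrt{\pi z}}\sum_{k=0}^\infty\frac{d_k(\sigma_-)}{z^k},$$ where $2\gamma\delta=\zeta_-^2-\zeta_+^2$ and $$\zeta_+=i\sigma_+\sqrt z=\sin\left(\tfrac12(\nu-\tau)\right)\sqrt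 z=\mathrm{sign}(x_0-x)\sqrt{\alpha\omega-\beta\xi-\gamma\delta},$$ $$\zeta_-=i\sigma_-\sqrt z=\sin\left(\tfrac12(\nu+\tau)\right)\sqrt z=\sqrt{\alpha\omega-\beta\xi+\gamma\delta}.$$ The expansions are valid for large values of $z$ and $|\sigma_\pm|\le\frac12$.
   Context: Parameters: $\alpha>0$, $-\alpha<\beta<\alpha$, $\delta>0$, $\mu$ real. Notation: $\xi=x-\mu$, $\gamma=\sqrt{\alpha^2-\beta^2}$, $\omega=\sqrt{\xi^2+\delta^2}$, $z=2\alpha\omega$, $x_0=\mu+\beta\delta/\gamma$, $\nu=\arctan(\delta/\xi)$ with $\nu\in(0,\tfrac12\pi)$ (so $\xi=\omega\cos\nu$, $\delta=\omega\sin\nu$), and $\tau\in(0,\pi)$ is defined by $\cos\tau=\beta/\alpha$ (so $\gamma=\alpha\sin\tau$). The cases $\nu>\tau$, $\nu=\tau$, $\nu<\tau$ correspond to $x<x_0$, $x=x_0$, $x>x_0$, respectively. Further $$\sigma_+=-i\sin\left(\tfrac12(\nu-\tau)\right),\qquad\sigma_-=-i\sin\left(\tfrac12(\nu+\tau)\right).$$ In formulas with $\pm$ and $\mp$, upper signs go together and lower signs go together. The normal inverse Gaussian cumulative distribution function is $$F(x;\alpha,\beta,\mu,\delta)=\frac{\alpha\delta e^{\delta\gamma}}{\pi}\int_{-\infty}^x\frac{K_1\left(\alpha\sqrt{\delta^2+(t-\mu)^2}\right)}{\sqrt{\delta^2+(t-\mu)^2}}\,e^{\beta(t-\mu)}\,dt,$$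 with $K_1$ the modified Bessel function. For $\nu>\tau$ one has $F=F^++F^-$ with $$F^\pm(x;\alpha,\beta,\mu,\delta)=\frac{e^{z\sigma_+^2}}{4\pi}\sin(\nu\mp\tau)\int_{-\infty}^\infty e^{-z\sigma^2}\frac{d\sigma}{(\sigma^2-\sigma_\pm^2)\sqrt{1+\sigma^2}}$$ (the prefactor contains $\sigma_+^2$ for both signs). The condition $\nu>\tau$ is used only to write down these integrals and is not imposed on the expansions: for $\nu\le\tau$, $F^-$ is given by the same integral and $F^+$ denotes the analytic continuation through $\nu=\tau$, so that $F=F^++F^-$ continues to hold. The complementary error function is $\mathrm{erfc}(z)=\frac{2}{\sqrt\pi}\int_z^\infty e^{-t^2}dt$. Coefficients: for $\rho=\sigma_\pm$ let $$g(\sigma,\rho)=\frac{1}{\sigma^2-\rho^2}\left(\frac1{\sqrt{1+\sigma^2}}-\frac1{\sqrt{1+\rho^2}}\right)=-\frac{1}{\sqrt{1+\sigma^2}\,\sqrt{1+\rho^2}\left(\sqrt{1+\sigma^2}+\sqrt{1+\rho^2}\right)},$$ which is analytic for $|\sigma|<1$, and define $c_k(\rho)$ by $g(\sigma,\rho)=g(0,\rho)\sum_{k=0}^\infty c_k(\rho)\sigma^{2k}$. Then $d_k(\rho)=c_k(\rho)\left(\tfrac12\right)_k$, where $(a)_k=\Gamma(a+k)/\Gamma(a)$ is the Pochhammer symbol. *)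

(* Defs.v *)
From HB Require Import structures.
From mathcomp Require Import all_boot all_order all_algebra.
From mathcomp Require Import all_classical all_reals all_analysis.
From mathcomp Require Import complex.

Set Implicit Arguments.
Unset Strict Implicit.
Unset Printing Implicit Defensive.

Import Order.TTheory GRing.Theory Num.Theory.
Import numFieldNormedType.Exports.

Local Open Scope classical_set_scope.
Local Open Scope ring_scope.
Local Open Scope complex_scope.

Section special_functions.
Context {R : realType}.
Local Notation leb := (@lebesgue_measure R).

Definition cosh (u : R) : R := (expR u + expR (- u)) / 2.

(* Modified Bessel function of the second kind, by its standard integral
   representation, valid for y > 0 and every real order (DLMF 10.32.9). *)
Definition besselK (order y : R) : R :=
  \int[leb]_(u in `[0, +oo[) (expR (- y * cosh u) * cosh (order * u)).

Definition erfc (w : R) : R :=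
  2 / Num.sqrt pi * \int[leb]_(t in `[w, +oo[) expR (- t ^+ 2).

Definition Gamma (a : R) : R :=
  \int[leb]_(t in `]0, +oo[) (t `^ (a - 1) * expR (- t)).

Definition pochhammer (a : R) (k : nat) : R := Gamma (a + k%:R) / Gamma a.

Definition analytic_at (f : R -> R) (a : R) : Prop :=
  exists c : nat -> R, \forall y \near a,
    series (fun k => c k * (y - a) ^+ k) @ \oo --> f y.

End special_functions.

Section angular_functions.
Context {R : realType}.
Local Notation leb := (@lebesgue_measure R).

Definition sigmap_of (nu tau : R) : R[i] := - 'i%C * (sin ((nu - tau) / 2))%:C.
Definition sigmam_of (nu tau : R) : R[i] := - 'i%C * (sin ((nu + tau) / 2))%:C.

(* [sigmap_of] and [sigmam_of] are purely imaginary, so their squares, and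
   their products with 'i, are real: taking the real part loses nothing. *)
Lemma imag_sqr_real (s : R) :
  (- 'i%C * s%:C : R[i]) ^+ 2 = (complex.Re ((- 'i%C * s%:C : R[i]) ^+ 2))%:C.
Proof. by rewrite !expr2; simpc. Qed.

Definition Fp_integral (z nu tau : R) : R :=
  expR (z * complex.Re (sigmap_of nu tau ^+ 2)) / (4 * pi) * sin (nu - tau) *
  \int[leb]_(s in setT)
    (expR (- z * s ^+ 2) /
     ((s ^+ 2 - complex.Re (sigmap_of nu tau ^+ 2)) * Num.sqrt (1 + s ^+ 2))).

Definition Fm_integral (z nu tau : R) : R :=
  expR (z * complex.Re (sigmap_of nu tau ^+ 2)) / (4 * pi) * sin (nu + tau) *
  \int[leb]_(s in setT)
    (expR (- z * s ^+ 2) /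
     ((s ^+ 2 - complex.Re (sigmam_of nu tau ^+ 2)) * Num.sqrt (1 + s ^+ 2))).

(* The integral in [Fp_integral] diverges at nu = tau, where F^+ jumps by 1 if
   the formula is used on both sides; hence the analytic continuation.  The
   continuation is taken on the whole interval ]0, pi[ of angles, so that the
   part ]tau, pi[ where it is prescribed is never empty, including when
   tau >= pi / 2. *)
Definition is_Fp_continuation (z tau : R) (f : R -> R) : Prop :=
  (forall nu, 0 < nu < pi -> analytic_at f nu) /\
  (forall nu, tau < nu < pi -> f nu = Fp_integral z nu tau).

Definition Fp_continuation (z tau : R) : R -> R :=
  xget (fun=> 0) [set f | is_Fp_continuation z tau f].

End angular_functions.

Section coefficients.
Context {R : realType}.

(* This is
     (s ^+ 2 - rho ^+ 2)^-1 * ((sqrt (1 + s ^+ 2))^-1 - (sqrt (1 + rho ^+ 2))^-1)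
   in the form that has no removable singularity at s ^+ 2 = rho ^+ 2; see
   [gfunE].  [sqrtc] is the principal square root. *)
Definition gfun (s : R) (rho : R[i]) : R[i] :=
  let a := (Num.sqrt (1 + s ^+ 2))%:C in
  let b := sqrtc (1 + rho ^+ 2) in
  - (a * b * (a + b))^-1.

Lemma gfunE (s : R) (rho : R[i]) :
  s%:C ^+ 2 != rho ^+ 2 -> 1 + rho ^+ 2 != 0 ->
  gfun s rho = (s%:C ^+ 2 - rho ^+ 2)^-1 *
    ((Num.sqrt (1 + s ^+ 2))%:C^-1 - (sqrtc (1 + rho ^+ 2))^-1).
Proof.
move=> sr r1; rewrite /gfun.
set a := (Num.sqrt _)%:C; set b := sqrtc _.
have s1 : 0 < 1 + s ^+ 2 by rewrite ltr_pwDl ?ltr01// sqr_ge0.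
have a2 : a ^+ 2 = 1 + s%:C ^+ 2.
  by rewrite /a -rmorphXn/= sqr_sqrtr ?ltW// rmorphD rmorphXn.
have b2 : b ^+ 2 = 1 + rho ^+ 2 by rewrite /b sqr_sqrtc.
have a0 : a != 0 by rewrite /a eq_complex/= eqxx andbT gt_eqF// sqrtr_gt0.
have b0 : b != 0 by apply: contra r1 => /eqP b0; rewrite -b2 b0 expr0n.
have d : s%:C ^+ 2 - rho ^+ 2 = (a - b) * (a + b).
  by rewrite -subr_sqr a2 b2 opprD addrACA subrr add0r.
have : (a - b) * (a + b) != 0 by rewrite -d subr_eq0.
rewrite mulf_eq0 negb_or => /andP[ab0 ab1].
have ab : a * b != 0 by rewrite mulf_neq0.
apply/esym/(mulfI (mulf_neq0 ab0 ab1)); rewrite d mulrA divff ?mulf_neq0// mul1r.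
rewrite mulrN [a * b * _]mulrC invfM mulrA mulfK//.
apply: (mulIf ab); rewrite mulNr mulfVK//.
by rewrite mulrBl mulrA mulVf// mul1r [a * b]mulrC mulrA mulVf// mul1r opprB.
Qed.

(* A power series is determined by its sum on the real interval ]-1, 1[. *)
Definition is_c_coef (rho : R[i]) (c : nat -> R[i]) : Prop :=
  forall s : R, `|s| < 1 ->
    (fun n => gfun 0 rho * \sum_(k < n) c k * s%:C ^+ (2 * k)) @ \oo
      --> (gfun s rho : (R[i])^o).

Definition c_coef (rho : R[i]) : nat -> R[i] :=
  xget (fun=> 0) [set c | is_c_coef rho c].

Definition d_coef (rho : R[i]) (k : nat) : R[i] :=
  c_coef rho k * (pochhammer (2^-1 : R) k)%:C.

End coefficients.

Record nig (R : Type) := Nig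
  { alpha : R; beta : R; mu : R; delta : R; xvar : R }.

Section nig_cdf.
Context {R : realType}.
Implicit Type p : nig R.
Local Notation leb := (@lebesgue_measure R).

Definition xi p := xvar p - mu p.
Definition gam p := Num.sqrt (alpha p ^+ 2 - beta p ^+ 2).
Definition omega p := Num.sqrt (xi p ^+ 2 + delta p ^+ 2).
Definition zvar p := 2 * alpha p * omega p.
Definition x0 p := mu p + beta p * delta p / gam p.
Definition nu p := atan (delta p / xi p).
Definition tau p := acos (beta p / alpha p).
Definition sigmap p : R[i] := sigmap_of (nu p) (tau p).
Definition sigmam p : R[i] := sigmam_of (nu p) (tau p).

(* The condition 0 < xi p expresses that nu p lies in ]0, pi / 2[. *)
Definition admissible p : Prop :=
  [/\ 0 < alpha p, - alpha p < beta p < alpha p, 0 < delta p & 0 < xi p].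

Definition Fnig p : R :=
  alpha p * delta p * expR (delta p * gam p) / pi *
  \int[leb]_(t in `]-oo, xvar p])
    (besselK 1 (alpha p * Num.sqrt (delta p ^+ 2 + (t - mu p) ^+ 2)) /
       Num.sqrt (delta p ^+ 2 + (t - mu p) ^+ 2) *
     expR (beta p * (t - mu p))).

Definition Fplus p : R :=
  if tau p < nu p then Fp_integral (zvar p) (nu p) (tau p)
  else Fp_continuation (zvar p) (tau p) (nu p).

Definition Fminus p : R := Fm_integral (zvar p) (nu p) (tau p).

Definition zetap p : R := sin ((nu p - tau p) / 2) * Num.sqrt (zvar p).
Definition zetam p : R := sin ((nu p + tau p) / 2) * Num.sqrt (zvar p).

(* f ~ A + B * \sum_k d k / z ^+ k for large z, uniformly on D: each truncation
   error is bounded by a constant, depending only on the truncation order,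
   times the size of the first omitted power. *)
Definition uniform_expansion (D : set (nig R)) (f A B : nig R -> R)
    (d : nig R -> nat -> R[i]) : Prop :=
  forall N : nat, exists M Z : R, forall p, D p -> Z <= zvar p ->
    `| (f p)%:C - ((A p)%:C +
         (B p)%:C * \sum_(k < N) d p k / (zvar p)%:C ^+ k) |
    <= (M * (`|B p| / zvar p ^+ N))%:C.

End nig_cdf.

(* Main.v *)
Require Import Defs.
From HB Require Import structures.
From mathcomp Require Import all_boot all_order all_algebra.
From mathcomp Require Import all_classical all_reals all_analysis.
From mathcomp Require Import complex.
From mathcomp Require Import measurable_realfun ring lra.
Import Order.TTheory GRing.Theory Num.Theory.
Import numFieldNormedType.Exports.
Local Open Scope classical_set_scope.
Local Open Scope ring_scope.

(** Write w = sqrt(1 + s^2).  Everything rests on one function of z and of an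
    angle th,

      angular_cdf z th = erfc(sin th sqrt z) / 2
        - e^(-z sin^2 th) / (2 pi) * int e^(-z s^2) sin th / (w (w + cos th)) ds,

    taken at th = (nu - tau) / 2 for F+ and at th = (nu + tau) / 2, with an
    additional factor e^(2 gam delta), for F-.

    F+ and F-.  With c = cos th and a = sin th one has w^2 - c^2 = s^2 + a^2, so
    that c / ((s^2 + a^2) w) = 1 / (s^2 + a^2) - 1 / (w (w + c)).  The Gaussian
    integral of the first term is an error function (gauss_over_quadratic), and
    this rewrites the integrals defining F+ and F- (Fp_integralE, Fm_integralE).
    The new form has no singularity at th = 0.  Its derivative in the angle is
    an exponential of a cosine times a trigonometric polynomial, whose iterated
    derivatives grow like C^n n!; hence it is analytic, and by the identity
    theorem it is the analytic continuation of F+ (Fp_continuationE).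

    F = F+ + F-.  Along the curve of polar coordinates (omega, nu) described by
    the end point x, differentiation under the integral and one integration by
    parts express the derivative of angular_cdf by the Bessel functions K_0 and
    K_1 (is_derive_angular_cdf).  In the derivative of F+ + F- the terms with K_0
    cancel and those with K_1 form the density; both functions vanish at minus
    infinity (integral_nig_density).

    The expansion.  For 0 < c < 1 the function (1 + c) / (w (w + c)) is a
    Stieltjes integral in s^2.  Its power series in s^2 is therefore alternating
    in a strong sense: the error of N terms is at most s^(2N) for all real s,
    uniformly in c (kernel_expansion_le).  Integration against e^(-z s^2) bounds
    the error by the N-th Gaussian moment, which is sqrt(pi / z) (1/2)_N / z^N
    (pochhammer_half).  For rho = - i sin th the coefficients are the c_k(rho),
    by uniqueness of power series (d_coef_imag), provided that sqrt(1 + rho^2) is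
    cos th, that is cos th >= 0.  For th = (nu - tau) / 2 this holds by the range
    of the angles; for th = (nu + tau) / 2 it follows from |sin th| <= 1/2
    (cos_thetam_gt0).  The constant in the N-th error term is (1/2)_N. *)

(** * Derivatives and continuity of explicit real functions *)

Section deriv_rules.
Context {R : realType}.
Implicit Types (f g : R -> R) (x a b : R).

(** The usual rules of differentiation, each stated for an explicit lambda
    expression and an explicit derivative, so that the tactic deriv below can
    differentiate a closed formula by matching its head symbol and leave only
    an algebraic identity. *)
Lemma is_derive_fun_cst (k x : R) : is_derive x 1 (fun=> k) 0.
Proof. exact: is_derive_cst. Qed.
Lemma is_derive_fun_id (x : R) : is_derive x 1 (fun y => y) 1.
Proof. exact: is_derive_id. Qed.
Lemma is_derive_fun_add f g x a b : is_derive x 1 f a -> is_derive x 1 g b ->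
  is_derive x 1 (fun y => f y + g y) (a + b).
Proof. by move=> ? ?; exact: is_deriveD. Qed.
Lemma is_derive_fun_opp f x a : is_derive x 1 f a -> is_derive x 1 (fun y => - f y) (- a).
Proof. by move=> ?; exact: is_deriveN. Qed.
Lemma is_derive_fun_mul f g x a b : is_derive x 1 f a -> is_derive x 1 g b ->
  is_derive x 1 (fun y => f y * g y) (a * g x + f x * b).
Proof.
move=> fa gb; apply: (is_derive_eq (is_deriveM fa gb)).
by rewrite /GRing.scale/=; ring.
Qed.
Lemma is_derive_fun_comp (h f : R -> R) x a b : is_derive (f x) 1 h b -> is_derive x 1 f a ->
  is_derive x 1 (fun y => h (f y)) (b * a).
Proof. by move=> hb fa; exact: (is_derive1_comp hb fa). Qed.
Lemma is_derive_fun_pow f x a n : is_derive x 1 f a ->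
  is_derive x 1 (fun y => f y ^+ n) (n%:R * f x ^+ n.-1 * a).
Proof.
move=> fa; elim: n => [|n ih].
  rewrite !mul0r; under eq_fun do rewrite expr0.
  exact: is_derive_fun_cst.
have -> : (fun y => f y ^+ n.+1) = (fun y => f y * f y ^+ n).
  by apply/funext => y; rewrite exprS.
apply: (is_derive_eq (is_derive_fun_mul _ _ _ _ _ fa ih)).
case: n {ih} => [|n]; rewrite /= ?expr0; first ring.
by rewrite -[n.+2]addn1 natrD [f x ^+ n.+1]exprS; ring.
Qed.
Lemma is_derive_fun_inv f x a : f x != 0 -> is_derive x 1 f a ->
  is_derive x 1 (fun y => (f y)^-1) (- (f x ^- 2) * a).
Proof. by move=> f0 fa; apply: (is_derive_eq (is_deriveV f0 fa)). Qed.
Lemma is_derive_fun_exp f x a : is_derive x 1 f a ->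
  is_derive x 1 (fun y => expR (f y)) (expR (f x) * a).
Proof. by apply: is_derive_fun_comp; exact: is_derive_expR. Qed.
Lemma is_derive_fun_sin f x a : is_derive x 1 f a ->
  is_derive x 1 (fun y => sin (f y)) (cos (f x) * a).
Proof. by apply: is_derive_fun_comp; exact: is_derive_sin. Qed.
Lemma is_derive_fun_cos f x a : is_derive x 1 f a ->
  is_derive x 1 (fun y => cos (f y)) (- sin (f x) * a).
Proof. by apply: is_derive_fun_comp; exact: is_derive_cos. Qed.
Lemma is_derive_fun_atan f x a : is_derive x 1 f a ->
  is_derive x 1 (fun y => atan (f y)) ((1 + f x ^+ 2)^-1 * a).
Proof. by apply: is_derive_fun_comp; exact: is_derive1_atan. Qed.
Lemma is_derive_fun_sqrt f x a : 0 < f x -> is_derive x 1 f a ->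
  is_derive x 1 (fun y => Num.sqrt (f y)) ((2 * Num.sqrt (f x))^-1 * a).
Proof. by move=> f0; apply: is_derive_fun_comp; exact: is_derive1_sqrt. Qed.
Lemma is_derive_fun_ln f x a : 0 < f x -> is_derive x 1 f a ->
  is_derive x 1 (fun y => ln (f y)) ((f x)^-1 * a).
Proof. by move=> f0; apply: is_derive_fun_comp; exact: is_derive1_ln. Qed.

Lemma is_derive_continuous f x a : is_derive x 1 f a -> {for x, continuous f}.
Proof.
by move=> fa; apply/differentiable_continuous/derivable1_diffP; exact: ex_derive.
Qed.

End deriv_rules.

Ltac deriv_step :=
  lazymatch goal with
  | |- is_derive _ _ (fun=> ?k) _ => exact: is_derive_fun_cst
  | |- is_derive _ _ (fun y => y) _ => exact: is_derive_fun_id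
  | |- is_derive _ _ (GRing.mul ?k) _ =>
      notypeclasses refine (is_derive_fun_mul (fun=> k) (fun y => y) _ _ _ _ _)
  | |- is_derive _ _ (fun y => _ + _) _ => notypeclasses refine (is_derive_fun_add _ _ _ _ _ _ _)
  | |- is_derive _ _ -%R _ => notypeclasses refine (is_derive_fun_opp (fun y => y) _ _ _)
  | |- is_derive _ _ (fun y => - _) _ => notypeclasses refine (is_derive_fun_opp _ _ _ _)
  | |- is_derive _ _ (fun y => _ * _) _ => notypeclasses refine (is_derive_fun_mul _ _ _ _ _ _ _)
  | |- is_derive _ _ (fun y => _ ^+ _) _ => notypeclasses refine (is_derive_fun_pow _ _ _ _ _)
  | |- is_derive _ _ (fun y => (_)^-1) _ => notypeclasses refine (is_derive_fun_inv _ _ _ _ _)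
  | |- is_derive _ _ (fun y => expR _) _ => notypeclasses refine (is_derive_fun_exp _ _ _ _)
  | |- is_derive _ _ (fun y => sin _) _ => notypeclasses refine (is_derive_fun_sin _ _ _ _)
  | |- is_derive _ _ (fun y => cos _) _ => notypeclasses refine (is_derive_fun_cos _ _ _ _)
  | |- is_derive _ _ (fun y => atan _) _ => notypeclasses refine (is_derive_fun_atan _ _ _ _)
  | |- is_derive _ _ (fun y => Num.sqrt _) _ =>
      notypeclasses refine (is_derive_fun_sqrt _ _ _ _ _)
  | |- is_derive _ _ (fun y => ln _) _ => notypeclasses refine (is_derive_fun_ln _ _ _ _ _)
  | |- is_derive _ _ _ _ => eassumption
  end.
(** deriv computes a derivative up to an identity between the two formulas,
    after any side conditions (nonvanishing denominators, positive radicands);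
    continuity_at and continuity reuse it to prove continuity at a point and everywhere,
    since a differentiable function is continuous. *)
Ltac deriv := notypeclasses refine (is_derive_eq _ _); [repeat deriv_step|..]; cbv beta.
Ltac continuity_at := notypeclasses refine (is_derive_continuous _ _ _ _);
  repeat deriv_step; cbv beta.
Ltac continuity := let y := fresh "y" in move=> y; continuity_at.

(** * Integration over the real line *)

Section integration.
Context {R : realType}.
Local Notation mu := (@lebesgue_measure R).
Local Notation integ f := (mu.-integrable [set: R] (EFin \o f)).
Implicit Types (f g F : R -> R) (a b z l m : R).

Lemma continuous_measT f : continuous f -> measurable_fun [set: R] f.
Proof. exact: measurable_realfun.continuous_measurable_fun. Qed.

Lemma integ_le f g : continuous f -> integ g -> (forall x, `|f x| <= g x) ->
  integ f.
Proof.
move=> cf ig fg; apply: (le_integrable _ _ _ ig) => //.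
  by apply/measurable_EFinP; exact: continuous_measT.
by move=> x _ /=; rewrite lee_fin (le_trans (fg x))// ler_norm.
Qed.

Lemma integZ f k : integ f -> integ (fun x => k * f x).
Proof. by move=> fi; exact: (@integrableZl _ _ _ mu _ measurableT k _ fi). Qed.

Lemma integD f g : integ f -> integ g -> integ (fun x => f x + g x).
Proof. by move=> fi gi; exact: (@integrableD _ _ _ mu _ measurableT _ _ fi gi). Qed.

Lemma integB f g : integ f -> integ g -> integ (fun x => f x - g x).
Proof. by move=> fi gi; exact: (@integrableB _ _ _ mu _ measurableT _ _ fi gi). Qed.

Lemma cvgr_idnS : (n.+1%:R : R) @[n --> \oo] --> +oo.
Proof. by rewrite (cvg_shiftS (fun n => n%:R : R)); exact: cvgr_idn. Qed.

(** The fundamental theorem of calculus on the whole line: the integrals over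
    [-n, n] converge to the full integral by dominated convergence. *)
Lemma integral_derivT f F l m : (forall x : R, is_derive x 1 F (f x)) ->
  continuous f -> integ f -> F x @[x --> +oo] --> l -> F x @[x --> -oo] --> m ->
  \int[mu]_x f x = l - m.
Proof.
move=> dF cf intf Fl Fm.
pose f_ n := (EFin \o f) \_ (`[- n%:R, n%:R]%classic).
have fcvg : (\int[mu]_x f_ n x)%E @[n --> \oo] --> (\int[mu]_x (f x)%:E)%E.
  apply: (@dominated_cvg _ _ _ mu setT measurableT f_ (EFin \o f)
    (fun x => `|f x|%:E)) => //.
  - move=> n; apply/(measurable_restrictT _ _).1 => //.
    by apply/measurable_EFinP/measurable_funTS; exact: continuous_measT.
  - move=> x _; apply: cvg_near_cst.
    near=> n; rewrite /f_ patchE ifT// inE/= in_itv/= -ler_norml.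
    by near: n; exact: nbhs_infty_ger.
  - by rewrite (_ : (fun x => _) = (abse \o (EFin \o f)))//; exact: integrable_abse.
  - move=> n x _; rewrite /f_ patchE; case: ifP => //= _.
    by rewrite normr0 lee_fin.
have FE n : (\int[mu]_x f_ n.+1 x)%E = (F n.+1%:R - F (- n.+1%:R))%:E.
  rewrite -integral_mkcond (@continuous_FTC2 _ f F) ?EFinB//.
  - by rewrite ltrNl (lt_trans _ (ltr0Sn _ _))// ltrNl oppr0.
  - exact: continuous_subspaceT.
  - split => [x _|  |].
    + exact: ex_derive.
    + apply: cvg_at_right_filter.
      by apply/differentiable_continuous/derivable1_diffP.
    + apply: cvg_at_left_filter.
      by apply/differentiable_continuous/derivable1_diffP.
  - by move=> x _; rewrite derive1E derive_val.
have Fcvg : (F n.+1%:R - F (- n.+1%:R))%:E @[n --> \oo] --> (l - m)%:E.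
  apply: cvg_EFin; first exact: nearW.
  apply: cvgB.
    have h := (cvg_pinftyP F l).1 Fl; apply: h.
    exact: cvgr_idnS.
  have h := (cvg_ninftyP F m).1 Fm; apply: h.
  apply/cvgNrNy.
  exact: cvgr_idnS.
have fS : (\int[mu]_x f_ n.+1 x)%E @[n --> \oo] --> (\int[mu]_x (f x)%:E)%E.
  by rewrite (cvg_shiftS (fun n => (\int[mu]_x f_ n x)%E)).
move: fS; under eq_fun do rewrite FE; move=> fS.
by rewrite /Rintegral -(cvg_lim _ fS)// (cvg_lim _ Fcvg).
Unshelve. all: end_near. Qed.

(** The integrand is a multiple of the density of a normal law of variance
    1 / (2 z), whose total mass is one. *)
Lemma gauss_scaled z : 0 < z ->
  (\int[mu]_x (expR (- z * x ^+ 2))%:E)%E = (Num.sqrt (pi / z))%:E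
  /\ integ (fun x => expR (- z * x ^+ 2)).
Proof.
(* The standard deviation for which the normal density decays like e^(-z x^2). *)
move=> z0; pose s := (Num.sqrt (2 * z))^-1.
have z20 : 0 < 2 * z by rewrite mulr_gt0.
have s0 : 0 < s by rewrite invr_gt0 sqrtr_gt0.
have s2 : s ^+ 2 = (2 * z)^-1 by rewrite /s exprVn sqr_sqrtr// ltW.
have nE : (fun x => expR (- z * x ^+ 2)) = (fun x => (normal_peak s)^-1 * normal_pdf 0 s x).
  apply/funext => x; rewrite normal_pdfE ?gt_eqF// mulrA mulVf ?mul1r; last first.
    by rewrite gt_eqF// normal_peak_gt0// gt_eqF.
  rewrite /normal_fun subr0 s2; congr expR.
  by rewrite -mulr_natr; field; rewrite gt_eqF.
have int1 : integ (fun x => expR (- z * x ^+ 2)).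
  rewrite nE (_ : EFin \o _ = (fun x => ((normal_peak s)^-1)%:E * (normal_pdf 0 s x)%:E)%E)//.
  by apply: integrableZl => //; exact: integrable_normal_pdf.
split => //.
rewrite (_ : (fun x => _) = (fun x => ((normal_peak s)^-1)%:E * (normal_pdf 0 s x)%:E)%E); last first.
  by apply/funext => x; rewrite (congr1 (fun f => f x) nE) EFinM.
rewrite integralZl//; last exact: integrable_normal_pdf.
rewrite integral_normal_pdf mule1 /normal_peak invrK s2; congr ((Num.sqrt _)%:E).
by rewrite -mulr_natr; field; rewrite gt_eqF.
Qed.

End integration.

(** * Gaussian moments *)

Section gaussian.
Context {R : realType}.
Local Notation mu := (@lebesgue_measure R).
Local Notation integ f := (mu.-integrable [set: R] (EFin \o f)).
Implicit Types (f g F : R -> R) (a b z : R).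

Lemma pow_le_expR (n : nat) z : 0 <= z -> z ^+ n <= n`!%:R * expR z.
Proof.
case: n => [|n] z0; first by rewrite expr0 mul1r -expR0 ler_expR.
rewrite mulrC -ler_pdivrMr ?ltr0n ?fact_gt0//.
by apply: le_trans (expR_ge1Dxn n z0); rewrite lerDr.
Qed.

(** Half of the Gaussian decay absorbs any power of s, because a power of
    z s^2 / 2 is bounded by a multiple of its exponential. *)
Lemma pow_gauss_le (n : nat) z : 0 < z ->
  exists2 C, 0 <= C &
    forall s, `|s| ^+ n * expR (- z * s ^+ 2) <= C * expR (- (z / 2) * s ^+ 2).
Proof.
move=> z0; exists (1 + (2 / z) ^+ n * n`!%:R).
  by rewrite addr_ge0// mulr_ge0// exprn_ge0// divr_ge0// ltW.
move=> s; set y := z / 2 * s ^+ 2.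
have y0 : 0 <= y by rewrite mulr_ge0// ?sqr_ge0// divr_ge0// ltW.
have -> : - z * s ^+ 2 = - y - y by rewrite /y; field.
have -> : - (z / 2) * s ^+ 2 = - y by rewrite /y; field.
rewrite expRD mulrA ler_wpM2r ?expR_ge0//.
rewrite expRN ler_pdivrMr ?expR_gt0//.
apply: (@le_trans _ _ (1 + `|s| ^+ n ^+ 2)).
  have h0 : 0 <= `|s| ^+ n by rewrite exprn_ge0.
  by have := sqr_ge0 (`|s| ^+ n - 1); rewrite !expr2; nra.
rewrite mulrDl mul1r lerD//; first by rewrite -expR0 ler_expR.
rewrite -exprM mulnC exprM real_normK ?num_real//.
have -> : s ^+ 2 = 2 / z * y by rewrite /y; field; rewrite gt_eqF.
rewrite exprMn -mulrA.
apply: ler_wpM2l; last exact: pow_le_expR.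
by rewrite exprn_ge0// divr_ge0// ltW.
Qed.

Lemma cvgy_gauss z : 0 < z -> expR (- z * s ^+ 2) @[s --> +oo] --> (0 : R).
Proof.
move=> z0; under eq_fun do rewrite mulNr.
apply: (cvg_comp (fun s => z * s ^+ 2) (fun y => expR (- y))); last exact: cvgr_expR.
by apply: gt0_cvgMry => //; exact: cvgr_expr2.
Qed.

Lemma cvgNy_gauss z : 0 < z -> expR (- z * s ^+ 2) @[s --> -oo] --> (0 : R).
Proof.
move=> z0; apply/cvgNy_compNP.
rewrite (_ : _ \o _ = (fun s => expR (- z * s ^+ 2))); first exact: cvgy_gauss.
by apply/funext => s /=; rewrite sqrrN.
Qed.

(** Integration by parts in the form used throughout: boundary terms of a
    primitive dominated by a Gaussian vanish. *)
Lemma integral_derivT0 f F C z : 0 < z ->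
  (forall x : R, is_derive x 1 F (f x)) -> continuous f -> integ f ->
  (forall s, `|F s| <= C * expR (- z * s ^+ 2)) -> \int[mu]_x f x = 0.
Proof.
move=> z0 dF cf intf FC.
rewrite -(subrr 0); apply: (@integral_derivT _ f F) => //.
- apply: (@squeeze_cvgr _ _ _ _ (fun s => - (C * expR (- z * s ^+ 2))) (fun s => C * expR (- z * s ^+ 2))).
  + by apply: nearW => s; rewrite -ler_norml.
  + rewrite -oppr0; apply: cvgN; rewrite -[X in _ --> X](mulr0 C).
    by apply: cvgMl_tmp; exact: cvgy_gauss.
  + rewrite -[X in _ --> X](mulr0 C).
    by apply: cvgMl_tmp; exact: cvgy_gauss.
- apply: (@squeeze_cvgr _ _ _ _ (fun s => - (C * expR (- z * s ^+ 2))) (fun s => C * expR (- z * s ^+ 2))).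
  + by apply: nearW => s; rewrite -ler_norml.
  + rewrite -oppr0; apply: cvgN; rewrite -[X in _ --> X](mulr0 C).
    by apply: cvgMl_tmp; exact: cvgNy_gauss.
  + rewrite -[X in _ --> X](mulr0 C).
    by apply: cvgMl_tmp; exact: cvgNy_gauss.
Qed.

Lemma integ_gauss_le f C (n : nat) z : 0 < z -> continuous f ->
  (forall s, `|f s| <= C * `|s| ^+ n * expR (- z * s ^+ 2)) -> integ f.
Proof.
move=> z0 cf fC; have [D D0 HD] := pow_gauss_le n z z0.
have z20 : 0 < z / 2 by rewrite divr_gt0.
apply: (integ_le _ (fun s => (`|C| * D) * expR (- (z / 2) * s ^+ 2))) => //.
  by apply: integZ; exact: (gauss_scaled _ z20).2.
move=> s; rewrite (le_trans (fC s))// -!mulrA.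
apply: (@le_trans _ _ (`|C| * (`|s| ^+ n * expR (- z * s ^+ 2)))).
  by rewrite ler_wpM2r ?ler_norm// mulr_ge0// ?exprn_ge0// expR_ge0.
by rewrite ler_wpM2l.
Qed.

Definition gauss_moment (k : nat) z := \int[mu]_s (s ^+ (2 * k) * expR (- z * s ^+ 2)).

Lemma continuous_gauss_mono (n : nat) z :
  continuous (fun s : R => s ^+ n * expR (- z * s ^+ 2)).
Proof. by continuity. Qed.

Lemma integ_gauss_mono k z : 0 < z -> integ (fun s => s ^+ (2 * k) * expR (- z * s ^+ 2)).
Proof.
move=> z0; apply: (integ_gauss_le _ 1 (2 * k) z z0); first exact: continuous_gauss_mono.
by move=> s; rewrite normrM normrX mul1r (ger0_norm (expR_ge0 _)).
Qed.

Lemma gauss_moment0 z : 0 < z -> gauss_moment 0 z = Num.sqrt (pi / z).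
Proof.
move=> z0; rewrite /gauss_moment; under eq_Rintegral do rewrite muln0 expr0 mul1r.
by rewrite /Rintegral (gauss_scaled _ z0).1.
Qed.

(** The integral of the derivative of s^(2k+1) e^(-z s^2) vanishes. *)
Lemma gauss_momentS k z : 0 < z -> gauss_moment k.+1 z = (k%:R + 2^-1) / z * gauss_moment k z.
Proof.
move=> z0.
pose f (s : R) := (2 * k).+1%:R * (s ^+ (2 * k) * expR (- z * s ^+ 2)) -
   (2 * z) * (s ^+ (2 * k.+1) * expR (- z * s ^+ 2)).
have int0 := integ_gauss_mono k z z0.
have int1 := integ_gauss_mono k.+1 z z0.
have : \int[mu]_s f s = 0.
  have [C C0 HC] := pow_gauss_le (2 * k).+1 z z0.
  apply: (@integral_derivT0 f (fun s => s ^+ (2 * k).+1 * expR (- z * s ^+ 2)) C (z / 2)).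
  - by rewrite divr_gt0.
  - move=> s; deriv; rewrite /f mulnS /= expr1 !exprS; ring.
  - by rewrite /f; continuity.
  - by apply: integB; exact: integZ.
  - by move=> s; rewrite normrM normrX (ger0_norm (expR_ge0 _)); exact: HC.
rewrite RintegralB//; [|exact: integZ..].
rewrite !RintegralZl//.
rewrite -/(gauss_moment k z) -/(gauss_moment k.+1 z) => /eqP; rewrite subr_eq0 => /eqP e.
have : 2 * z != 0 by rewrite mulf_neq0// gt_eqF.
move=> /mulfI; apply; rewrite -e -natr1 natrM; field; by rewrite gt_eqF.
Qed.

End gaussian.

(** * Expansion of the algebraic kernel with remainder *)

Section stieltjes.
Context {R : realType}.
Local Notation mu := (@lebesgue_measure R).
Implicit Types (c u y w : R) (n k : nat).

(** For c < 1 <= w one has 1 / (w (w + c)) = (2 / pi) times the integral of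
    c / ((c^2 + y^2) (w^2 + y^2)) over y >= 0.  With w^2 = 1 + u, expanding
    1 / (1 + y^2 + u) in powers of u / (1 + y^2) under this integral gives a
    geometric series whose coefficients and remainders are all of the present
    form: n counts the extracted powers, and u = 0 gives the coefficients. *)
Definition stieltjes c n u :=
  \int[mu]_(y in `[0, +oo[)
    (c / ((c ^+ 2 + y ^+ 2) * (1 + y ^+ 2) ^+ n * (1 + y ^+ 2 + u))).

Lemma sqrD_gt0 a y : 0 < a -> 0 < a + y ^+ 2 :> R.
Proof. by move=> a0; rewrite ltr_pwDl// sqr_ge0. Qed.

Lemma continuous_stieltjes_kernel c n u : 0 < c -> 0 <= u -> continuous (fun y : R =>
  c / ((c ^+ 2 + y ^+ 2) * (1 + y ^+ 2) ^+ n * (1 + y ^+ 2 + u))).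
Proof.
move=> c0 u0; continuity.
have y1 := sqrD_gt0 1 y ltr01.
have yc := sqrD_gt0 (c ^+ 2) y (exprn_gt0 2 c0).
by rewrite !mulf_neq0// ?expf_neq0 ?gt_eqF// ltr_pwDl.
Qed.

Lemma integrable_stieltjes_kernel c n u : 0 < c -> 0 <= u ->
  mu.-integrable `[0, +oo[ (EFin \o (fun y : R =>
    c / ((c ^+ 2 + y ^+ 2) * (1 + y ^+ 2) ^+ n * (1 + y ^+ 2 + u)))).
Proof.
move=> c0 u0.
have i1 : mu.-integrable `[0, +oo[ (EFin \o (fun y : R => (oneDsqr y)^-1)).
  apply/integrableP; split.
    apply/measurable_EFinP/measurable_funTS; apply: continuous_measT.
    exact: continuous_oneDsqrV.
  under eq_integral => y _ do rewrite /= ger0_norm ?invr_ge0 ?oneDsqr_ge0//.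
  by rewrite integral0y_oneDsqr ltry.
apply: (@le_integrable _ _ _ mu _ _ _ (EFin \o (fun y : R => c^-1 * (oneDsqr y)^-1))) => //.
- apply/measurable_EFinP/measurable_funTS; apply: continuous_measT.
  exact: continuous_stieltjes_kernel.
- move=> y _ /=; rewrite lee_fin.
  have y1 := sqrD_gt0 1 y ltr01.
  have yc := sqrD_gt0 (c ^+ 2) y (exprn_gt0 2 c0).
  have yu : 0 < 1 + y ^+ 2 + u by rewrite ltr_pwDl.
  rewrite !ger0_norm//; first last.
  + by rewrite divr_ge0 ?(ltW c0)// !mulr_ge0// ?exprn_ge0// ltW.
  + by rewrite mulr_ge0 ?invr_ge0 ?oneDsqr_ge0// ltW.
  rewrite /oneDsqr -invfM -[leRHS]mul1r ler_pdivrMr ?mulr_gt0 ?exprn_gt0//.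
  rewrite mul1r mulrC ler_pdivlMr ?mulr_gt0//.
  rewrite mulrA -expr2.
  apply: (@le_trans _ _ ((c ^+ 2 + y ^+ 2) * (1 + y ^+ 2 + u))).
    by rewrite ler_pM ?sqr_ge0 ?(ltW y1)// lerDl// sqr_ge0.
  rewrite [leRHS]mulrAC ler_peMr ?mulr_ge0 ?(ltW yc) ?(ltW yu)//.
  by rewrite exprn_ege1// lerDl sqr_ge0.
- exact: (@integrableZl _ _ _ mu _ _ c^-1 _ i1).
Qed.

Lemma stieltjes_ge0 c n u : 0 < c -> 0 <= u -> 0 <= stieltjes c n u.
Proof.
move=> c0 u0; apply: Rintegral_ge0 => y _.
by rewrite divr_ge0 ?(ltW c0)// !mulr_ge0// ?exprn_ge0// ?addr_ge0 ?sqr_ge0.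
Qed.

(** One step of the geometric expansion,
    1 / (v + u) = 1 / v - u / (v (v + u)) with v = 1 + y^2. *)
Lemma stieltjesS c n u : 0 < c -> 0 <= u ->
  stieltjes c n u = stieltjes c n 0 - u * stieltjes c n.+1 u.
Proof.
move=> c0 u0; rewrite /stieltjes -RintegralZl//; last exact: integrable_stieltjes_kernel.
rewrite -RintegralB//; last 2 first.
- exact: integrable_stieltjes_kernel.
- exact: (@integrableZl _ _ _ mu _ _ u _ (integrable_stieltjes_kernel c n.+1 u c0 u0)).
apply: eq_Rintegral => y _.
have y1 := sqrD_gt0 1 y ltr01.
have yc := sqrD_gt0 (c ^+ 2) y (exprn_gt0 2 c0).
rewrite [(1 + y ^+ 2) ^+ n.+1]exprS addr0; set X := (1 + y ^+ 2) ^+ n.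
have X0 : X != 0 by rewrite expf_neq0 ?gt_eqF.
field.
by rewrite X0 !gt_eqF// ltr_pwDl.
Qed.

Lemma stieltjes_le c n u : 0 < c -> 0 <= u -> stieltjes c n u <= stieltjes c 0 0.
Proof.
move=> c0 u0; apply: le_Rintegral => //; try exact: integrable_stieltjes_kernel.
move=> y _.
have y1 := sqrD_gt0 1 y ltr01.
have yc := sqrD_gt0 (c ^+ 2) y (exprn_gt0 2 c0).
have yu : 0 < 1 + y ^+ 2 + u by rewrite ltr_pwDl.
rewrite ler_pM2l// addr0 lef_pV2 ?posrE ?mulr_gt0 ?exprn_gt0//.
rewrite expr0 mulr1 ler_pM// ?mulr_ge0 ?(ltW yc) ?(ltW y1)//; last by rewrite lerDl.
by rewrite ler_pMr// exprn_ege1// lerDl sqr_ge0.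
Qed.

(** The integral representation itself, by partial fractions and two
    arctangents; c < 1 keeps w^2 - c^2 away from zero. *)
Lemma stieltjes0 c u : 0 < c < 1 -> 0 <= u ->
  stieltjes c 0 u = pi / 2 / (Num.sqrt (1 + u) * (Num.sqrt (1 + u) + c)).
Proof.
move=> /andP[c0 c1] u0; set w := Num.sqrt (1 + u).
have w2 : w ^+ 2 = 1 + u by rewrite sqr_sqrtr// addr_ge0.
have w0 : 0 < w by rewrite sqrtr_gt0 ltr_pwDl.
have w1 : 1 <= w by rewrite -sqrtr1 ler_wsqrtr// lerDl.
have cw : w ^+ 2 - c ^+ 2 != 0.
  by rewrite subr_sqr mulf_neq0// gt_eqF ?subr_gt0 ?addr_gt0 ?(lt_le_trans c1 w1).
have wc0 : w + c != 0 by rewrite gt_eqF// addr_gt0.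
pose F (y : R) := c / (w ^+ 2 - c ^+ 2) * (c^-1 * atan (c^-1 * y) - w^-1 * atan (w^-1 * y)).
have dF y : is_derive y 1 F
    (c / ((c ^+ 2 + y ^+ 2) * (1 + y ^+ 2) ^+ 0 * (1 + y ^+ 2 + u))).
  rewrite /F; deriv.
  have -> : 1 + y ^+ 2 + u = w ^+ 2 + y ^+ 2 by rewrite w2 addrAC.
  have yc := sqrD_gt0 (c ^+ 2) y (exprn_gt0 2 c0).
  have yw := sqrD_gt0 (w ^+ 2) y (exprn_gt0 2 w0).
  field; rewrite cw !gt_eqF//=.
have Fl : F y @[y --> +oo] --> c / (w ^+ 2 - c ^+ 2) * (c^-1 * (pi / 2) - w^-1 * (pi / 2)).
  have at_ (a : R) : 0 < a -> atan (a^-1 * y) @[y --> +oo] --> (pi / 2 : R).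
    move=> a0; apply: (@cvg_comp _ _ _ (fun y => a^-1 * y) atan _ +oo); last exact: cvgy_atan.
    by apply: gt0_cvgMry; rewrite ?invr_gt0//; exact: cvg_id.
  by apply: cvgMl_tmp; apply: cvgB; apply: cvgMl_tmp; exact: at_.
rewrite /stieltjes (@Rintegral_ge0_continuous_FTC2y _ _ F _ _ _ _ Fl).
- by rewrite /F !mulr0 atan0; field; rewrite cw wc0 !gt_eqF.
- by move=> y _; rewrite divr_ge0 ?(ltW c0)// !mulr_ge0// ?exprn_ge0// ?addr_ge0 ?sqr_ge0.
- by apply: continuous_subspaceT; exact: continuous_stieltjes_kernel.
- by move=> y _; exact: ex_derive.
- by apply: cvg_at_right_filter; exact: (is_derive_continuous _ _ _ (dF 0)).
- by move=> y _; rewrite derive1E derive_val.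
Qed.

Definition kernel_coef c k := (2 / pi) * (1 + c) * (-1) ^+ k * stieltjes c k 0.

Lemma kernel_expansion c n u : 0 < c < 1 -> 0 <= u ->
  (1 + c) / (Num.sqrt (1 + u) * (Num.sqrt (1 + u) + c)) =
  \sum_(k < n) kernel_coef c k * u ^+ k +
    (2 / pi) * (1 + c) * (- u) ^+ n * stieltjes c n u.
Proof.
move=> c01 u0; have c0 : 0 < c by case/andP: c01.
have w0 : 0 < Num.sqrt (1 + u) by rewrite sqrtr_gt0 ltr_pwDl.
elim: n => [|n ->].
  rewrite big_ord0 add0r expr0 stieltjes0//.
  move: (@pi R) (pi_gt0 R) => p p0; field.
  by rewrite !gt_eqF ?addr_gt0.
rewrite big_ord_recr /= -addrA; congr (_ + _).
by rewrite stieltjesS// /kernel_coef exprS [(- u) ^+ n]exprNn; ring.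
Qed.

(** The remainder is (- u)^n times an integral that is at most its value at
    n = 0 and u = 0, which the factor (2 / pi) (1 + c) normalises to one.  Hence the error of n terms is at most u^n, uniformly in c and for all
    u >= 0, even beyond the radius of convergence. *)
Lemma kernel_expansion_le c n u : 0 < c < 1 -> 0 <= u ->
  `|(1 + c) / (Num.sqrt (1 + u) * (Num.sqrt (1 + u) + c)) -
    \sum_(k < n) kernel_coef c k * u ^+ k| <= u ^+ n.
Proof.
move=> c01 u0; have c0 : 0 < c by case/andP: c01.
rewrite (kernel_expansion c n u)// addrAC subrr add0r.
have p0 : 0 <= (2 / pi) * (1 + c) :> R.
  by rewrite mulr_ge0 ?divr_ge0 ?pi_ge0// addr_ge0// ltW.
rewrite normrM (ger0_norm (stieltjes_ge0 _ _ _ c0 u0)) normrM (ger0_norm p0).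
rewrite normrX normrN (ger0_norm u0) mulrAC -[leRHS]mul1r ler_wpM2r ?exprn_ge0//.
apply: le_trans (ler_wpM2l p0 (stieltjes_le c n u c0 u0)) _.
rewrite stieltjes0// addr0 sqrtr1 mul1r le_eqVlt; apply/orP; left; apply/eqP.
move: (@pi R) (pi_gt0 R) => p p1; field.
by rewrite !gt_eqF ?addr_gt0.
Qed.

End stieltjes.

(** * Uniqueness of the coefficients of a power series *)

Section power_series.
Context {R : realType}.
Implicit Types (c a : nat -> R) (h e : R).

Lemma sum_geometric_le2 (x : R) m : 0 <= x <= 2^-1 -> \sum_(i < m) x ^+ i <= 2.
Proof.
move=> /andP[x0 x1]; elim: m => [|m ih]; first by rewrite big_ord0.
rewrite big_ord_recl expr0.
under eq_bigr do rewrite /= exprS.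
by rewrite -mulr_sumr; nra.
Qed.

(** By strong induction on k: once the coefficients below k vanish, the bound
    on c j h0^j at a fixed h0 makes the tail of the series O(h^(k+1)), while
    its sum is zero, so c k h^k is O(h^(k+1)) as h tends to zero. *)
Lemma power_series_eq0 c e : 0 < e ->
  (forall h, 0 < h < e -> series (fun k => c k * h ^+ k) @ \oo --> (0 : R)) ->
  forall k, c k = 0.
Proof.
move=> e0 cv.
pose h0 := e / 2; have h00 : 0 < h0 by rewrite divr_gt0.
have [M M0 HM] : exists2 M : R, 0 < M & forall j, `|c j * h0 ^+ j| <= M.
  have : 0 < h0 < e by rewrite h00 /h0 gtr_pMr// invf_lt1// ltr1n.
  move=> /cv cvh0.
  have /cvg_series_cvg_0 cv0 : cvgn (series (fun k => c k * h0 ^+ k)) by apply/cvg_ex; exists 0.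
  have : cvgn (fun k => c k * h0 ^+ k) by apply/cvg_ex; exists 0.
  move=> /cvg_seq_bounded/pinfty_ex_gt0[M M0 HM]; exists M => // j.
  exact: HM.
move=> k; elim/ltn_ind: k => k ih.
have bnd h : 0 < h <= h0 / 2 -> `|c k * h ^+ k| <= 2 * M * (h / h0) ^+ k.+1.
  move=> /andP[h_gt0 hh0]; set x := h / h0.
  have x01 : 0 <= x <= 2^-1.
    by rewrite divr_ge0 ?(ltW h_gt0) ?(ltW h00)//= ler_pdivrMr// mulrC.
  have x0 : 0 <= x by case/andP: x01.
  have hx : h = h0 * x by rewrite /x; field; rewrite gt_eqF.
  have Sb m : `|series (fun j => c j * h ^+ j) (m + k.+1)%N - c k * h ^+ k| <=
      M * x ^+ k.+1 * \sum_(i < m) x ^+ i.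
    elim: m => [|m ihm].
      rewrite big_ord0 mulr0 add0n seriesEnat /= big_nat_recr//= big_nat big1 ?add0r ?subrr ?normr0//.
      by move=> i /= ik; rewrite ih ?mul0r.
    rewrite addSn seriesEnat /= big_nat_recr//= big_ord_recr/= mulrDr addrAC.
    apply: le_trans (ler_normD _ _) _; apply: lerD; first by move: ihm; rewrite seriesEnat.
    rewrite hx exprMn mulrA normrM (ger0_norm (exprn_ge0 _ x0)).
    by rewrite -mulrA -exprD addnC ler_wpM2r// exprn_ge0.
  apply/ler_addgt0Pr => d d0.
  have hlt : 0 < h < e.
    rewrite h_gt0 (le_lt_trans hh0)// /h0 -mulrA -invfM -natrM.
    by rewrite gtr_pMr// invf_lt1// ltr1n.
  have /cvgr0Pnorm_le/(_ d d0)[N _ HN] := cv h hlt.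
  have := HN (N + k.+1)%N (leq_addr _ _); have := Sb N.
  set S := series _ _ => S1 S2.
  have S3 : M * x ^+ k.+1 * \sum_(i < N) x ^+ i <= 2 * M * x ^+ k.+1.
    have := sum_geometric_le2 x N x01; have : 0 <= M * x ^+ k.+1 by rewrite mulr_ge0 ?exprn_ge0// ltW.
    by move=> ? ?; nra.
  have -> : c k * h ^+ k = S - (S - c k * h ^+ k) by rewrite opprB addrC subrK.
  by rewrite (le_trans (ler_normB _ _))// addrC lerD// (le_trans S1).
apply/eqP; rewrite -normr_le0; apply/ler_addgt0Pr => d d0; rewrite add0r.
(* Choosing h below d / K turns the bound K h^(k+1) on |c k h^k| into
   |c k| <= d. *)
pose K := 2 * M / h0 ^+ k.+1.
have K0 : 0 < K by rewrite divr_gt0 ?mulr_gt0 ?exprn_gt0.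
pose h := Num.min (h0 / 2) (d / K).
have hgt0 : 0 < h by rewrite /h lt_min (divr_gt0 h00)//= (divr_gt0 d0 K0).
have hle : h <= h0 / 2 by rewrite /h ge_min lexx.
have hK : K * h <= d by rewrite mulrC -ler_pdivlMr// /h ge_min lexx orbT.
have := bnd h; rewrite hgt0 hle => /(_ isT).
rewrite normrM normrX (gtr0_norm hgt0) expr_div_n [h ^+ k.+1]exprS.
have -> : 2 * M * (h * h ^+ k / h0 ^+ k.+1) = K * h * h ^+ k.
  by rewrite /K; ring.
by rewrite ler_pM2r ?exprn_gt0// => /le_trans; apply.
Qed.

End power_series.

Section real_complex.
Context {R : realType}.
Local Open Scope complex_scope.
Local Notation C := (R[i]).

Lemma normcR (x : R) : `|x%:C| = `|x|%:C :> C.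
Proof. by rewrite normc_def/= expr0n/= addr0 sqrtr_sqr. Qed.

Lemma cvg_realC (u : nat -> R) (l : R) : u @ \oo --> l ->
  (fun n => (u n)%:C) @ \oo --> (l%:C : C^o).
Proof.
move=> ul; apply/(@cvgrPdist_lt _ (C^o)) => /= -[d d'] d0.
have /andP[/eqP d'0 dpos] : (d' == 0) && (0 < d) by move: d0; rewrite ltcE/=.
move/cvgrPdist_lt : ul => /(_ d dpos); apply: filterS => n.
by rewrite -rmorphB/= normcR d'0 ltcR.
Qed.

Lemma cvg_complex_Re (u : nat -> C) (l : C) : u @ \oo --> (l : C^o) ->
  (fun n => complex.Re (u n)) @ \oo --> complex.Re l.
Proof.
move=> /(@cvgrPdist_lt _ (C^o)) ul; apply/cvgrPdist_lt => d d0.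
have d0' : 0 < d%:C :> C by rewrite ltcR.
have := ul _ d0'; apply: filterS => n /=.
rewrite normc_def ltcR => /(le_lt_trans _); apply.
rewrite -sqrtr_sqr ler_wsqrtr//; case: (u n) (l) => [a b] [a' b'] /=.
by rewrite lerDl sqr_ge0.
Qed.

Lemma cvg_complex_Im (u : nat -> C) (l : C) : u @ \oo --> (l : C^o) ->
  (fun n => complex.Im (u n)) @ \oo --> complex.Im l.
Proof.
move=> /(@cvgrPdist_lt _ (C^o)) ul; apply/cvgrPdist_lt => d d0.
have d0' : 0 < d%:C :> C by rewrite ltcR.
have := ul _ d0'; apply: filterS => n /=.
rewrite normc_def ltcR => /(le_lt_trans _); apply.
rewrite -sqrtr_sqr ler_wsqrtr//; case: (u n) (l) => [a b] [a' b'] /=.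
by rewrite lerDr sqr_ge0.
Qed.

End real_complex.

Section coefficients.
Context {R : realType}.
Local Open Scope complex_scope.
Local Notation C := (R[i]).

(** The coefficients c_coef are chosen among the sequences that represent gfun,
    so it suffices to exhibit one real sequence a and to show uniqueness.
    Substituting s = sqrt h turns the even series into a power series in h,
    whose real and imaginary parts are handled separately. *)
Lemma c_coefE (rho : C) (a : nat -> R) (H : R -> R) :
  gfun 0 rho != 0 ->
  (forall s, `|s| < 1 -> gfun s rho = gfun 0 rho * (H s)%:C) ->
  (forall s, `|s| < 1 ->
     (fun n => \sum_(k < n) a k * s ^+ (2 * k)) @ \oo --> H s) ->
  forall k, c_coef rho k = (a k)%:C.
Proof.
move=> g0 gH aH.
have sumC s n : \sum_(k < n) (a k)%:C * s%:C ^+ (2 * k) =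
    (\sum_(k < n) a k * s ^+ (2 * k))%:C.
  by rewrite rmorph_sum/=; apply: eq_bigr => i _; rewrite rmorphM rmorphXn.
have ex : is_c_coef rho (fun k => (a k)%:C).
  move=> s s1; rewrite (gH s s1).
  rewrite (_ : (fun n => _) = (fun n => gfun 0 rho *
    (\sum_(k < n) a k * s ^+ (2 * k))%:C)); last by apply/funext => n; rewrite sumC.
  by apply: (@cvgMl_tmp C); exact: cvg_realC (aH s s1).
have := @xgetPex _ (fun=> 0) [set c | is_c_coef rho c] (ex_intro _ _ ex).
rewrite -/(c_coef rho) /= => cc.
have lim s : `|s| < 1 ->
    (fun n => \sum_(k < n) c_coef rho k * s%:C ^+ (2 * k)) @ \oo --> ((H s)%:C : C^o).
  move=> s1.
  rewrite (_ : (fun n => _) = (fun n => (gfun 0 rho)^-1 *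
    (gfun 0 rho * \sum_(k < n) c_coef rho k * s%:C ^+ (2 * k)))); last first.
    by apply/funext => n; rewrite mulrA mulVf// mul1r.
  rewrite (_ : (H s)%:C = (gfun 0 rho)^-1 * gfun s rho); last first.
    by rewrite (gH s s1) mulrA mulVf// mul1r.
  by apply: (@cvgMl_tmp C); exact: cc.
have ReM (x : C) (s : R) n : complex.Re (x * s%:C ^+ n) = complex.Re x * s ^+ n.
  by rewrite -rmorphXn; case: x => x y; simpc.
have ImM (x : C) (s : R) n : complex.Im (x * s%:C ^+ n) = complex.Im x * s ^+ n.
  by rewrite -rmorphXn; case: x => x y; simpc.
have sqrt_lt1 h : 0 < h < 1 -> `|Num.sqrt h| < 1 /\ forall k, Num.sqrt h ^+ (2 * k) = h ^+ k.
  move=> /andP[h0 h1]; split; last by move=> k; rewrite exprM sqr_sqrtr// ltW.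
  by rewrite ger0_norm// -sqrtr1 ltr_sqrt.
have Re0 := power_series_eq0 (fun k => complex.Re (c_coef rho k) - a k) 1 ltr01.
have Im0 := power_series_eq0 (fun k => complex.Im (c_coef rho k)) 1 ltr01.
move=> k; apply/eqP; rewrite eq_complex/= -subr_eq0 Re0 ?Im0 ?eqxx//.
- move=> h /sqrt_lt1[sh shE]; have /cvg_complex_Im := lim _ sh.
  rewrite /= seriesEord; apply: cvg_trans; apply: near_eq_cvg; apply: nearW => n.
  by rewrite raddf_sum/=; apply: eq_bigr => i _; rewrite ImM shE.
- move=> h /sqrt_lt1[sh shE].
  have /cvg_complex_Re h1 := lim _ sh.
  have h2 := cvgB h1 (aH _ sh); rewrite /= subrr in h2.
  rewrite (_ : series _ = (fun n : nat =>
    complex.Re (\sum_(k < n) c_coef rho k * (Num.sqrt h)%:C ^+ (2 * k))) -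
    (fun n : nat => \sum_(k < n) a k * Num.sqrt h ^+ (2 * k))); first exact: h2.
  rewrite seriesEord; apply/funext => n; rewrite !fctE /= raddf_sum/= -sumrB.
  by apply: eq_bigr => i _; rewrite ReM shE mulrBl.
Qed.

End coefficients.

(** * The Gamma function at half-integers *)

Section gamma_half.
Context {R : realType}.
Local Notation mu := (@lebesgue_measure R).

(** The change of variables t = s^2 in the Gamma integral has a singular
    derivative at the origin; it is carried out on half-lines that stay away
    from zero and increase to the open half-line, which is described here for
    an arbitrary left end point r. *)
Lemma bigcup_itvV (r : R -> R) : (forall e, 0 < e -> 0 < r e) ->
  (forall e d, 0 < e -> e <= d -> r e <= r d) ->
  (forall x, 0 < x -> exists2 e, 0 < e & r e <= x) ->
  \bigcup_n `[r (n.+1%:R^-1), +oo[%classic = `]0, +oo[%classic.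
Proof.
move=> r0 rmono rx; apply/seteqP; split => [x [n _]|x] /=; rewrite !in_itv/= !andbT.
  by apply: lt_le_trans; rewrite r0// invr_gt0 ltr0n.
move=> /rx[e e0 ex].
have [n ne] : exists n : nat, e^-1 <= n.+1%:R.
  have e1 : 0 <= e^-1 by rewrite invr_ge0 ltW.
  by exists (Num.bound e^-1); rewrite (le_trans (ltW (archi_boundP e1)))// ler_nat.
exists n => //=; rewrite in_itv/= andbT (le_trans _ ex)// rmono ?invr_gt0 ?ltr0n//.
by rewrite invf_ple ?posrE ?invr_gt0 ?ltr0n.
Qed.

Lemma cvg_integral_itvV (r g : R -> R) : (forall e, 0 < e -> 0 < r e) ->
  (forall e d, 0 < e -> e <= d -> r e <= r d) ->
  (forall x, 0 < x -> exists2 e, 0 < e & r e <= x) ->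
  measurable_fun [set: R] g -> (forall x, 0 < x -> 0 <= g x) ->
  (\int[mu]_(x in `[r ((n.+1%:R)^-1)%R, +oo[) (g x)%:E)%E @[n --> \oo] -->
  (\int[mu]_(x in `]0%R, +oo[) (g x)%:E)%E.
Proof.
move=> r0 rmono rx mg g0; rewrite -(bigcup_itvV r)//.
apply: ge0_nondecreasing_set_cvg_integral => //.
- move=> n m nm; rewrite subsetEset => x /=; rewrite !in_itv/= !andbT.
  apply: le_trans; apply: rmono; first by rewrite invr_gt0 ltr0n.
  by rewrite lef_pV2 ?posrE ?ltr0n// ler_nat.
- by move=> n; apply/measurable_EFinP/measurable_funTS.
- move=> n x /=; rewrite in_itv/= andbT => rnx; rewrite lee_fin g0//.
  by rewrite (lt_le_trans _ rnx)// r0// invr_gt0 ltr0n.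
Qed.

Lemma cvgy_sqrt : Num.sqrt (t : R) @[t --> +oo] --> +oo.
Proof.
apply/cvgryPge => A; near=> t.
rewrite (le_trans (ler_norm A))// -sqrtr_sqr ler_wsqrtr//.
Unshelve. all: end_near. Qed.

Lemma half_gauss_subst (k : nat) (e : R) : 0 < e ->
  (\int[mu]_(s in `[Num.sqrt e, +oo[) (2 * (s ^+ (2 * k) * expR (- s ^+ 2)))%:E =
   \int[mu]_(t in `[e, +oo[) (t `^ (2^-1 + k%:R - 1) * expR (- t))%:E)%E.
Proof.
move=> e0.
have dS (t : R) : 0 < t -> is_derive t (1 : R) (@Num.sqrt R) (2 * Num.sqrt t)^-1.
  exact: is_derive1_sqrt.
have dSE (t : R) : 0 < t -> derive1 (@Num.sqrt R) t = (2 * Num.sqrt t)^-1.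
  by move=> t0; rewrite derive1E; apply: derive_val; exact: dS.
have cV (t : R) : 0 < t -> (2 * Num.sqrt s)^-1 @[s --> t] --> (2 * Num.sqrt t)^-1.
  move=> t0; apply: cvgV; first by rewrite mulf_neq0// gt_eqF// sqrtr_gt0.
  by apply: cvgMl_tmp; exact: sqrt_continuous.
have cG : continuous (fun s : R => 2 * (s ^+ (2 * k) * expR (- s ^+ 2))).
  by continuity.
rewrite (@increasing_ge0_integration_by_substitutiony _ (@Num.sqrt R)
  (fun s => 2 * (s ^+ (2 * k) * expR (- s ^+ 2)))).
- apply: eq_integral => t; rewrite inE/= in_itv/= andbT => et.
  have t0 : 0 < t by exact: lt_le_trans et.
  rewrite !fctE dSE// exprM sqr_sqrtr ?ltW//; congr EFin.
  rewrite (addrC 2^-1) -addrA (_ : 2^-1 - 1 = - 2^-1); last by field.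
  rewrite powRD; last by rewrite (gt_eqF t0) implybT.
  rewrite powR_mulrn ?ltW// powRN powR12_sqrt ?ltW//; field.
  by rewrite gt_eqF// sqrtr_gt0.
- by move=> x y; rewrite !in_itv/= !andbT => xe ye xy; rewrite ltr_sqrt// (lt_le_trans e0)// (le_trans xe)// ltW.
- move=> x; rewrite in_itv/= andbT => ex; have x0 := lt_trans e0 ex.
  rewrite /prop_for /continuous_at dSE//; apply: cvg_trans (cV x x0); apply: near_eq_cvg.
  near=> y; rewrite dSE//; near: y; exact: lt_nbhsr.
- have h : derive1 (@Num.sqrt R) x @[x --> e^'+] --> ((2 * Num.sqrt e)^-1 : R).
    apply: cvg_at_right_filter.
    apply: cvg_trans (cV e e0); apply: near_eq_cvg.
    near=> y; rewrite dSE//; near: y; exact: lt_nbhsr.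
  exact: (cvgP _ h).
- have h : derive1 (@Num.sqrt R) t @[t --> +oo] --> (0 : R).
    have : (2 * Num.sqrt t)^-1 @[t --> +oo] --> (0 : R).
      apply/gtr0_cvgV0; first by near=> y; rewrite mulr_gt0// sqrtr_gt0; near: y; exact: nbhs_pinfty_gt.
      by apply: gt0_cvgMry => //; exact: cvgy_sqrt.
    apply: cvg_trans; apply: near_eq_cvg; near=> y; rewrite dSE//; near: y; exact: nbhs_pinfty_gt.
  exact: (cvgP _ h).
- split; first by move=> x; rewrite in_itv/= andbT => ex; have dx := dS x (lt_trans e0 ex); exact: ex_derive.
  by apply: cvg_at_right_filter; exact: sqrt_continuous.
- exact: cvgy_sqrt.
- exact: continuous_subspaceT.
- by move=> x _; rewrite !mulr_ge0// ?expR_ge0// exprM exprn_ge0// sqr_ge0.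
Unshelve. all: end_near. Qed.

(** Substituting t = s^2 in the Gamma integral gives an even Gaussian
    moment. *)
Lemma Gamma_half (k : nat) : Gamma (2^-1 + k%:R : R) = gauss_moment k 1.
Proof.
have cf : continuous (fun s : R => s ^+ (2 * k) * expR (- 1 * s ^+ 2)).
  exact: continuous_gauss_mono.
have cf2 : continuous (fun s : R => 2 * (s ^+ (2 * k) * expR (- s ^+ 2))) by continuity.
have f0 (s : R) : 0 <= s ^+ (2 * k) * expR (- 1 * s ^+ 2).
  by rewrite mulr_ge0 ?expR_ge0// exprM exprn_ge0// sqr_ge0.
rewrite /Gamma /gauss_moment /Rintegral ge0_symfun_integralT//; last first.
  by move=> s /=; rewrite exprM [in RHS]exprM sqrrN.
rewrite -set_itvcy -integral_itv_obnd_cbnd; last first.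
  by apply/measurable_EFinP/measurable_funTS; exact: continuous_measT.
rewrite -ge0_integralZl//; last 2 first.
- by apply/measurable_EFinP/measurable_funTS; exact: continuous_measT.
- by move=> s _; rewrite lee_fin.
congr fine; under [RHS]eq_integral => s _ do rewrite -EFinM mulN1r.
have pm : measurable_fun [set: R] (fun t : R => t `^ (2^-1 + k%:R - 1) * expR (- t)).
  by apply: measurable_funM; [exact: measurable_powR|apply: measurableT_comp => //; exact: measurableT_comp].
have L1 := cvg_integral_itvV id (fun t => t `^ (2^-1 + k%:R - 1) * expR (- t))
  (fun e e0 => e0) (fun e d _ ed => ed) (fun x x0 => ex_intro2 _ _ x x0 (lexx x)) pm.
have L2 := cvg_integral_itvV Num.sqrt (fun s => 2 * (s ^+ (2 * k) * expR (- s ^+ 2))).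
apply: (cvg_unique _ (L1 _)) => //.
  by move=> x x0; rewrite mulr_ge0 ?powR_ge0 ?expR_ge0.
rewrite (_ : (fun n : nat => _) = (fun n : nat => (\int[mu]_(s in
  `[Num.sqrt ((n.+1%:R)^-1)%R, +oo[) (2 * (s ^+ (2 * k) * expR (- s ^+ 2)))%:E)%E)); last first.
  by apply/funext => n; rewrite half_gauss_subst// invr_gt0 ltr0n.
apply: L2; last 2 first.
- exact: continuous_measT.
- by move=> x _; rewrite !mulr_ge0// ?expR_ge0// exprM exprn_ge0// sqr_ge0.
- by move=> e e0; rewrite sqrtr_gt0.
- by move=> e d _ ed; rewrite ler_wsqrtr.
- by move=> x x0; exists (x ^+ 2); rewrite ?exprn_gt0// sqrtr_sqr ger0_norm// ltW.
Qed.

(** Gaussian moments are the source of the factor (1/2)_k / z^k that turns the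
    coefficients c_k into d_k. *)
Lemma pochhammer_half (k : nat) (z : R) : 0 < z ->
  gauss_moment k z = Num.sqrt (pi / z) * (pochhammer (2^-1) k / z ^+ k).
Proof.
move=> z0; have p1 : 0 < Num.sqrt (pi / 1 : R) by rewrite sqrtr_gt0 divr1 pi_gt0.
rewrite /pochhammer Gamma_half -[in Gamma _](addr0 2^-1) (Gamma_half 0) gauss_moment0//.
elim: k => [|k ih]; first by rewrite !gauss_moment0// divff ?gt_eqF// expr0 divr1 mulr1.
rewrite !gauss_momentS// ih exprS divr1.
move: (Num.sqrt (pi / 1)) (Num.sqrt (pi / z)) (gauss_moment k 1) p1 => a b g a0.
by field; rewrite !gt_eqF// ?exprn_gt0// sqrtr_gt0 pi_gt0.
Qed.

End gamma_half.

(** * The Gaussian integral of the algebraic kernel *)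

Section expansion.
Context {R : realType}.
Local Notation mu := (@lebesgue_measure R).
Local Notation integ f := (mu.-integrable [set: R] (EFin \o f)).
Implicit Types (s z c : R).

(** The factor 1 / wt s is the weight in the integrals defining F+ and F-. *)
Definition wt (s : R) : R := Num.sqrt (1 + s ^+ 2).

Lemma wt_gt0 s : 0 < wt s. Proof. by rewrite sqrtr_gt0 sqrD_gt0. Qed.
Lemma wt_ge1 s : 1 <= wt s.
Proof. by rewrite -sqrtr1 ler_wsqrtr// lerDl sqr_ge0. Qed.
Lemma sqr_wt s : wt s ^+ 2 = 1 + s ^+ 2.
Proof. by rewrite sqr_sqrtr// ltW// sqrD_gt0. Qed.
Lemma wtD_gt0 s c : -1 < c -> 0 < wt s + c.
Proof. by move=> c1; have := wt_ge1 s; lra. Qed.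

Lemma is_derive_wt s : is_derive s 1 wt (s / wt s).
Proof.
rewrite /wt; deriv; first exact: sqrD_gt0.
by rewrite expr1; field; rewrite gt_eqF ?wt_gt0.
Qed.

(** What remains of the integrals defining F+ and F- after their poles have
    been removed: with c = cos th this integral is smooth for |th| < pi, in
    particular at th = 0. *)
Definition regular_int z c := \int[mu]_s (expR (- z * s ^+ 2) / (wt s * (wt s + c))).

Lemma continuous_regular_int_kernel z c : -1 < c ->
  continuous (fun s => expR (- z * s ^+ 2) / (wt s * (wt s + c))).
Proof.
move=> c1 s; have dw := is_derive_wt s.
continuity_at.
by rewrite mulf_neq0// gt_eqF// ?wt_gt0// wtD_gt0.
Qed.

Lemma integ_regular_int_kernel z c : 0 < z -> -1 < c ->
  integ (fun s => expR (- z * s ^+ 2) / (wt s * (wt s + c))).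
Proof.
move=> z0 c1; apply: (integ_gauss_le _ (1 + c)^-1 0 z z0); first exact: continuous_regular_int_kernel.
move=> s; have w1 := wt_ge1 s; have w0 := wt_gt0 s.
have wc : 0 < wt s + c by exact: wtD_gt0.
have c0 : 0 < 1 + c by lra.
rewrite ger0_norm; last by rewrite divr_ge0 ?expR_ge0// mulr_ge0// ltW.
rewrite expr0 mulr1 mulrC ler_wpM2r ?expR_ge0// lef_pV2 ?posrE ?mulr_gt0//; nra.
Qed.

(** Integrating the pointwise bound s^(2N) on the remainder against the Gaussian
    gives an error of at most the N-th moment, with a constant that does not
    depend on c. *)
Lemma regular_int_expansion z c N : 0 < z -> 0 < c < 1 ->
  `|(1 + c) * regular_int z c - \sum_(k < N) kernel_coef c k * gauss_moment k z| <= gauss_moment N z.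
Proof.
move=> z0 /[dup] c01 /andP[c0 c1].
have cN1 : -1 < c by lra.
pose h s := (1 + c) / (wt s * (wt s + c)).
pose p s := \sum_(k < N) kernel_coef c k * s ^+ 2 ^+ k.
have int_mono k := integ_gauss_mono k z z0.
have int_p (n : nat) : integ (fun s => \sum_(k < n) kernel_coef c k * (s ^+ (2 * k) * expR (- z * s ^+ 2))) /\
  \int[mu]_s (\sum_(k < n) kernel_coef c k * (s ^+ (2 * k) * expR (- z * s ^+ 2))) =
  \sum_(k < n) kernel_coef c k * gauss_moment k z.
  elim: n => [|n [ih1 ih2]].
    under eq_Rintegral do rewrite big_ord0.
    rewrite big_ord0 /= Rintegral_cst// mul0r; split => //.
    rewrite (_ : (fun s => _) = fun=> 0); first exact: integrable0.
    by apply/funext => s; rewrite big_ord0.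
  have e : (fun s => \sum_(k < n.+1) kernel_coef c k * (s ^+ (2 * k) * expR (- z * s ^+ 2))) =
     (fun s => \sum_(k < n) kernel_coef c k * (s ^+ (2 * k) * expR (- z * s ^+ 2)) +
       kernel_coef c n * (s ^+ (2 * n) * expR (- z * s ^+ 2))).
    by apply/funext => s; rewrite big_ord_recr.
  rewrite e; split; first by apply: integD => //; exact: integZ.
  by rewrite RintegralD//; [rewrite RintegralZl// ih2 [RHS]big_ord_recr|exact: integZ].
rewrite -(int_p N).2 -RintegralZl//; last exact: integ_regular_int_kernel.
have [int_pN _] := int_p N.
have int_L := integZ _ (1 + c) (integ_regular_int_kernel z c z0 cN1).
rewrite -RintegralB//.
apply: le_trans (le_normr_Rintegral _ _) _ => //; first exact: integB.
apply: le_Rintegral => //; first by apply: integrable_norm => //; exact: integB.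
move=> s _; rewrite /= mulrA.
rewrite (_ : _ - _ = ((1 + c) / (wt s * (wt s + c)) - \sum_(k < N) kernel_coef c k * (s ^+ 2) ^+ k)
  * expR (- z * s ^+ 2)); last first.
  rewrite mulrBl mulr_suml; congr (_ - _); first by ring.
  by apply: eq_bigr => i _; rewrite exprM mulrA.
rewrite normrM (ger0_norm (expR_ge0 _)) ler_wpM2r ?expR_ge0// exprM.
exact: kernel_expansion_le (sqr_ge0 s).
Qed.

End expansion.

(** * The complementary error function *)

Section erfc_theory.
Context {R : realType}.
Local Notation mu := (@lebesgue_measure R).
Local Notation integ f := (mu.-integrable [set: R] (EFin \o f)).
Implicit Types (s z a b x : R).

Lemma integ_gauss1 : integ (fun t => expR (- t ^+ 2)).
Proof. exact: integrableT_gauss. Qed.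

Lemma is_derive_erfc x :
  is_derive x 1 (@erfc R) (- (2 / Num.sqrt pi) * expR (- x ^+ 2)).
Proof.
have ig := integ_gauss1.
pose P y := \int[mu]_(t in `]-oo, y]) expR (- t ^+ 2).
have eE : @erfc R = (fun y => 2 / Num.sqrt pi * (\int[mu]_t expR (- t ^+ 2) - P y)).
  apply/funext => y; rewrite /erfc /P.
  have igy : mu.-integrable [set` Interval -oo%O +oo%O] (EFin \o (fun t : R => expR (- t ^+ 2))).
    by rewrite set_itvNyy.
  have := @Rintegral_itvB R (fun t => expR (- t ^+ 2)) -oo%O +oo%O y igy isT isT.
  rewrite set_itvNyy => ->; rewrite Rintegral_itv_obnd_cbnd//.
  by apply: integrableS ig.
have cg : continuous (fun t : R => expR (- t ^+ 2)) by continuity.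
have [dP PE] : derivable P x 1 /\ derive1 P x = expR (- x ^+ 2).
  apply: (@continuous_FTC1 R (fun t => expR (- t ^+ 2)) -oo%O x (x + 1)) => //.
  - by rewrite ltrDl.
  - by apply: integrableS ig.
  - by rewrite ltNyr.
  - exact: cg.
have dPx : is_derive x 1 P (expR (- x ^+ 2)).
  by apply: DeriveDef; [exact: dP|rewrite -derive1E; exact: PE].
by rewrite eE; deriv; ring.
Qed.

(** The integrand is the integral over t >= a sqrt z of
    (2 t / a^2) exp(- t^2 (s^2 + a^2) / a^2).  Exchanging the two integrations
    (Tonelli) leaves a Gaussian integral in s, and then erfc. *)
Lemma gauss_over_quadratic a z : 0 < a -> 0 < z ->
  (\int[mu]_s (expR (- z * (s ^+ 2 + a ^+ 2)) / (s ^+ 2 + a ^+ 2))%:E =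
   (pi / a * erfc (a * Num.sqrt z))%:E)%E.
Proof.
move=> a0 z0; set b := a * Num.sqrt z.
have b0 : 0 < b by rewrite mulr_gt0// sqrtr_gt0.
have sa s : 0 < s ^+ 2 + a ^+ 2 by rewrite ltr_wpDl ?sqr_ge0// exprn_gt0.
pose g (s t : R) := 2 * t / a ^+ 2 * expR (- ((s ^+ 2 + a ^+ 2) / a ^+ 2) * t ^+ 2).
pose f (p : R * R) := (g p.1 p.2 * \1_`[b, +oo[ p.2)%:E.
have mf : measurable_fun setT f.
  apply/measurable_EFinP/measurable_funM; last first.
    by apply: measurableT_comp => //; exact: measurable_indic.
  apply: measurable_funM.
    by apply: measurable_funM => //; apply: measurable_funM => //; exact: measurable_snd.
  apply: measurableT_comp => //; apply: measurable_funM; last first.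
    by apply: measurable_funX; exact: measurable_snd.
  apply: measurableT_comp => //; apply: measurable_funM => //.
  by apply: measurable_funD => //; apply: measurable_funX; exact: measurable_fst.
have f0 p : (0 <= f p)%E.
  rewrite /f lee_fin indicE; case: (boolP (p.2 \in _)); last by rewrite mulr0.
  rewrite inE/= in_itv/= andbT mulr1 => bp; rewrite /g.
  by rewrite mulr_ge0 ?expR_ge0// divr_ge0 ?sqr_ge0// mulr_ge0// (le_trans (ltW b0)).
have := @fubini_tonelli _ _ _ _ R mu mu f mf f0.
have fE s : (\int[mu]_t f (s, t))%E =
    (expR (- z * (s ^+ 2 + a ^+ 2)) / (s ^+ 2 + a ^+ 2))%:E.
  transitivity (\int[mu]_(t in `[b, +oo[) (g s t)%:E)%E.
    rewrite [RHS]integral_mkcond; apply: eq_integral => t _.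
    by rewrite patchE /f /= indicE; case: ifP => _; rewrite ?mulr1 ?mulr0.
  pose k := (s ^+ 2 + a ^+ 2) / a ^+ 2.
  have k0 : 0 < k by rewrite divr_gt0// exprn_gt0.
  pose F (t : R) := - (s ^+ 2 + a ^+ 2)^-1 * expR (- k * t ^+ 2).
  have dF (t : R) : is_derive t 1 F (g s t).
    rewrite /F; deriv; rewrite /g -/k expr1; set E := expR _.
    by rewrite /k; field; rewrite !gt_eqF.
  have cg : continuous (g s) by rewrite /g; continuity.
  have Fl : F t @[t --> +oo] --> (0 : R).
    rewrite -[X in _ --> X](mulr0 (- (s ^+ 2 + a ^+ 2)^-1)).
    by apply: cvgMl_tmp; exact: cvgy_gauss.
  rewrite (@ge0_continuous_FTC2y _ _ F _ _ _ _ Fl).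
  - rewrite sub0e /F mulNr EFinN oppeK mulrC; congr ((expR _ / _)%:E).
    rewrite /k /b exprMn sqr_sqrtr ?(ltW z0)//; field; by rewrite gt_eqF.
  - move=> t bt; rewrite /g mulr_ge0 ?expR_ge0// divr_ge0 ?sqr_ge0// mulr_ge0//.
    by rewrite (le_trans (ltW b0)).
  - exact: continuous_subspaceT.
  - by move=> t _; exact: ex_derive.
  - by apply: cvg_at_right_filter; exact: (is_derive_continuous _ _ _ (dF b)).
  - by move=> t _; rewrite derive1E derive_val.
under eq_integral do rewrite fE.
move=> ->.
transitivity (\int[mu]_(t in `[b, +oo[) ((2 * Num.sqrt pi / a)%:E * (expR (- t ^+ 2))%:E))%E.
  rewrite [RHS]integral_mkcond; apply: eq_integral => t _.
  rewrite patchE /f /= indicE; case: ifPn => [|_]; last first.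
    by under eq_integral do rewrite mulr0; rewrite integral0.
  rewrite inE/= in_itv/= andbT => bt; have t0 : 0 < t by exact: lt_le_trans bt.
  (* For fixed t the integral over s is Gaussian, with parameter (t / a)^2. *)
  pose q := (t / a) ^+ 2; have q0 : 0 < q by rewrite exprn_gt0// divr_gt0.
  transitivity (\int[mu]_s ((2 * t / a ^+ 2 * expR (- t ^+ 2))%:E * (expR (- q * s ^+ 2))%:E))%E.
    apply: eq_integral => s _; rewrite /g mulr1 -EFinM -(mulrA (2 * t / a ^+ 2)) -expRD; congr ((_ * expR _)%:E).
    by rewrite /q; field; rewrite gt_eqF.
  rewrite integralZl//; last exact: (gauss_scaled _ q0).2.
  rewrite (gauss_scaled _ q0).1 -!EFinM /q sqrtrM ?pi_ge0// sqrtrV ?sqr_ge0//.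
  rewrite sqrtr_sqr gtr0_norm ?divr_gt0//; congr EFin.
  move: (Num.sqrt pi) => sp; field; by rewrite !gt_eqF.
rewrite integralZl//; last by apply: integrableS integ_gauss1.
rewrite /erfc /Rintegral.
have igb : mu.-integrable `[b, +oo[ (EFin \o (fun t : R => expR (- t ^+ 2))).
  by apply: integrableS integ_gauss1.
have /fineK : (\int[mu]_(t in `[b, +oo[) (expR (- t ^+ 2))%:E)%E \is a fin_num.
  by apply: integrable_fin_num igb.
rewrite /= => <-; rewrite -EFinM; congr EFin; rewrite mulrA; congr (_ * _).
have p0 : 0 < Num.sqrt pi :> R by rewrite sqrtr_gt0 pi_gt0.
rewrite -{2}[pi]sqr_sqrtr ?pi_ge0//; move: (Num.sqrt pi) p0 => sp p0; field.
by rewrite !gt_eqF.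
Qed.

End erfc_theory.

(** * Gaussian integrals of functions of at most quadratic growth *)

Section gauss_weighted.
Context {R : realType}.
Local Notation mu := (@lebesgue_measure R).
Local Notation integ f := (mu.-integrable [set: R] (EFin \o f)).
Implicit Types (s z c : R) (f g : R -> R).

Definition subquadratic f := continuous f /\ exists C, forall s, `|f s| <= C * (1 + s ^+ 2).

Lemma subquadraticD f g : subquadratic f -> subquadratic g -> subquadratic (fun s => f s + g s).
Proof.
move=> [cf [C fC]] [cg [D gD]]; split; first by move=> s; apply: cvgD; [exact: cf|exact: cg].
exists (C + D) => s; rewrite (le_trans (ler_normD _ _))// mulrDl lerD//.
Qed.

Lemma subquadraticZ f k : subquadratic f -> subquadratic (fun s => k * f s).
Proof.
move=> [cf [C fC]]; split; first by move=> s; apply: cvgMl_tmp; exact: cf.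
by exists (`|k| * C) => s; rewrite normrM -mulrA ler_wpM2l.
Qed.

Lemma subquadratic_bounded f C : continuous f -> (forall s, `|f s| <= C) -> subquadratic f.
Proof.
move=> cf fC; split => //; exists C => s.
have C0 : 0 <= C := le_trans (normr_ge0 _) (fC 0).
by rewrite (le_trans (fC s))// ler_peMr// lerDl sqr_ge0.
Qed.

Lemma continuous_gauss z : continuous (fun s => expR (- z * s ^+ 2)).
Proof. by continuity. Qed.

Lemma integ_subquadratic z f : 0 < z -> subquadratic f -> integ (fun s => expR (- z * s ^+ 2) * f s).
Proof.
move=> z0 [cf [C fC]].
apply: (integ_le _ (fun s => C * (s ^+ (2 * 0) * expR (- z * s ^+ 2)) + C * (s ^+ (2 * 1) * expR (- z * s ^+ 2)))).
- by move=> s; apply: cvgM; [exact: continuous_gauss|exact: cf].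
- by apply: integD; apply: integZ; exact: integ_gauss_mono.
- move=> s; rewrite normrM (ger0_norm (expR_ge0 _)) muln0 expr0 muln1.
  rewrite mulrC -mulrDr mul1r -{2}[expR _]mul1r -mulrDl mulrA.
  by rewrite ler_wpM2r ?expR_ge0.
Qed.

Definition gauss_int z f := \int[mu]_s (expR (- z * s ^+ 2) * f s).

Lemma gauss_intD z f g : 0 < z -> subquadratic f -> subquadratic g ->
  gauss_int z (fun s => f s + g s) = gauss_int z f + gauss_int z g.
Proof.
move=> z0 tf tg; rewrite /gauss_int -RintegralD//; [|exact: integ_subquadratic..].
by apply: eq_Rintegral => s _; rewrite mulrDr.
Qed.

Lemma gauss_intZ z f k : 0 < z -> subquadratic f -> gauss_int z (fun s => k * f s) = k * gauss_int z f.
Proof.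
move=> z0 tf; rewrite /gauss_int -RintegralZl//; last exact: integ_subquadratic.
by apply: eq_Rintegral => s _; rewrite mulrCA.
Qed.

Lemma gauss_int1 z : 0 < z -> gauss_int z (fun=> 1) = Num.sqrt (pi / z).
Proof.
move=> z0; rewrite -gauss_moment0//; apply: eq_Rintegral => s _.
by rewrite muln0 expr0 mulr1 mul1r.
Qed.

End gauss_weighted.

(** * Differentiation of the kernel integral along a curve *)

Section curve_derivative.
Context {R : realType}.
Local Notation mu := (@lebesgue_measure R).
Local Notation integ f := (mu.-integrable [set: R] (EFin \o f)).
Implicit Types (s c a m : R).

Lemma continuous_kernel_wt c : -1 < c -> continuous (fun s => (wt s * (wt s + c))^-1).
Proof.
move=> c1 s; have dw := is_derive_wt s.
continuity_at.
by rewrite mulf_neq0// gt_eqF// ?wt_gt0// wtD_gt0.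
Qed.

Lemma kernel_wt_le s c m : 0 < m -> m <= 1 + c -> (wt s * (wt s + c))^-1 <= m^-1.
Proof.
move=> m0 mc; have w1 := wt_ge1 s.
by rewrite lef_pV2 ?posrE ?mulr_gt0//; nra.
Qed.

Lemma kernel_wt_gt0 s c : -1 < c -> 0 < (wt s * (wt s + c))^-1.
Proof. by move=> c1; rewrite invr_gt0 mulr_gt0 ?wt_gt0 ?wtD_gt0. Qed.

Lemma continuous_kernel_wt2 c : -1 < c ->
  continuous (fun s => (wt s * (wt s + c) ^+ 2)^-1).
Proof.
move=> c1 s; have dw := is_derive_wt s.
continuity_at.
by rewrite mulf_neq0// ?expf_neq0 ?gt_eqF// ?wt_gt0// wtD_gt0.
Qed.

Lemma kernel_wt2_le s c m : 0 < m -> m <= 1 + c ->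
  `|(wt s * (wt s + c) ^+ 2)^-1| <= m ^- 2.
Proof.
move=> m0 mc; have w1 := wt_ge1 s; have w0 := wt_gt0 s.
have wcm : m <= wt s + c by lra.
have wc : 0 < wt s + c by lra.
rewrite ger0_norm; last by rewrite invr_ge0 mulr_ge0 ?ltW// exprn_gt0.
rewrite lef_pV2 ?posrE ?mulr_gt0 ?exprn_gt0//.
rewrite -[leLHS]mul1r ler_pM// ?exprn_ge0 ?(ltW m0)//.
by rewrite ler_pXn2r// nnegrE ltW.
Qed.

Variables (z th z' th' : R -> R) (u v z1 M m : R).
Hypothesis dz : forall t, u < t < v -> is_derive t 1 z (z' t).
Hypothesis dth : forall t, u < t < v -> is_derive t 1 th (th' t).
Hypotheses (z10 : 0 < z1) (zz1 : forall t, u < t < v -> z1 <= z t).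
Hypotheses (z'M : forall t, u < t < v -> `|z' t| <= M).
Hypotheses (th'M : forall t, u < t < v -> `|th' t| <= M).
Hypotheses (m0 : 0 < m) (mc : forall t, u < t < v -> m <= 1 + cos (th t)).

Let f t s := expR (- z t * s ^+ 2) / (wt s * (wt s + cos (th t))).
Let f' t s := expR (- z t * s ^+ 2) *
  (- z' t * (s ^+ 2 * (wt s * (wt s + cos (th t)))^-1) +
   th' t * sin (th t) * (wt s * (wt s + cos (th t)) ^+ 2)^-1).

Let cN1 r : u < r < v -> -1 < cos (th r).
Proof. by move=> /mc /(lt_le_trans m0); rewrite addrC -ltrBlDr sub0r. Qed.

Let df t s : u < t < v -> is_derive t 1 (f ^~ s) (f' t s).
Proof.
move=> tuv; have h1 := dz t tuv; have h2 := dth t tuv; rewrite /f.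
have w0 := wt_gt0 s; have w1 := wt_ge1 s.
have wc : 0 < wt s + cos (th t) by apply: wtD_gt0; exact: cN1.
deriv; first by rewrite mulf_neq0// gt_eqF.
rewrite /f'; set E := expR _.
move: (sin _) (cos _) wc => a c wc; field.
by rewrite !gt_eqF.
Qed.

(** Differentiation under the integral sign: on the neighbourhood where
    z >= z1 and 1 + cos th >= m, the derivative of the integrand is dominated by
    a multiple of (1 + s^2) e^(-z1 s^2). *)
Lemma is_derive_regular_int t : u < t < v ->
  is_derive t 1 (fun t => regular_int (z t) (cos (th t)))
   (- z' t * gauss_int (z t) (fun s => s ^+ 2 * (wt s * (wt s + cos (th t)))^-1) +
    th' t * sin (th t) * gauss_int (z t) (fun s => (wt s * (wt s + cos (th t)) ^+ 2)^-1)).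
Proof.
move=> tuv.
pose g s : R := (M / m + M / m ^+ 2) * ((s ^+ (2 * 0) * expR (- z1 * s ^+ 2)) +
  (s ^+ (2 * 1) * expR (- z1 * s ^+ 2))).
have z0 r : u < r < v -> 0 < z r by move=> /zz1; exact: lt_le_trans.
have M0 : 0 <= M by exact: le_trans (normr_ge0 _) (z'M t tuv).
have t_uv : (`]u, v[%classic : set R) t by rewrite /= in_itv.
have intf r : (`]u, v[%classic : set R) r -> integ (f r).
  by rewrite /= in_itv/= => ruv; apply: integ_regular_int_kernel; [exact: z0|exact: cN1].
have derf r s : (`]u, v[%classic : set R) r -> [set: R] s -> derivable (f ^~ s) r 1.
  by rewrite /= in_itv/= => ruv _; have ? := df r s ruv; exact: ex_derive.
have p1E r s : u < r < v -> partial1of2 f r s = f' r s.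
  by move=> ruv; rewrite partial1of2E; have ? := df r s ruv; exact: derive_val.
have g0 s : 0 <= g s.
  have C0 : 0 <= M / m + M / m ^+ 2 by rewrite addr_ge0 ?divr_ge0 ?exprn_ge0 ?(ltW m0).
  rewrite /g mulr_ge0// muln0 expr0 mul1r muln1 addr_ge0 ?expR_ge0//.
  by rewrite mulr_ge0 ?sqr_ge0 ?expR_ge0.
have intg : integ g by apply: integZ; apply: integD; exact: integ_gauss_mono.
have gub r s : (`]u, v[%classic : set R) r -> [set: R] s -> `|partial1of2 f r s| <= g s.
  rewrite /= in_itv/= => ruv _; rewrite p1E// /f' /g.
  rewrite normrM (ger0_norm (expR_ge0 _)).
  have eE : expR (- z r * s ^+ 2) <= expR (- z1 * s ^+ 2).
    by rewrite ler_expR !mulNr lerN2 ler_wpM2r ?sqr_ge0// zz1.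
  rewrite muln0 expr0 muln1 -mulrDl [leRHS]mulrA [leLHS]mulrC.
  apply: ler_pM => //.
  have k1 := kernel_wt_le s _ _ m0 (mc r ruv).
  have k2 := kernel_wt2_le s _ _ m0 (mc r ruv).
  have k3 := kernel_wt_gt0 s _ (cN1 r ruv).
  rewrite (le_trans (ler_normD _ _))// mulrDl lerD//.
    rewrite 2!normrM normrN (ger0_norm (sqr_ge0 s)) (gtr0_norm k3) -mulrA ler_pM ?z'M//.
      by rewrite mulr_ge0 ?sqr_ge0 ?ltW.
    rewrite mulrC ler_pM ?sqr_ge0// ?(ltW k3)//; by rewrite lerDr.
  apply: (@le_trans _ _ (M / m ^+ 2)); last first.
    by rewrite ler_peMr ?divr_ge0 ?exprn_ge0 ?(ltW m0)// lerDl sqr_ge0.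
  rewrite !normrM ler_pM ?mulr_ge0// -[leRHS]mulr1 ler_pM ?th'M//.
  by rewrite sin_max.
have D1 := @derivable_under_integral R _ _ mu f setT measurableT t u v t_uv intf derf g g0 intg gub.
have D2 := @differentiation_under_integral R _ _ mu f setT measurableT t u v t_uv intf derf g g0 intg gub.
have -> : - z' t * gauss_int (z t) (fun s => s ^+ 2 * (wt s * (wt s + cos (th t)))^-1) +
    th' t * sin (th t) * gauss_int (z t) (fun s => (wt s * (wt s + cos (th t)) ^+ 2)^-1)
  = \int[mu]_(s in setT) partial1of2 f t s.
  have zt := z0 t tuv.
  have t1 : subquadratic (fun s => s ^+ 2 * (wt s * (wt s + cos (th t)))^-1).
    split.
      move=> s; apply: cvgM; first exact: exprn_continuous.
      by apply: continuous_kernel_wt; exact: cN1.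
    exists m^-1 => s; have k1 := kernel_wt_le s _ _ m0 (mc t tuv).
    have k3 := kernel_wt_gt0 s _ (cN1 t tuv).
    rewrite normrM (ger0_norm (sqr_ge0 s)) (gtr0_norm k3) mulrC ler_pM ?sqr_ge0 ?(ltW k3)//.
    by rewrite lerDr.
  have t2 : subquadratic (fun s => (wt s * (wt s + cos (th t)) ^+ 2)^-1).
    apply: (subquadratic_bounded _ (m ^- 2)); first by apply: continuous_kernel_wt2; exact: cN1.
    by move=> s; exact: (kernel_wt2_le _ _ _ m0 (mc t tuv)).
  rewrite -!gauss_intZ// -gauss_intD//; try exact: subquadraticZ.
  by apply: eq_Rintegral => s _; rewrite p1E.
apply: DeriveDef; [exact: D1|by rewrite -derive1E D2].
Qed.

End curve_derivative.

(** * The angular form of the distribution function *)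

Section angular_cdf.
Context {R : realType}.
Local Notation mu := (@lebesgue_measure R).
Implicit Types (s c z a : R).

(** With s = sinh(u / 2) these become e^(z/2) K_0(z / 2) and
    e^(z/2) K_1(z / 2). *)
Definition scaled_K0 z := gauss_int z (fun s => (wt s)^-1).
Definition scaled_K1 z := gauss_int z (fun s => (1 + 2 * s ^+ 2) / wt s).

Lemma continuous_wtV : continuous (fun s : R => (wt s)^-1).
Proof.
move=> s; have dw := is_derive_wt s.
continuity_at.
by rewrite gt_eqF// wt_gt0.
Qed.

Lemma wtV_le1 s : (wt s)^-1 <= 1.
Proof. by rewrite invf_le1 ?wt_gt0// wt_ge1. Qed.

Lemma subquadratic_cst (k : R) : subquadratic (fun=> k).
Proof. by apply: (subquadratic_bounded _ `|k|) => // s; exact: cvg_cst. Qed.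

Lemma subquadratic_wtV : subquadratic (fun s : R => (wt s)^-1).
Proof.
apply: (subquadratic_bounded _ 1); first exact: continuous_wtV.
by move=> s; rewrite gtr0_norm ?invr_gt0 ?wt_gt0// wtV_le1.
Qed.

Lemma subquadratic_scaled_K1 : subquadratic (fun s : R => (1 + 2 * s ^+ 2) / wt s).
Proof.
split.
  by move=> s; have dw := is_derive_wt s; continuity_at; rewrite gt_eqF// wt_gt0.
exists 2 => s; have w0 := wt_gt0 s; have w1 := wtV_le1 s.
have s2 := sqr_ge0 s.
rewrite normrM (ger0_norm (_ : 0 <= 1 + 2 * s ^+ 2)); last by lra.
rewrite gtr0_norm ?invr_gt0//.
by rewrite (@le_trans _ _ ((1 + 2 * s ^+ 2) * 1))// ?ler_wpM2l//; lra.
Qed.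

Lemma subquadratic_kernel c : -1 < c -> subquadratic (fun s => (wt s * (wt s + c))^-1).
Proof.
move=> c1; have c0 : 0 < 1 + c by lra.
apply: (subquadratic_bounded _ (1 + c)^-1); first exact: continuous_kernel_wt.
by move=> s; rewrite gtr0_norm ?kernel_wt_gt0// kernel_wt_le.
Qed.

Lemma subquadratic_kernel2 c : -1 < c -> subquadratic (fun s => (wt s * (wt s + c) ^+ 2)^-1).
Proof.
move=> c1; have c0 : 0 < 1 + c by lra.
apply: (subquadratic_bounded _ ((1 + c) ^- 2)); first exact: continuous_kernel_wt2.
by move=> s; exact: kernel_wt2_le.
Qed.

Lemma regular_int_gauss z c : regular_int z c = gauss_int z (fun s => (wt s * (wt s + c))^-1).
Proof. by []. Qed.

Lemma gauss_int_sqr_kernel z c : 0 < z -> -1 < c ->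
  gauss_int z (fun s => s ^+ 2 * (wt s * (wt s + c))^-1) =
  Num.sqrt (pi / z) - c * scaled_K0 z - (1 - c ^+ 2) * regular_int z c.
Proof.
move=> z0 c1; have tk := subquadratic_kernel c c1; have tw := subquadratic_wtV; have t1 := subquadratic_cst 1.
have t2 := subquadraticZ _ (- c) tw; have t3 := subquadraticZ _ (- (1 - c ^+ 2)) tk.
transitivity (gauss_int z (fun s => 1 + - c * (wt s)^-1 + - (1 - c ^+ 2) * (wt s * (wt s + c))^-1)); last first.
  rewrite gauss_intD//; last exact: subquadraticD.
  by rewrite gauss_intD// !gauss_intZ// gauss_int1// !mulNr.
apply: eq_Rintegral => s _; congr (_ * _).
have -> : s ^+ 2 = wt s ^+ 2 - 1 by rewrite sqr_wt addrC addKr.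
by field; rewrite !gt_eqF ?wt_gt0 ?wtD_gt0.
Qed.

(** The kernel c / (w (w + c)) + (1 - c^2) / (w (w + c)^2) is the derivative
    of s / (w + c).  Integrating it by parts against the Gaussian replaces it
    by 2 z s^2 / (w + c), which reduces to the listed integrals. *)
Lemma gauss_int_by_parts z c : 0 < z -> -1 < c <= 1 ->
  c * regular_int z c + (1 - c ^+ 2) * gauss_int z (fun s => (wt s * (wt s + c) ^+ 2)^-1) =
  z * (2 * (1 - c ^+ 2) * c * regular_int z c + scaled_K1 z + (2 * c ^+ 2 - 1) * scaled_K0 z
    - 2 * c * Num.sqrt (pi / z)).
Proof.
move=> z0 /andP[c1 c2].
have tk := subquadratic_kernel c c1; have tk2 := subquadratic_kernel2 c c1.
have tw := subquadratic_wtV; have tk1 := subquadratic_scaled_K1; have t1 := subquadratic_cst 1.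
pose f s := expR (- z * s ^+ 2) *
  ((c * (wt s * (wt s + c))^-1 + (1 - c ^+ 2) * (wt s * (wt s + c) ^+ 2)^-1) +
   - z * (2 * (1 - c ^+ 2) * c * (wt s * (wt s + c))^-1 + (1 + 2 * s ^+ 2) / wt s
     + (2 * c ^+ 2 - 1) * (wt s)^-1 + - (2 * c) * 1)).
have ta := subquadraticD _ _ (subquadraticZ _ c tk) (subquadraticZ _ (1 - c ^+ 2) tk2).
have tb1 := subquadraticD _ _ (subquadraticZ _ (2 * (1 - c ^+ 2) * c) tk) tk1.
have tb2 := subquadraticD _ _ tb1 (subquadraticZ _ (2 * c ^+ 2 - 1) tw).
have tb := subquadraticD _ _ tb2 (subquadraticZ _ (- (2 * c)) t1).
have tf := subquadraticD _ _ ta (subquadraticZ _ (- z) tb).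
have f0 : \int[mu]_s f s = 0.
  have [C C0 HC] := pow_gauss_le 1 z z0.
  apply: (@integral_derivT0 _ f (fun s => s * expR (- z * s ^+ 2) * (wt s + c)^-1) (C * (1 + c)^-1) (z / 2)).
  - by rewrite divr_gt0.
  - move=> s; have dw := is_derive_wt s; have wc := wtD_gt0 s c c1; have w0 := wt_gt0 s.
    deriv; first by rewrite gt_eqF.
    rewrite /f expr1; have e : s ^+ 2 = wt s ^+ 2 - 1 by rewrite sqr_wt addrC addKr.
    move: (wt s) (expR _) wc w0 e => w E wc w0 e; field: e.
    by rewrite !gt_eqF.
  - move=> s; apply: cvgM; [exact: continuous_gauss|exact: tf.1].
  - exact: integ_subquadratic.
  - move=> s; have wc := wtD_gt0 s c c1; have w1 := wt_ge1 s.
    rewrite 2!normrM (ger0_norm (expR_ge0 _)) [leRHS]mulrAC; apply: ler_pM => //.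
    + by have := HC s; rewrite expr1.
    + by rewrite gtr0_norm ?invr_gt0// lef_pV2 ?posrE//; lra.
move: f0; rewrite /f -/(gauss_int z _) gauss_intD//; last exact: subquadraticZ.
rewrite (gauss_intZ z _ (- z)) // mulNr => /eqP; rewrite subr_eq0 => /eqP.
rewrite gauss_intD//; try exact: subquadraticZ.
rewrite !gauss_intZ// -regular_int_gauss => ->; congr (_ * _).
rewrite gauss_intD//; last exact: subquadraticZ.
rewrite gauss_intD//; last exact: subquadraticZ.
rewrite gauss_intD//; last exact: subquadraticZ.
by rewrite !gauss_intZ// gauss_int1// -regular_int_gauss -/(scaled_K1 z) -/(scaled_K0 z) mulNr.
Qed.

(** The function through which F+ and F- are expressed: th stands for
    (nu - tau) / 2 and (nu + tau) / 2 respectively.  It is regular at th = 0,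
    where the integral defining F+ diverges. *)
Definition angular_cdf z th := erfc (sin th * Num.sqrt z) / 2 -
  (2 * pi)^-1 * (expR (- z * sin th ^+ 2) * (sin th * regular_int z (cos th))).

(** Along a curve the error function and the integral of the kernel combine:
    after integration by parts only the two Bessel integrals are left. *)
Lemma is_derive_angular_cdf (z th z' th' : R -> R) (u v z1 M m : R) (t : R) :
  (forall t, u < t < v -> is_derive t 1 z (z' t)) ->
  (forall t, u < t < v -> is_derive t 1 th (th' t)) ->
  0 < z1 -> (forall t, u < t < v -> z1 <= z t) ->
  (forall t, u < t < v -> `|z' t| <= M) ->
  (forall t, u < t < v -> `|th' t| <= M) ->
  0 < m -> (forall t, u < t < v -> m <= 1 + cos (th t)) ->
  u < t < v ->
  is_derive t 1 (fun t => angular_cdf (z t) (th t))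
    (- (2 * pi)^-1 * expR (- z t * sin (th t) ^+ 2) *
      (sin (th t) * cos (th t) * scaled_K0 (z t) * z' t +
       z t * th' t * (scaled_K1 (z t) + (2 * cos (th t) ^+ 2 - 1) * scaled_K0 (z t)))).
Proof.
move=> dz dth z10 zz1 z'M th'M m0 mc tuv.
have dzt := dz t tuv; have dtht := dth t tuv.
have zt0 : 0 < z t by exact: lt_le_trans (zz1 t tuv).
have dL := is_derive_regular_int z th z' th' u v z1 M m dz dth z10 zz1 z'M th'M m0 mc t tuv.
have c1 : -1 < cos (th t) by have := lt_le_trans m0 (mc t tuv); rewrite addrC -ltrBlDr sub0r.
set a := sin (th t); set c := cos (th t).
have dS : is_derive t 1 (fun t => sin (th t) * Num.sqrt (z t))
    (c * th' t * Num.sqrt (z t) + a * ((2 * Num.sqrt (z t))^-1 * z' t)) by deriv.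
have dE := is_derive_fun_comp (@erfc R) _ t _ _ (is_derive_erfc _) dS.
have cc : -1 < c <= 1 by rewrite c1 cos_le1.
have bp := gauss_int_by_parts (z t) c zt0 cc.
rewrite gauss_int_sqr_kernel// -/a -/c in dL.
rewrite /angular_cdf; deriv; rewrite -/a -/c.
have sz0 : 0 < Num.sqrt (z t) by rewrite sqrtr_gt0.
have p0 : 0 < Num.sqrt pi :> R by rewrite sqrtr_gt0 pi_gt0.
have zE : z t = Num.sqrt (z t) ^+ 2 by rewrite sqr_sqrtr// ltW.
have pE : pi = Num.sqrt pi ^+ 2 :> R by rewrite sqr_sqrtr// pi_ge0.
have eE : expR (- (a * Num.sqrt (z t)) ^+ 2) = expR (- z t * a ^+ 2).
  by congr expR; rewrite exprMn -zE; ring.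
have SE : Num.sqrt (pi / z t) = Num.sqrt pi / Num.sqrt (z t).
  by rewrite sqrtrM ?pi_ge0// sqrtrV// ltW.
have a2 : a ^+ 2 = 1 - c ^+ 2 by exact: sin2cos2.
have ppE : (2 * pi)^-1 = (2 * Num.sqrt pi ^+ 2)^-1 :> R by rewrite -pE.
rewrite eE SE in bp *; rewrite !ppE {ppE pE}.
move: (expR _) (regular_int _ _) (gauss_int _ _) (scaled_K0 _) (scaled_K1 _) bp => E L G2 K0 K1.
rewrite {1}zE => bp.
move: (erfc _) p0 sz0 zE a2 bp => ef.
move: (Num.sqrt pi) (Num.sqrt (z t)) => P Z.
move: (z t) (z' t) (th' t) => zt zt' tht' P0 Z0 -> a2 bp.
set Y := (X in - zt' * X).
have -> : c * tht' * L + a * (- zt' * Y + tht' * a * G2) =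
    tht' * (c * L + (1 - c ^+ 2) * G2) - a * zt' * Y by rewrite -a2; ring.
rewrite bp /Y expr1; field: a2.
by rewrite !gt_eqF.
Qed.

End angular_cdf.

(** * The integrals defining F+ and F- *)

Section angular_cdf_integral.
Context {R : realType}.
Local Notation mu := (@lebesgue_measure R).
Implicit Types (s c z a th nu tau : R).

Lemma subquadratic_quadraticV a : a != 0 -> subquadratic (fun s => (s ^+ 2 + a ^+ 2)^-1).
Proof.
move=> a0; have a2 : 0 < a ^+ 2 by rewrite exprn_even_gt0.
have sa s : 0 < s ^+ 2 + a ^+ 2 by rewrite ltr_wpDl ?sqr_ge0.
apply: (subquadratic_bounded _ (a ^- 2)); first by move=> s; continuity_at; rewrite gt_eqF.
by move=> s; rewrite gtr0_norm ?invr_gt0// lef_pV2 ?posrE// lerDr sqr_ge0.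
Qed.

Lemma gauss_int_quadraticV z a : 0 < z -> 0 < a ->
  expR (- z * a ^+ 2) * gauss_int z (fun s => (s ^+ 2 + a ^+ 2)^-1) =
  pi / a * erfc (a * Num.sqrt z).
Proof.
move=> z0 a0; rewrite /gauss_int -RintegralZl//; last first.
  by apply: integ_subquadratic => //; apply: subquadratic_quadraticV; rewrite gt_eqF.
have := gauss_over_quadratic a z a0 z0 => /(congr1 fine) /= <-.
by apply: eq_Rintegral => s _; rewrite mulrA -expRD; congr (expR _ / _); ring.
Qed.

(** The integral in the definitions of F+ and F-, with a = sin th. *)
Definition pole_int z a := \int[mu]_s (expR (- z * s ^+ 2) / ((s ^+ 2 + a ^+ 2) * wt s)).

Lemma subquadratic_pole a : a != 0 -> subquadratic (fun s => ((s ^+ 2 + a ^+ 2) * wt s)^-1).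
Proof.
move=> a0; have [cq [C qC]] := subquadratic_quadraticV a a0.
rewrite (_ : (fun s => _) = (fun s => (s ^+ 2 + a ^+ 2)^-1 * (wt s)^-1)); last first.
  by apply/funext => s; rewrite invfM.
split; first by move=> s; apply: cvgM; [exact: cq|exact: continuous_wtV].
exists C => s; rewrite normrM (le_trans _ (qC s))// ler_piMr//.
by rewrite gtr0_norm ?invr_gt0 ?wt_gt0// wtV_le1.
Qed.

(** With w^2 - c^2 = s^2 + a^2, partial fractions give
    c / ((s^2 + a^2) w) = 1 / (s^2 + a^2) - 1 / (w (w + c)); the Gaussian
    integral of the first term is the error function. *)
Lemma angular_cdf_integral z th : 0 < z -> 0 < sin th ->
  expR (- z * sin th ^+ 2) / (4 * pi) * (2 * (sin th * cos th)) * pole_int z (sin th) =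
  angular_cdf z th.
Proof.
move=> z0 a0; set a := sin th in a0 *; set c := cos th.
have ca : c ^+ 2 = 1 - a ^+ 2 by exact: cos2sin2.
have a2 : 0 < a ^+ 2 by rewrite exprn_gt0.
have c1 : -1 < c by rewrite !expr2 in ca a2; nra.
have aN0 : a != 0 by rewrite gt_eqF.
have tq := subquadratic_quadraticV a aN0; have tk := subquadratic_kernel c c1.
have e : c * pole_int z a = gauss_int z (fun s => (s ^+ 2 + a ^+ 2)^-1) - regular_int z c.
  rewrite /pole_int -/(gauss_int z _) -gauss_intZ//; last exact: subquadratic_pole.
  rewrite regular_int_gauss -[X in _ - X]mul1r -mulNr -gauss_intZ// -gauss_intD//; last exact: subquadraticZ.
  apply: eq_Rintegral => s _; congr (_ * _).
  have w0 := wt_gt0 s; have wc := wtD_gt0 s c c1.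
  have sa : 0 < s ^+ 2 + a ^+ 2 by rewrite ltr_wpDl ?sqr_ge0// exprn_gt0.
  have e1 : s ^+ 2 + a ^+ 2 = (wt s - c) * (wt s + c).
    by rewrite -subr_sqr sqr_wt ca; ring.
  move: sa; rewrite e1 pmulr_lgt0// => wc'.
  by field; rewrite !gt_eqF.
have q := gauss_int_quadraticV z a z0 a0.
have p0 : (pi : R) != 0 by rewrite gt_eqF// pi_gt0.
rewrite -!mulrA e /angular_cdf -/a -/c.
rewrite (_ : erfc _ = a / pi * (pi / a * erfc (a * Num.sqrt z))); last first.
  by move: (pi : R) (erfc _) p0 => p x p0; field; rewrite aN0.
rewrite -q; move: (pi : R) p0 => p p0; field; by rewrite p0.
Qed.

Lemma pole_int_bound z a : 0 < z -> a != 0 ->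
  0 <= pole_int z a <= Num.sqrt (pi / z) / a ^+ 2.
Proof.
move=> z0 a0; have a2 : 0 < a ^+ 2 by rewrite exprn_even_gt0.
have sa s : 0 < s ^+ 2 + a ^+ 2 by rewrite ltr_wpDl ?sqr_ge0.
apply/andP; split.
  apply: Rintegral_ge0 => s _.
  by rewrite divr_ge0 ?expR_ge0// mulr_ge0 ?ltW// wt_gt0.
rewrite -gauss_int1// mulrC -gauss_intZ//; last exact: subquadratic_cst.
apply: le_Rintegral => //; try apply: (@integ_subquadratic R z) => //.
- exact: subquadratic_pole.
- by apply: subquadraticZ; exact: subquadratic_cst.
move=> s _; rewrite ler_wpM2l ?expR_ge0// mulr1 invfM.
rewrite -[leRHS]mulr1 ler_pM ?invr_ge0 ?(ltW (sa s)) ?(ltW (wt_gt0 s)) ?wtV_le1//.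
by rewrite lef_pV2 ?posrE// lerDr sqr_ge0.
Qed.

(** For large z the pole integral, of which this is a multiple, is small; this
    yields the limits at minus infinity. *)
Lemma angular_cdf_bound z th : 0 < z -> 0 < sin th ->
  `|angular_cdf z th| <= Num.sqrt (pi / z) / sin th ^+ 2.
Proof.
move=> z0 a0; rewrite -angular_cdf_integral//.
have /andP[p0 p1] := pole_int_bound z (sin th) z0 (lt0r_neq0 a0).
rewrite normrM (ger0_norm p0) (le_trans _ p1)// ler_piMl//.
rewrite normrM [`|2 * _|]normrM [`|2|]ger0_norm// (ger0_norm (divr_ge0 (expR_ge0 _) _)); last first.
  by rewrite mulr_ge0// pi_ge0.
have e1 : expR (- z * sin th ^+ 2) <= 1.
  by rewrite -expR0 ler_expR mulNr oppr_le0 mulr_ge0 ?sqr_ge0// ltW.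
have sc : `|sin th * cos th| <= 1.
  by rewrite normrM -[leRHS]mulr1 ler_pM// ?sin_max ?cos_max.
have p2 := pi_ge2 R.
have h : expR (- z * sin th ^+ 2) / (4 * pi) <= 2^-1.
  by rewrite ler_pdivrMr; lra.
rewrite -[leRHS](@mulVf _ (2 : R))// ler_pM// ?divr_ge0 ?expR_ge0 ?mulr_ge0 ?pi_ge0//.
by rewrite ler_piMr.
Qed.

Lemma Re_sqr_imag (x : R) :
  complex.Re ((- 'i%C * x%:C : R[i])%C ^+ 2) = - x ^+ 2.
Proof. by rewrite !expr2; simpc => /=; ring. Qed.

Lemma sin_double_half (x : R) : sin x = 2 * (sin (x / 2) * cos (x / 2)).
Proof.
rewrite {1}(_ : x = (x / 2) *+ 2); last by rewrite -mulr_natr; field.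
by rewrite sin_mulr2n -mulr_natl [cos _ * _]mulrC.
Qed.

Lemma cos_double_half (x : R) : cos x = 2 * cos (x / 2) ^+ 2 - 1.
Proof.
rewrite {1}(_ : x = (x / 2) *+ 2); last by rewrite -mulr_natr; field.
by rewrite cos_mulr2n mulr_natl.
Qed.

Lemma sqr_sin_half (x : R) : sin (x / 2) ^+ 2 = (1 - cos x) / 2.
Proof. by rewrite cos_double_half cos2sin2; field. Qed.

Lemma Fp_integralE z nu tau : 0 < z -> 0 < sin ((nu - tau) / 2) ->
  Fp_integral z nu tau = angular_cdf z ((nu - tau) / 2).
Proof.
move=> z0 a0; rewrite -angular_cdf_integral// /Fp_integral /sigmap_of Re_sqr_imag.
rewrite (sin_double_half (nu - tau)) mulrN -mulNr; congr (_ * _).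
by apply: eq_Rintegral => s _; rewrite opprK.
Qed.

Lemma Fm_integralE z nu tau : 0 < z -> 0 < sin ((nu + tau) / 2) ->
  Fm_integral z nu tau =
  expR (z * (sin ((nu + tau) / 2) ^+ 2 - sin ((nu - tau) / 2) ^+ 2)) *
    angular_cdf z ((nu + tau) / 2).
Proof.
move=> z0 a0; rewrite -angular_cdf_integral// /Fm_integral /sigmap_of /sigmam_of !Re_sqr_imag.
rewrite (sin_double_half (nu + tau)) !mulrA -expRD.
rewrite (_ : z * (_ - _) + _ = z * - sin ((nu - tau) / 2) ^+ 2); last by ring.
by congr (_ * _); apply: eq_Rintegral => s _; rewrite opprK.
Qed.

End angular_cdf_integral.

(** * The Bessel function of order one *)

Section bessel.
Context {R : realType}.
Local Notation mu := (@lebesgue_measure R).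
Implicit Types (s y z : R).

(** The inverse of s = sinh(u / 2), which makes cosh u = 1 + 2 s^2. *)
Definition arsinh2 s := 2 * ln (s + wt s).

Lemma wt_gt_norm s : `|s| < wt s.
Proof. by rewrite -sqrtr_sqr /wt ltr_sqrt ?sqrD_gt0// ltrDr. Qed.

Lemma addr_wt_gt0 s : 0 < s + wt s.
Proof. by have := wt_gt_norm s; rewrite ltr_norml => /andP[? _]; lra. Qed.

Lemma is_derive_arsinh2 s : is_derive s 1 arsinh2 (2 * (wt s)^-1).
Proof.
have dw := is_derive_wt s; have w0 := wt_gt0 s; have sw0 := addr_wt_gt0 s.
rewrite /arsinh2; deriv => //; move: (wt s) w0 sw0 => w w0 sw0.
by field; rewrite !gt_eqF.
Qed.

Lemma cosh_arsinh2 s : cosh (arsinh2 s) = 1 + 2 * s ^+ 2.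
Proof.
have w0 := wt_gt0 s; have sw0 := addr_wt_gt0 s; have w2 := sqr_wt s.
have e : expR (arsinh2 s) = (s + wt s) ^+ 2.
  by rewrite /arsinh2 mulr_natl -lnXn// lnK// posrE exprn_gt0.
rewrite /cosh expRN e; have -> : ((s + wt s) ^+ 2)^-1 = (wt s - s) ^+ 2.
  rewrite -exprVn; congr (_ ^+ 2); apply: (mulfI (lt0r_neq0 sw0)).
  rewrite mulfV ?gt_eqF//; move: (wt s) w2 => w w2; ring: w2.
by move: (wt s) w2 => w w2; field: w2.
Qed.

Lemma scaled_K1_kernel_ge0 s : 0 <= (1 + 2 * s ^+ 2) / wt s.
Proof.
by rewrite mulr_ge0 ?invr_ge0 ?(ltW (wt_gt0 s))// addr_ge0// mulr_ge0 ?sqr_ge0.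
Qed.

Lemma cvgy_wt : wt (s : R) @[s --> +oo] --> +oo.
Proof.
apply/cvgryPge => A; near=> s.
rewrite (le_trans _ (ltW (wt_gt_norm s)))// (le_trans _ (ler_norm s))//.
Unshelve. all: end_near. Qed.

Lemma besselK_1E y : 0 < y -> besselK 1 y = expR (- y) * scaled_K1 (2 * y).
Proof.
move=> y0; have y20 : 0 < 2 * y by rewrite mulr_gt0.
pose G u := expR (- y * cosh u) * cosh (1 * u).
have cosh0 u : 0 <= cosh u :> R by rewrite /cosh divr_ge0// addr_ge0// expR_ge0.
have G0 u : 0 <= G u by rewrite /G mulr_ge0 ?expR_ge0.
have cG : continuous G by rewrite /G /cosh; continuity.
have cF : continuous arsinh2 by move=> s; exact: is_derive_continuous (is_derive_arsinh2 s).
have dF1 : derive1 arsinh2 = (fun s => 2 * (wt s)^-1).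
  apply/funext => s; rewrite derive1E; have ? := is_derive_arsinh2 s; exact: derive_val.
have cF1 : continuous (fun s => 2 * (wt s)^-1).
  by move=> s; apply: cvgMl_tmp; exact: continuous_wtV.
have wty := cvgy_wt.
have wtVy : 2 * (wt (s : R))^-1 @[s --> +oo] --> (0 : R).
  rewrite -[X in _ --> X](mulr0 2); apply: cvgMl_tmp.
  by apply/gtr0_cvgV0 => //; near=> s; exact: wt_gt0.
have Fy : arsinh2 s @[s --> +oo] --> +oo.
  apply: gt0_cvgMry => //; apply/cvgryPge => A; near=> s.
  rewrite -(expRK A) ler_ln ?posrE ?expR_gt0 ?addr_wt_gt0//.
  have : expR A <= wt s by near: s; exact: cvgry_ge.
  have : 0 <= s by near: s; exact: nbhs_pinfty_ge.
  by move=> ? ?; lra.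
have F0 : arsinh2 0 = 0 by rewrite /arsinh2 /wt expr0n addr0 sqrtr1 add0r ln1 mulr0.
have -> : besselK 1 y = fine (\int[mu]_(u in `[arsinh2 0, +oo[) (G u)%:E) by rewrite F0.
rewrite (@increasing_ge0_integration_by_substitutiony _ arsinh2 G 0); first last.
- by move=> u _; exact: G0.
- exact: continuous_subspaceT.
- exact: Fy.
- split; first by move=> s _; have ? := is_derive_arsinh2 s; exact: ex_derive.
  by apply: cvg_at_right_filter; exact: cF.
- by rewrite dF1; exact: (cvgP _ wtVy).
- by rewrite dF1; apply: (cvgP (2 * (wt 0)^-1)); apply: cvg_at_right_filter; exact: cF1.
- by rewrite dF1 => s _; exact: cF1.
- move=> s t; rewrite !in_itv/= !andbT => s0 t0 st; rewrite /arsinh2 ltr_pM2l// ltr_ln ?posrE ?addr_wt_gt0//.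
  by rewrite ltrD// /wt ltr_sqrt ?sqrD_gt0// ltrD2l ltrXn2r.
pose h s := expR (- y) * (expR (- (2 * y) * s ^+ 2) * ((1 + 2 * s ^+ 2) / wt s)).
have th := integ_subquadratic (2 * y) _ y20 subquadratic_scaled_K1.
have ch : continuous h.
  move=> s; apply: cvgMl_tmp; apply: cvgM; first exact: continuous_gauss.
  exact: subquadratic_scaled_K1.1.
have h0 s : 0 <= h s.
  by rewrite /h mulr_ge0 ?expR_ge0// mulr_ge0 ?expR_ge0 ?scaled_K1_kernel_ge0.
transitivity (\int[mu]_s h s); last first.
  by rewrite RintegralZl.
rewrite /Rintegral ge0_symfun_integralT//; last by move=> s; rewrite /h /wt /= sqrrN.
rewrite -set_itvcy -ge0_integralZl//; last 2 first.
- by apply/measurable_EFinP/measurable_funTS; exact: continuous_measT.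
- by move=> s _; rewrite lee_fin.
congr fine; apply: eq_integral => s _; rewrite -EFinM !fctE dF1 /G mul1r cosh_arsinh2 /h.
congr EFin; rewrite (_ : - y * _ = - y + - (2 * y) * s ^+ 2); last by ring.
by rewrite expRD; ring.
Unshelve. all: end_near. Qed.

Lemma continuous_scaled_K1 z : 0 < z -> {for z, continuous scaled_K1}.
Proof.
move=> z0; have z20 : 0 < z / 2 by rewrite divr_gt0.
pose f (l s : R) := expR (- l * s ^+ 2) * ((1 + 2 * s ^+ 2) / wt s).
have k0_ := scaled_K1_kernel_ge0.
apply: (@continuity_under_integral R _ _ mu f setT measurableT (z / 2) (z + 1) _ _ (f (z / 2))).
- move=> l; rewrite /= in_itv/= => /andP[zl _]; apply: integ_subquadratic subquadratic_scaled_K1.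
  exact: lt_trans zl.
- apply: aeW => s _ l _; rewrite /f; continuity_at.
- exact: integ_subquadratic subquadratic_scaled_K1.
- move=> l; rewrite /= in_itv/= => /andP[zl _]; apply: aeW => s _.
  rewrite ger0_norm; last by rewrite mulr_ge0 ?expR_ge0.
  by rewrite ler_wpM2r// ler_expR !mulNr lerN2 ler_wpM2r ?sqr_ge0// ltW.
- by rewrite inE/= in_itv/=; lra.
Qed.

Lemma integral_derivNy (f F : R -> R) (x l : R) :
  (forall t, 0 <= f t) -> continuous f -> (forall t : R, is_derive t 1 F (f t)) ->
  F t @[t --> -oo] --> l ->
  \int[mu]_(t in `]-oo, x]) f t = F x - l.
Proof.
move=> f0 cf dF Fl.
rewrite /Rintegral -{1}(opprK x) ge0_integration_by_substitutionNy; last 2 first.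
- exact: continuous_subspaceT.
- by move=> t _.
pose H t := - F (- t).
have dH (t : R) : is_derive t 1 H (f (- t)).
  have dFt := is_derive_fun_comp F (fun t => - t) t _ _ (dF (- t)) (is_derive_fun_opp _ _ _ (is_derive_fun_id t)).
  rewrite /H; deriv; ring.
have Hl : H t @[t --> +oo] --> - l.
  by apply: cvgN; move/cvgNy_compNP : Fl.
rewrite (@ge0_continuous_FTC2y _ (f \o -%R) H (- x) (- l)) //.
- by rewrite /H /= !opprK addrC.
- by move=> t _; exact: f0.
- apply: continuous_subspaceT => t; apply: continuous_comp; [exact: opp_continuous|exact: cf].
- by apply: cvg_at_right_filter; exact: (is_derive_continuous _ _ _ (dH (- x))).
- by move=> t _; rewrite derive1E; have ? := dH t; exact: derive_val.
Qed.

End bessel.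

(** * The normal inverse Gaussian distribution function *)

Section cdf_derivative.
Context {R : realType}.
Local Notation mu := (@lebesgue_measure R).
Variables (al de tau m : R).
Hypotheses (al0 : 0 < al) (de0 : 0 < de) (tau0 : 0 < tau) (taupi : tau < pi).
Implicit Type t : R.

(** The polar coordinates omega and nu of the point (t - m, de).  The angle is
    written with the arctangent of (t - m) / de so that it is defined and
    smooth for all real t, with values in ]0, pi[. *)
Definition radius t : R := Num.sqrt ((t - m) ^+ 2 + de ^+ 2).
Definition polar_angle t : R := pi / 2 - atan ((t - m) / de).

Local Notation om := radius.
Local Notation N := polar_angle.

Lemma radius_gt0 t : 0 < om t.
Proof. by rewrite sqrtr_gt0 ltr_wpDl ?sqr_ge0// exprn_gt0. Qed.

Lemma sqr_radius t : om t ^+ 2 = (t - m) ^+ 2 + de ^+ 2.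
Proof. by rewrite sqr_sqrtr// addr_ge0 ?sqr_ge0. Qed.

Lemma radius_ge t : de <= om t.
Proof. by rewrite -[leLHS]gtr0_norm// -sqrtr_sqr ler_wsqrtr// lerDr sqr_ge0. Qed.

Lemma norm_le_radius t : `|t - m| <= om t.
Proof. by rewrite -sqrtr_sqr ler_wsqrtr// lerDl sqr_ge0. Qed.

Lemma polar_angle_bounds t : 0 < N t < pi.
Proof.
have := atan_gtNpi2 ((t - m) / de); have := atan_ltpi2 ((t - m) / de).
by rewrite /polar_angle => ? ?; apply/andP; split; lra.
Qed.

Lemma sqrt_slope t : Num.sqrt (1 + ((t - m) / de) ^+ 2) = om t / de.
Proof.
rewrite (_ : 1 + _ = (om t / de) ^+ 2); last first.
  by rewrite [in RHS]exprMn sqr_radius; field; rewrite gt_eqF.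
by rewrite sqrtr_sqr gtr0_norm// divr_gt0// radius_gt0.
Qed.

Lemma sin_polar_angle t : sin (N t) = de / om t.
Proof.
rewrite /polar_angle -[sin _]opprK -sinN opprB sinBpihalf opprK cos_atan sqrt_slope.
by rewrite invf_div.
Qed.

Lemma cos_polar_angle t : cos (N t) = (t - m) / om t.
Proof.
rewrite /polar_angle -cosN opprB cosBpihalf.
have c0 : cos (atan ((t - m) / de)) != 0.
  by rewrite gt_eqF// cos_gt0_pihalf// atan_gtNpi2 atan_ltpi2.
have := atanK ((t - m) / de); rewrite /tan => /(canRL (mulfVK c0)) ->.
by rewrite cos_atan sqrt_slope; field; rewrite !gt_eqF// radius_gt0.
Qed.

Lemma is_derive_radius t : is_derive t 1 om ((t - m) / om t).
Proof.
have o0 := radius_gt0 t; rewrite /radius; deriv.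
  by rewrite -sqrtr_gt0.
by rewrite -/(om t) expr1; field; rewrite gt_eqF.
Qed.

Lemma is_derive_polar_angle t : is_derive t 1 N (- (de / om t ^+ 2)).
Proof.
have o0 := radius_gt0 t; rewrite /polar_angle; deriv.
have s2 : 0 < (t - m) ^+ 2 + de ^+ 2 by rewrite -sqr_radius exprn_gt0.
rewrite sqr_radius; field.
by rewrite !gt_eqF//= addrC.
Qed.

Definition nig_density t := al * de * expR (de * (al * sin tau)) / pi *
  (besselK 1 (al * om t) / om t * expR (al * cos tau * (t - m))).

(** The sum F+ + F- as a function of the end point t. *)
Definition nig_primitive t :=
  angular_cdf (2 * al * om t) ((N t - tau) / 2) +
  expR (2 * (al * sin tau) * de) * angular_cdf (2 * al * om t) ((N t + tau) / 2).

Lemma exponent_difference t :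
  2 * al * om t * (sin ((N t + tau) / 2) ^+ 2 - sin ((N t - tau) / 2) ^+ 2) =
  2 * (al * sin tau) * de.
Proof.
rewrite !sqr_sin_half cosD cosB sin_polar_angle; field.
by rewrite gt_eqF// radius_gt0.
Qed.

Lemma exponent_plus t :
  2 * al * om t * sin ((N t - tau) / 2) ^+ 2 =
  al * om t - al * cos tau * (t - m) - al * sin tau * de.
Proof.
rewrite !sqr_sin_half cosB sin_polar_angle cos_polar_angle; field.
by rewrite gt_eqF// radius_gt0.
Qed.

(** In the two derivatives the terms with K_0 are multiples of
    omega' sin nu + omega nu' cos nu and of omega' cos nu - omega nu' sin nu.
    The first vanishes because omega sin nu is the constant de, and the second
    cancels between F+ and F-; the terms with K_1 add up to the density. *)
Lemma is_derive_nig_primitive t : is_derive t 1 nig_primitive (nig_density t).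
Proof.
have o0 := radius_gt0.
pose Z' t := 2 * al * ((t - m) / om t).
pose th' t := - (de / om t ^+ 2) / 2.
(* M bounds the derivatives of 2 al omega and of nu / 2, since omega >= de. *)
pose M := 2 * al + (2 * de)^-1.
have dZ r : t - 1 < r < t + 1 -> is_derive r 1 (fun r => 2 * al * om r) (Z' r).
  by move=> _; have ? := is_derive_radius r; deriv; rewrite /Z'; ring.
have dth (e : R) r : t - 1 < r < t + 1 -> is_derive r 1 (fun r => (N r + e) / 2) (th' r).
  by move=> _; have ? := is_derive_polar_angle r; deriv; rewrite /th'; ring.
have z10 : 0 < 2 * al * de by rewrite !mulr_gt0.
have zz1 r : t - 1 < r < t + 1 -> 2 * al * de <= 2 * al * om r.
  by move=> _; rewrite ler_pM2l ?mulr_gt0// radius_ge.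
have Z'M r : t - 1 < r < t + 1 -> `|Z' r| <= M.
  move=> _; apply: (@le_trans _ _ (2 * al)); last by rewrite /M lerDl invr_ge0 mulr_ge0// ltW.
  rewrite /Z' normrM gtr0_norm ?mulr_gt0// ler_piMr ?mulr_ge0 ?(ltW al0)//.
  by rewrite normrM normfV (gtr0_norm (o0 r)) ler_pdivrMr// mul1r norm_le_radius.
have th'M r : t - 1 < r < t + 1 -> `|th' r| <= M.
  move=> _; apply: (@le_trans _ _ (2 * de)^-1); last by rewrite /M lerDr mulr_ge0// ltW.
  rewrite /th' mulNr normrN gtr0_norm ?divr_gt0 ?exprn_gt0//.
  rewrite (_ : (2 * de)^-1 = de / de ^+ 2 / 2); last by field; rewrite gt_eqF.
  rewrite ler_pM2r ?invr_gt0// ler_pM2l// lef_pV2 ?posrE ?exprn_gt0//.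
  by rewrite ler_pXn2r ?nnegrE ?radius_ge// ltW.
have mp r : t - 1 < r < t + 1 -> 1 <= 1 + cos ((N r + - tau) / 2).
  move=> _; rewrite lerDl ltW// cos_gt0_pihalf//; have := polar_angle_bounds r.
  by move: tau0 taupi => h1 h2 /andP[? ?]; apply/andP; split; lra.
have mm0 : 0 < 1 + cos ((pi + tau) / 2).
  rewrite -[ltLHS](subrr 1) ler_ltD// -cospi ltr_cos ?in_itv/=;
    have := pi_gt0 R; move: tau0 taupi => h1 h2 h3; try (apply/andP; split); lra.
have mm r : t - 1 < r < t + 1 -> 1 + cos ((pi + tau) / 2) <= 1 + cos ((N r + tau) / 2).
  move=> _; rewrite lerD2l ltW// ltr_cos ?in_itv/=; have := polar_angle_bounds r;
    have := pi_gt0 R; move: tau0 taupi => h1 h2 h3 /andP[h4 h5]; try (apply/andP; split); lra.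
have tt : t - 1 < t < t + 1 by apply/andP; split; lra.
have D1 := is_derive_angular_cdf _ _ Z' th' _ _ _ M 1 t dZ (dth (- tau)) z10 zz1 Z'M th'M ltr01 mp tt.
have D2 := is_derive_angular_cdf _ _ Z' th' _ _ _ M _ t dZ (dth tau) z10 zz1 Z'M th'M mm0 mm tt.
rewrite /nig_primitive; deriv.
have ed := exponent_difference t; have ep := exponent_plus t.
have -> : expR (- (2 * al * om t) * sin ((N t - tau) / 2) ^+ 2) =
  expR (de * (al * sin tau)) * expR (al * cos tau * (t - m)) * expR (- (al * om t)).
  by rewrite mulNr ep -!expRD; congr expR; ring.
have -> : expR (- (2 * al * om t) * sin ((N t + tau) / 2) ^+ 2) =
  expR (- (2 * (al * sin tau) * de)) * (expR (de * (al * sin tau)) * expR (al * cos tau * (t - m)) * expR (- (al * om t))).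
  rewrite -!expRD; congr expR; rewrite -ed; rewrite mulrBr ep; ring.
have sc (x : R) : sin (x / 2) * cos (x / 2) = sin x / 2.
  by rewrite (sin_double_half x); field.
rewrite !sc -!cos_double_half sinB sinD cosB cosD sin_polar_angle cos_polar_angle.
rewrite /nig_density besselK_1E ?mulr_gt0// [2 * (al * om t)]mulrA (expRN (2 * _ * _)) /Z' /th'.
have EX : expR (2 * (al * sin tau) * de) != 0 by rewrite gt_eqF ?expR_gt0.
move: (expR (2 * (al * sin tau) * de)) EX => X X0.
move: (expR (de * (al * sin tau))) (expR (al * cos tau * (t - m))) (expR (- (al * om t))) => E1 E2 E3.
move: (scaled_K0 _) (scaled_K1 _) (angular_cdf _ _) (pi : R) (pi_gt0 R) => K0 K1 G p p0.
move: (om t) (o0 t) => o oo0.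
by field; rewrite X0 !gt_eqF.
Qed.

Lemma nig_density_ge0 t : 0 <= nig_density t.
Proof.
have b0 : 0 <= besselK 1 (al * om t).
  apply: Rintegral_ge0 => u _.
  by rewrite mulr_ge0 ?expR_ge0// /cosh divr_ge0// addr_ge0 ?expR_ge0.
have o0 := ltW (radius_gt0 t); have p0 := pi_ge0 R; have a0 := ltW al0; have d0 := ltW de0.
apply: mulr_ge0; first by rewrite divr_ge0// mulr_ge0 ?expR_ge0// mulr_ge0.
by rewrite mulr_ge0 ?expR_ge0// divr_ge0.
Qed.

Lemma continuous_nig_density : continuous nig_density.
Proof.
have o0 := radius_gt0.
have -> : nig_density = (fun t => al * de * expR (de * (al * sin tau)) / pi *
  (expR (- (al * om t)) * scaled_K1 (2 * (al * om t)) / om t * expR (al * cos tau * (t - m)))).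
  by apply/funext => t; rewrite /nig_density besselK_1E// mulr_gt0.
move=> t; have dr := is_derive_radius t.
have co : om x @[x --> t] --> om t by exact: is_derive_continuous dr.
have c1 : continuous (fun t => expR (al * cos tau * (t - m))) by continuity.
have c2 : {for t, continuous (fun t => expR (- (al * om t)))} by continuity_at.
apply: cvgMl_tmp; apply: cvgM; last exact: c1.
apply: cvgM; last by apply: cvgV => //; rewrite gt_eqF.
apply: cvgM; first exact: c2.
apply: (@cvg_comp _ _ _ (fun t => 2 * (al * om t)) scaled_K1); last first.
  by apply: continuous_scaled_K1; rewrite !mulr_gt0.
by apply: cvgMl_tmp; apply: cvgMl_tmp.
Qed.

Lemma cvg_polar_angle : N t @[t --> -oo] --> (pi : R).
Proof.
have -> : pi = pi / 2 - (- (pi / 2)) :> R by field.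
apply: cvgB; first exact: cvg_cst.
apply/cvgNy_compNP.
have -> : (fun t => atan ((t - m) / de)) \o -%R = (fun t => - atan ((t + m) / de)).
  by apply/funext => t /=; rewrite -atanN; congr atan; ring.
apply: cvgN; apply: (@cvg_comp _ _ _ (fun t => (t + m) / de) atan _ +oo); last exact: cvgy_atan.
apply: gt0_cvgMly; first by rewrite invr_gt0.
exact: cvg_addrr.
Qed.

Lemma cvgNy_angular_cdf (e : R) : 0 < sin ((pi + e) / 2) ->
  angular_cdf (2 * al * om t) ((N t + e) / 2) @[t --> -oo] --> (0 : R).
Proof.
move=> s0.
have Zy : 2 * al * om t @[t --> -oo] --> +oo.
  apply: gt0_cvgMry; first by rewrite mulr_gt0.
  apply/cvgryPge => A; near=> t.
  rewrite (le_trans _ (norm_le_radius t))// -normrN (le_trans _ (ler_norm _))//.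
  have : t <= m - A by near: t; exact: nbhs_ninfty_le.
  by move=> ?; lra.
have sl : sin ((N t + e) / 2) @[t --> -oo] --> sin ((pi + e) / 2).
  apply: (@cvg_comp _ _ _ (fun t => (N t + e) / 2) sin _ (nbhs ((pi + e) / 2))); last exact: continuous_sin.
  by apply: cvgMr_tmp; apply: cvgD; [exact: cvg_polar_angle|exact: cvg_cst].
have bl : Num.sqrt (pi / (2 * al * om t)) / sin ((N t + e) / 2) ^+ 2 @[t --> -oo] --> (0 : R).
  rewrite -[X in _ --> X](mul0r ((sin ((pi + e) / 2) ^+ 2)^-1)); apply: cvgM; last first.
    apply: cvgV; first by rewrite expf_neq0// gt_eqF.
    by apply: (@cvg_comp _ _ _ (fun t => sin ((N t + e) / 2)) (fun x => x ^+ 2) _ _ _ sl); exact: exprn_continuous.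
  have h : pi / (2 * al * om t) @[t --> -oo] --> (0 : R).
    rewrite -[X in _ --> X](mulr0 pi); apply: cvgMl_tmp.
    by apply/gtr0_cvgV0 => //; near=> t; rewrite !mulr_gt0// radius_gt0.
  rewrite -[X in _ --> X]sqrtr0.
  by apply: (@cvg_comp _ _ _ (fun t => pi / (2 * al * om t)) Num.sqrt _ _ _ h); exact: sqrt_continuous.
have sp : \forall t \near -oo, 0 < sin ((N t + e) / 2).
  exact: (cvgr_gt _ sl).
apply: (@squeeze_cvgr _ _ _ _ (fun t => - (Num.sqrt (pi / (2 * al * om t)) / sin ((N t + e) / 2) ^+ 2))
   (fun t => Num.sqrt (pi / (2 * al * om t)) / sin ((N t + e) / 2) ^+ 2)) => //; last first.
  by rewrite -[X in _ --> X]oppr0; exact: cvgN.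
near=> t; rewrite -ler_norml; apply: angular_cdf_bound.
  by rewrite !mulr_gt0// radius_gt0.
by near: t.
Unshelve. all: end_near. Qed.

(** Both sides have the same derivative and tend to zero at minus infinity. *)
Lemma integral_nig_density x :
  al * de * expR (de * (al * sin tau)) / pi *
    \int[mu]_(t in `]-oo, x])
      (besselK 1 (al * om t) / om t * expR (al * cos tau * (t - m))) =
  nig_primitive x.
Proof.
set K := al * de * _ / pi.
have K0 : 0 < K by rewrite !mulr_gt0 ?invr_gt0 ?pi_gt0 ?expR_gt0.
have -> : (fun t => besselK 1 (al * om t) / om t * expR (al * cos tau * (t - m))) =
    (fun t => K^-1 * nig_density t).
  by apply/funext => t; rewrite /nig_density -/K mulKf// gt_eqF.
have h0 t : 0 <= K^-1 * nig_density t.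
  by rewrite mulr_ge0 ?nig_density_ge0// invr_ge0 ltW.
have hc : continuous (fun t => K^-1 * nig_density t).
  by move=> t; apply: cvgMl_tmp; exact: continuous_nig_density.
have hd (t : R) : is_derive t 1 (fun t => K^-1 * nig_primitive t) (K^-1 * nig_density t).
  by have ? := is_derive_nig_primitive t; deriv; ring.
have hl : K^-1 * nig_primitive t @[t --> -oo] --> (0 : R).
  rewrite -[X in _ --> X](mulr0 K^-1); apply: cvgMl_tmp.
  have sp (e : R) : - pi < e < pi -> 0 < sin ((pi + e) / 2).
    by move=> /andP[e1 e2]; apply: sin_gt0_pi; apply/andP; split; lra.
  have pi0 := pi_gt0 R.
  rewrite -[X in _ --> X](addr0 0); apply: cvgD.
    by apply: cvgNy_angular_cdf; apply: sp; move: tau0 taupi => h1 h2; apply/andP; split; lra.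
  rewrite -[X in _ --> X](mulr0 (expR (2 * (al * sin tau) * de))); apply: cvgMl_tmp.
  by apply: cvgNy_angular_cdf; apply: sp; move: tau0 taupi => h1 h2; apply/andP; split; lra.
rewrite (@integral_derivNy R (fun t => K^-1 * nig_density t) (fun t => K^-1 * nig_primitive t) x 0 h0 hc hd hl).
by rewrite subr0 mulVKf// gt_eqF.
Qed.

End cdf_derivative.

(** * Analyticity from bounds on derivatives *)

Section taylor.
Context {R : realType}.
Implicit Types (t x y a : R) (n k : nat).

Lemma nondecreasing_derive (f f' : R -> R) y : 0 <= y ->
  (forall t, 0 <= t <= y -> is_derive t 1 f (f' t)) ->
  (forall t, 0 <= t <= y -> 0 <= f' t) -> f 0 <= f y.
Proof.
move=> y0 df f0.
have sub t : t \in `]0, y[ -> 0 <= t <= y.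
  by rewrite in_itv/= => /andP[t0 ty]; rewrite !ltW.
apply: (@ger0_derive1_le_cc R f 0 y) => //.
- by move=> t /sub /df ?; exact: ex_derive.
- by move=> t /sub ty; rewrite derive1E; have := df t ty => dft; rewrite derive_val f0.
- apply: derivable_within_continuous => t; rewrite in_itv/= => ty.
  by have := df t ty => dft; exact: ex_derive.
- by rewrite in_itv/= lexx.
- by rewrite in_itv/= lexx andbT.
Qed.

(** By induction on n: the derivative of f 0 minus its Taylor polynomial is the
    same difference for f 1, and bounds on derivatives integrate to bounds on
    functions. *)
Lemma taylor_remainder_le n (f : nat -> R -> R) (B t : R) : 0 <= t <= 1 ->
  (forall k x, 0 <= x <= 1 -> is_derive x 1 (f k) (f k.+1 x)) ->
  (forall x, 0 <= x <= 1 -> `|f n x| <= B) ->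
  `|f 0 t - \sum_(k < n) f k 0 / k`!%:R * t ^+ k| <= B / n`!%:R * t ^+ n.
Proof.
elim: n f t => [|n ih] f t t01 df fB.
  by rewrite big_ord0 subr0 fact0 divr1 expr0 mulr1 fB.
have /andP[t0 t1] := t01.
pose P (x : R) : R := \sum_(k < n.+1) f k 0 / k`!%:R * x ^+ k.
pose P' (x : R) : R := \sum_(k < n) f k.+1 0 / k`!%:R * x ^+ k.
have dP x : is_derive x 1 P (P' x).
  rewrite /P /P'.
  have -> : (fun x => \sum_(k < n.+1) f k 0 / k`!%:R * x ^+ k) =
    \sum_(k < n.+1) (fun x : R => f k 0 / k`!%:R * x ^+ k).
    by apply/funext => y; rewrite fct_sumE.
  have -> : \sum_(k < n) f k.+1 0 / k`!%:R * x ^+ k =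
    \sum_(k < n.+1) (f k 0 / k`!%:R * (k%:R * x ^+ k.-1)).
    rewrite big_ord_recl /= mul0r mulr0 add0r; apply: eq_bigr => i _.
    rewrite /bump leq0n add1n add0n factS natrM; field.
    by rewrite ?nat1r !pnatr_eq0 -lt0n fact_gt0.
  apply: is_derive_sum => i; deriv; ring.
have g' x : 0 <= x <= 1 -> `|f 1 x - P' x| <= B / n`!%:R * x ^+ n.
  by move=> x01; apply: (ih (fun k => f k.+1)) => // k y y01; exact: df.
pose Q (x : R) := B / n.+1`!%:R * x ^+ n.+1.
have dQ (x : R) : is_derive x 1 Q (B / n`!%:R * x ^+ n).
  rewrite /Q; deriv; rewrite /= factS natrM; field.
  by rewrite ?nat1r !pnatr_eq0 -lt0n fact_gt0.
have xt (x : R) : 0 <= x <= t -> 0 <= x <= 1.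
  by move=> /andP[-> xt] /=; exact: le_trans t1.
have Q0 : Q 0 = 0 by rewrite /Q expr0n mulr0.
have P0 : P 0 = f 0 0.
  rewrite /P big_ord_recl expr0 mulr1 fact0 divr1 big1 ?addr0// => i _.
  by rewrite expr0n mulr0.
rewrite -/(P t) -/(Q t) ler_norml; apply/andP; split.
- rewrite -subr_ge0 opprK.
  have := @nondecreasing_derive (fun x => f 0 x - P x + Q x)
    (fun x => f 1 x - P' x + B / n`!%:R * x ^+ n) t t0.
  rewrite P0 Q0 subrr addr0; apply.
    by move=> x /xt /df dfx; have ? := dP x; have ? := dQ x; deriv.
  by move=> x /xt /g'; rewrite ler_norml => /andP[h _]; rewrite -lerBlDr sub0r.
- rewrite -subr_ge0.
  have := @nondecreasing_derive (fun x => Q x - (f 0 x - P x))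
    (fun x => B / n`!%:R * x ^+ n - (f 1 x - P' x)) t t0.
  rewrite P0 Q0 subrr subr0; apply.
    by move=> x /xt /df dfx; have ? := dP x; have ? := dQ x; deriv.
  by move=> x /xt /g'; rewrite ler_norml => /andP[_ h]; rewrite subr_ge0.
Qed.

(** A derivative bound of the form B C^n n! makes the Taylor series converge
    geometrically where C |y - a| <= 1/2.  The Taylor estimate is applied on
    the segment from a to y, parametrised by [0, 1], so that both sides of a
    are treated at once. *)
Lemma analytic_of_derivatives (f : nat -> R -> R) (u v a B C : R) :
  u < a < v -> 0 < C ->
  (forall n x, u < x < v -> is_derive x 1 (f n) (f n.+1 x)) ->
  (forall n x, u < x < v -> `|f n.+1 x| <= B * (C ^+ n.+1 * n.+1`!%:R)) ->
  analytic_at (f 0) a.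
Proof.
move=> /andP[ua av] C0 df fB; exists (fun k => f k a / k`!%:R).
have B0 : 0 <= B.
  have := fB 0 a; rewrite ua av => /(_ isT); rewrite expr1 (_ : 1`! = 1%N)// mulr1 => h.
  by have := le_trans (normr_ge0 _) h; rewrite pmulr_lge0.
near=> y.
have uyv (s : R) : 0 <= s <= 1 -> u < a + s * (y - a) < v.
  move=> /andP[s0 s1].
  have uy : u < y by near: y; exact: lt_nbhsr.
  have yv : y < v by near: y; exact: lt_nbhsl.
  have s1' : 0 <= 1 - s by lra.
  have [q1 q2] : 0 <= s * (y - u) /\ 0 <= s * (v - y) by split; apply: mulr_ge0; lra.
  have [q3 q4] : 0 <= (1 - s) * (a - u) /\ 0 <= (1 - s) * (v - a) by split; apply: mulr_ge0; lra.
  have [hs|hs] := leP s 2^-1.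
    have : 0 < (1 - s) * (a - u) by apply: mulr_gt0; lra.
    have : 0 < (1 - s) * (v - a) by apply: mulr_gt0; lra.
    by move=> ? ?; apply/andP; split; nra.
  have : 0 < s * (y - u) by apply: mulr_gt0; lra.
  have : 0 < s * (v - y) by apply: mulr_gt0; lra.
  by move=> ? ?; apply/andP; split; nra.
pose h := y - a.
pose g k (s : R) := f k (a + s * h) * h ^+ k.
have dg k (s : R) : 0 <= s <= 1 -> is_derive s 1 (g k) (g k.+1 s).
  move=> s01; have dfk := df k _ (uyv s s01).
  have dl : is_derive s 1 (fun s => a + s * h) h by deriv; ring.
  have dc := is_derive_fun_comp (f k) _ s _ _ dfk dl.
  rewrite /g; deriv; rewrite exprS -/h; ring.
have Ch : C * `|h| <= 2^-1.
  rewrite mulrC -ler_pdivlMr// /h; near: y.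
  have e0 : 0 < 2^-1 / C by rewrite divr_gt0.
  by exists (2^-1 / C) => //= y /=; rewrite distrC => /ltW.
have rem n : `|f 0 y - series (fun k => f k a / k`!%:R * (y - a) ^+ k) n.+1| <= B * 2^-1 ^+ n.+1.
  have gB x : 0 <= x <= 1 -> `|g n.+1 x| <= B * (C ^+ n.+1 * n.+1`!%:R) * `|h| ^+ n.+1.
    by move=> x01; rewrite /g normrM normrX ler_wpM2r ?exprn_ge0// fB// uyv.
  have l01 : 0 <= (1 : R) <= 1 by rewrite ler01 lexx.
  have g01 : g 0%N 1 = f 0%N y by rewrite /g mul1r expr0 mulr1 /h addrC subrK.
  have H := @taylor_remainder_le n.+1 g _ 1 l01 dg gB; rewrite g01 in H.
  rewrite seriesEord /=.
  have -> : \sum_(k < n.+1) f k a / k`!%:R * (y - a) ^+ k =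
     \sum_(k < n.+1) g k 0 / k`!%:R * 1 ^+ k.
    by apply: eq_bigr => k _; rewrite /g mul0r addr0 expr1n mulr1 mulrAC.
  apply: le_trans H _; rewrite expr1n mulr1.
  have -> : B * (C ^+ n.+1 * n.+1`!%:R) * `|h| ^+ n.+1 / n.+1`!%:R = B * (C * `|h|) ^+ n.+1.
    rewrite exprMn; move: (C ^+ n.+1) (`|h| ^+ n.+1) => c d; field.
    by rewrite pnatr_eq0 -lt0n fact_gt0.
  rewrite ler_wpM2l// ler_pXn2r ?nnegrE ?mulr_ge0// ?invr_ge0// ltW//.
rewrite -(cvg_shiftS (series _)) /=.
have geo : (fun n => B * 2^-1 ^+ n.+1) @ \oo --> (0 : R).
  rewrite -[X in _ --> X](mulr0 B); apply: cvgMl_tmp.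
  rewrite (cvg_shiftS (fun n => (2^-1 : R) ^+ n)); apply: cvg_expr.
  by rewrite ger0_norm ?invr_ge0// invf_lt1// ltr1n.
apply/cvgrPdist_le => e e0; have /cvgr0Pnorm_le/(_ e e0) := geo.
apply: filterS => n; rewrite ger0_norm; last by rewrite mulr_ge0// exprn_ge0// invr_ge0.
by apply: le_trans; exact: rem.
Unshelve. all: end_near. Qed.

End taylor.

(** * Derivatives of exponentials of trigonometric functions *)

Section trig_exp.
Context {R : realType}.
Variables (r tau : R).
Implicit Types (x N k : R) (f : R -> R) (d : nat).

(** The functions obtained from e^(r cos(x - tau)) cos^i sin^j by linear
    combination.  The number d bounds the degrees i + j, and N bounds the sum
    of the absolute values of the coefficients.  Tracking both through
    differentiation is what gives factorial bounds on all derivatives. *)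
Inductive trig_exp : nat -> R -> (R -> R) -> Prop :=
| te_mono i j : trig_exp (i + j) 1 (fun x => expR (r * cos (x - tau)) *
    (cos (x - tau) ^+ i * sin (x - tau) ^+ j))
| te_scale d N k f : trig_exp d N f -> trig_exp d (`|k| * N) (fun x => k * f x)
| te_add d N N' f g : trig_exp d N f -> trig_exp d N' g ->
    trig_exp d (N + N') (fun x => f x + g x)
| te_weaken d d' N N' f : (d <= d')%N -> N <= N' -> trig_exp d N f -> trig_exp d' N' f.

Lemma trig_exp_le d N f : trig_exp d N f ->
  0 <= N /\ forall x, `|f x| <= N * expR `|r|.
Proof.
elim=> {d N f} [i j|d N k f _ [N0 ih]|d N N' f g _ [N0 ih1] _ [N'0 ih2]|d d' N N' f _ NN' _ [N0 ih]].
- split => // x; rewrite mul1r normrM (ger0_norm (expR_ge0 _)) -[leRHS]mulr1 ler_pM ?expR_ge0//.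
    rewrite ler_expR (le_trans (ler_norm _))// normrM ler_piMr//; exact: cos_max.
  rewrite normrM !normrX -[leRHS]mulr1 ler_pM ?exprn_ge0//; rewrite exprn_ile1 ?cos_max ?sin_max//.
- split; first by rewrite mulr_ge0.
  by move=> x; rewrite normrM -mulrA ler_wpM2l.
- split; first by rewrite addr_ge0.
  by move=> x; rewrite (le_trans (ler_normD _ _))// mulrDl lerD.
- split; first exact: le_trans N0 NN'.
  by move=> x; rewrite (le_trans (ih x))// ler_wpM2r ?expR_ge0.
Qed.

(** Differentiating a monomial produces r times one monomial of the next
    degree and, counted with multiplicity, i + j monomials of the same
    degree. *)
Lemma trig_exp_derive d N f : trig_exp d N f -> exists f',
  trig_exp d.+1 ((`|r| + d%:R) * N) f' /\ forall x, is_derive x 1 f (f' x).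
Proof.
elim=> {d N f} [i j|d N k f _ [f' [h1 h2]]|d N N' f g _ [f' [h1 h2]] _ [g' [h3 h4]]|d d' N N' f dd' NN' tf [f' [h1 h2]]].
- pose T a b x := expR (r * cos (x - tau)) * (cos (x - tau) ^+ a * sin (x - tau) ^+ b).
  exists (fun x => - r * T i j.+1 x + (- i%:R * T i.-1 j.+1 x + j%:R * T i.+1 j.-1 x)); split.
    have -> : (`|r| + (i + j)%:R) * 1 = `|- r| * 1 + (`|- i%:R : R| * 1 + `|j%:R : R| * 1).
      by rewrite !mulr1 !normrN !normr_nat natrD.
    apply: te_add; first by apply: te_scale; rewrite -addnS; exact: te_mono.
    apply: te_add; apply: te_scale.
      by apply: te_weaken (te_mono _ _) => //; rewrite addnS ltnS leq_add2r leq_pred.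
    by apply: te_weaken (te_mono _ _) => //; rewrite addSn ltnS leq_add2l leq_pred.
  move=> x; deriv; rewrite /T.
  set E := expR _; move: E => E; move: (cos (x - tau)) (sin (x - tau)) => c s.
  case: i j => [|i] [|j] /=; rewrite ?exprS; ring.
- exists (fun x => k * f' x); split; last by move=> x; have ? := h2 x; deriv; ring.
  by rewrite mulrCA; exact: te_scale.
- exists (fun x => f' x + g' x); split; last by move=> x; have ? := h2 x; have ? := h4 x; deriv; ring.
  by rewrite mulrDr; exact: te_add.
- exists f'; split => //; apply: te_weaken h1 => //.
  have [N0 _] := trig_exp_le _ _ _ tf.
  by rewrite ler_pM ?addr_ge0// lerD2l ler_nat.
Qed.

(** The product of the factors |r| + d + i for i < n is at most
    (|r| + d + 1)^n n!. *)
Lemma trig_exp_iterates d N f : trig_exp d N f ->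
  exists F : nat -> R -> R, [/\ F 0 = f,
    (forall n x, is_derive x 1 (F n) (F n.+1 x)) &
    forall n x, `|F n x| <= N * expR `|r| * ((`|r| + d%:R + 1) ^+ n * n`!%:R)].
Proof.
move=> tf; have [N0 _] := trig_exp_le _ _ _ tf.
pose C := `|r| + d%:R + 1.
pose bd n := N * (C ^+ n * n`!%:R).
have C0 : 0 <= C by rewrite !addr_ge0.
have step (nf : nat * (R -> R)) : exists g, trig_exp (d + nf.1) (bd nf.1) nf.2 ->
    trig_exp (d + nf.1.+1) (bd nf.1.+1) g /\ forall x, is_derive x 1 nf.2 (g x).
  case: nf => n g /=; have [tg|ntg] := pselect (trig_exp (d + n) (bd n) g); last by exists g.
  have [g' [tg' dg]] := trig_exp_derive _ _ _ tg; exists g' => _; split => //.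
  rewrite addnS; apply: te_weaken tg' => //.
  rewrite {2}/bd exprS factS natrM.
  have -> : N * (C * C ^+ n * (n.+1%:R * n`!%:R)) = C * n.+1%:R * bd n by rewrite /bd; ring.
  apply: ler_wpM2r; first by rewrite !mulr_ge0// exprn_ge0.
  rewrite /C natrD -(natr1 n); have := normr_ge0 r; have := ler0n R d; have := ler0n R n.
  move: (n%:R : R) (d%:R : R) `|r| => a b c *; have : 0 <= a * (c + b) by rewrite mulr_ge0// addr_ge0.
  nra.
have [S HS] := choice step.
pose F := fix F n := if n is k.+1 then S (k, F k) else f.
have HF n : trig_exp (d + n) (bd n) (F n).
  elim: n => [|n ih]; first by rewrite addn0 /bd mul1r mulr1.
  exact: (HS (n, F n) ih).1.
exists F; split => //.
- by move=> n; exact: (HS (n, F n) (HF n)).2.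
- by move=> n x; rewrite mulrAC; exact: (trig_exp_le _ _ _ (HF n)).2.
Qed.

End trig_exp.

(** * The identity theorem for real analytic functions *)

Section identity_theorem.
Context {R : realType}.
Implicit Types (a b t : R) (f g : R -> R).

Lemma analytic_near_eq f g a : analytic_at f a -> analytic_at g a ->
  (forall e, 0 < e -> exists2 d, 0 < d <= e & forall y, a < y < a + d -> f y = g y) ->
  \forall y \near a, f y = g y.
Proof.
move=> [c hc] [d hd] fg.
have [e /= e0 he] : \forall y \near a, series (fun k => (c k - d k) * (y - a) ^+ k) @ \oo --> f y - g y.
  near=> y.
  have -> : series (fun k => (c k - d k) * (y - a) ^+ k) =
      series (fun k => c k * (y - a) ^+ k) \- series (fun k => d k * (y - a) ^+ k).
    apply/funext => n; rewrite !seriesEord /= -sumrB.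
    by apply: eq_bigr => k _; rewrite mulrBl.
  by apply: cvgB; [near: y | near: y].
have [r /andP[r0 re] hr] := fg e e0.
have cd0 : forall k, c k - d k = 0.
  apply: (power_series_eq0 _ r) => // h /andP[h0 hr'].
  have q : `|a - (a + h)| < e.
    by rewrite opprD addrA subrr sub0r normrN gtr0_norm// (lt_le_trans hr').
  have := he (a + h) q; rewrite hr ?subrr ?(addrC a) ?addrK//.
  by rewrite ltrDr h0 ltrD2r.
exists e => // y /he.
have -> : series (fun k => (c k - d k) * (y - a) ^+ k) = fun=> 0.
  by apply/funext => n; rewrite seriesEord /= big1// => k _; rewrite cd0 mul0r.
move=> H; apply/eqP; rewrite -subr_eq0; apply/eqP.
have H0 : (fun=> 0 : R) @ \oo --> (0 : R) by exact: cvg_cst.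
by rewrite -(cvg_lim _ H)// (cvg_lim _ H0).
Unshelve. all: end_near. Qed.

(** Let m be the infimum of the points to the right of which f and g agree.
    If m were greater than a, the two power series at m would agree to the
    right of m, hence be equal, and f and g would agree to the left of m. *)
Lemma analytic_identity f g a b t : a < t < b ->
  (forall x, a < x < b -> analytic_at f x) ->
  (forall x, a < x < b -> analytic_at g x) ->
  (forall x, t < x < b -> f x = g x) ->
  forall x, a < x < b -> f x = g x.
Proof.
move=> /andP[at_ tb] af ag fg.
pose E := [set s | a <= s < b /\ forall x, s < x < b -> f x = g x].
have Et : E t by split => //; rewrite ltW.
have lE : has_inf E by split; [exists t | exists a => s [/andP[]]].
pose m := inf E.
have am : a <= m by apply: lb_le_inf; [exists t | move=> s [/andP[]]].
have mt : m <= t by apply: ge_inf => //; exact: lE.2.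
have fgm x : m < x < b -> f x = g x.
  move=> /andP[mx xb].
  have [s Es sx] : exists2 s, E s & s < x by apply: inf_lt => //; exists t.
  by apply: Es.2; rewrite sx.
have [->|ma] := eqVneq a m; first exact: fgm.
have am' : a < m by rewrite lt_neqAle ma.
have mb : m < b := le_lt_trans mt tb.
have : \forall y \near m, f y = g y.
  apply: analytic_near_eq; [by apply: af; rewrite am'|by apply: ag; rewrite am'|].
  move=> e e0; exists (Num.min e (b - m)); first by rewrite lt_min e0 subr_gt0 mb/= ge_min lexx.
  move=> y /andP[my ym]; apply: fgm; rewrite my/=.
  by rewrite (lt_le_trans ym)// -lerBrDl ge_min lexx orbT.
move=> [e /= e0 he].
pose s := Num.max a (m - e / 2).
have sm : s < m by rewrite gt_max am' ltrBlDr ltrDl divr_gt0.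
suff Es : E s by have := ge_inf lE.2 Es; rewrite leNgt -/m sm.
split; first by rewrite le_max lexx/= (lt_trans sm).
move=> x /andP[sx xb]; have [mx|xm] := ltP m x; first by apply: fgm; rewrite mx.
apply: he => /=; rewrite ger0_norm ?subr_ge0//.
by move: sx; rewrite gt_max => /andP[_]; lra.
Qed.

End identity_theorem.

(** * Analytic continuation of F+ *)

Section continuation.
Context {R : realType}.
Variables (z tau : R).
Hypotheses (z0 : 0 < z) (tau0 : 0 < tau) (taupi : tau < pi).

(** The zeroth and first powers are displayed so that both terms are literally
    scaled monomials of the class trig_exp, with r = z / 2. *)
Lemma is_derive_angular_cdf_angle x : 0 < x < pi ->
  is_derive x 1 (fun x => angular_cdf z ((x - tau) / 2))
    (- (2 * pi)^-1 * (z / 2) * expR (- (z / 2)) * scaled_K1 z *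
       (expR (z / 2 * cos (x - tau)) * (cos (x - tau) ^+ 0 * sin (x - tau) ^+ 0)) +
     - (2 * pi)^-1 * (z / 2) * expR (- (z / 2)) * scaled_K0 z *
       (expR (z / 2 * cos (x - tau)) * (cos (x - tau) ^+ 1 * sin (x - tau) ^+ 0))).
Proof.
move=> x0pi; move: (tau0) (taupi) => t0 tpi.
have c0 y : 0 < y < pi -> 0 < cos ((y - tau) / 2).
  by move=> /andP[y0 ypi]; apply: cos_gt0_pihalf; apply/andP; split; lra.
have dz (t : R) : 0 < t < pi -> is_derive t 1 (fun=> z) 0 by move=> _; deriv.
have dth (t : R) : 0 < t < pi -> is_derive t 1 (fun x => (x - tau) / 2) 2^-1.
  by move=> _; deriv; ring.
have hM (t : R) : 0 < t < pi -> `|2^-1 : R| <= 1.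
  by move=> _; rewrite ger0_norm ?invr_ge0// invf_le1// ler1n.
have hM0 (t : R) : 0 < t < pi -> `|0 : R| <= 1 by move=> _; rewrite normr0.
have hc (t : R) : 0 < t < pi -> 1 <= 1 + cos ((t - tau) / 2).
  by move=> /c0 /ltW; rewrite lerDl.
have hz (t : R) : 0 < t < pi -> z <= z by [].
have H := @is_derive_angular_cdf R (fun=> z) (fun x => (x - tau) / 2) (fun=> 0) (fun=> 2^-1) 0 pi z 1 1 x
  dz dth z0 hz hM0 hM ltr01 hc x0pi.
apply: (@is_derive_eq _ _ _ _ _ _ _ _ H).
rewrite !expr0 !expr1 !mulr1 mulr0 add0r.
have e1 := sqr_sin_half (x - tau); have e2 := cos_double_half (x - tau).
rewrite -e2 e1.
have -> : - z * ((1 - cos (x - tau)) / 2) = - (z / 2) + z / 2 * cos (x - tau) by field.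
rewrite expRD; set E := expR (- _); set F := expR (_ * _).
move: (cos _) E F (scaled_K0 z) (scaled_K1 z) (pi : R) (pi_gt0 R) => c E F a b p p0.
by field; rewrite gt_eqF.
Qed.

Lemma analytic_angular_cdf x : 0 < x < pi -> analytic_at (fun x => angular_cdf z ((x - tau) / 2)) x.
Proof.
move=> x0pi.
pose A k := - (2 * pi)^-1 * (z / 2) * expR (- (z / 2)) * k : R.
have m0 := te_weaken _ _ 0 1 _ _ _ isT (lexx _) (te_mono (z / 2) tau 0 0).
have tG := te_add _ _ _ _ _ _ _ (te_scale _ _ _ _ (A (scaled_K1 z)) _ m0)
  (te_scale _ _ _ _ (A (scaled_K0 z)) _ (te_mono (z / 2) tau 1 0)).
have [F [F0 dF FB]] := trig_exp_iterates _ _ _ _ _ tG.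
(* The family of successive derivatives: the function itself, then the
   iterates of its explicit first derivative. *)
pose G n := if n is k.+1 then F k else fun x => angular_cdf z ((x - tau) / 2).
pose C := `|z / 2| + 1%:R + 1 : R.
have [B {}FB] : exists B, forall n x, `|F n x| <= B * (C ^+ n * n`!%:R).
  by eexists; exact: FB.
have C1 : 1 <= C by rewrite /C lerDr.
apply: (@analytic_of_derivatives R G 0 pi x B C x0pi).
- exact: lt_le_trans C1.
- move=> [|n] y y0pi /=; last exact: dF.
  by rewrite F0; exact: is_derive_angular_cdf_angle.
- move=> n y _ /=; apply: le_trans (FB n y) _.
  have B0 : 0 <= B.
    have := FB 0 x; rewrite expr0 mul1r mulr1 => h.
    exact: le_trans (normr_ge0 _) h.
  apply: ler_wpM2l => //; apply: ler_pM; rewrite ?exprn_ge0 ?(le_trans _ C1)//.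
    by apply: ler_weXn2l.
  by rewrite ler_nat leq_fact.
Qed.

(** The angular form is analytic on ]0, pi[ and equals the defining integral of
    F+ for nu > tau, so by the identity theorem it is the continuation. *)
Lemma Fp_continuationE x : 0 < x < pi ->
  Fp_continuation z tau x = angular_cdf z ((x - tau) / 2).
Proof.
move=> x0pi; move: (tau0) (taupi) => t0 tpi.
have GP : is_Fp_continuation z tau (fun x => angular_cdf z ((x - tau) / 2)).
  split; first exact: analytic_angular_cdf.
  move=> n /andP[tn npi]; rewrite Fp_integralE//.
  by apply: sin_gt0_pi; apply/andP; split; lra.
have [aF eF] : is_Fp_continuation z tau (Fp_continuation z tau).
  by rewrite /Fp_continuation; apply: (@xgetPex _ _ [set f | is_Fp_continuation z tau f]); exists (fun x => angular_cdf z ((x - tau) / 2)).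
have t0pi : 0 < tau < pi by rewrite t0.
have E y : tau < y < pi -> Fp_continuation z tau y = angular_cdf z ((y - tau) / 2).
  by move=> hy; rewrite eF// GP.2.
exact: (analytic_identity _ (fun x => angular_cdf z ((x - tau) / 2)) 0 pi tau t0pi aF GP.1 E).
Qed.
End continuation.

(** * The parameters of the distribution *)

Section parameters.
Context {R : realType}.
Implicit Type p : nig R.

Lemma cos_tau p : admissible p -> cos (tau p) = beta p / alpha p.
Proof.
move=> [a0 /andP[b1 b2] _ _]; rewrite /tau acosK// in_itv/=.
by rewrite lerNl -mulNr !ler_pdivrMr// !mul1r ltW ?(ltW b2)// ltrNl.
Qed.

Lemma tau_bounds p : admissible p -> 0 < tau p < pi.
Proof.
move=> [a0 /andP[b1 b2] _ _]; rewrite /tau.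
have h : -1 < beta p / alpha p < 1.
  by rewrite ltr_pdivlMr// ltr_pdivrMr// mulN1r mul1r b1 b2.
by case/andP: h => h1 h2; rewrite acos_gt0 ?acos_ltpi ?h1 ?h2 ?ltW.
Qed.

Lemma gamE p : admissible p -> gam p = alpha p * sin (tau p).
Proof.
move=> adm; have [a0 _ _ _] := adm; have /andP[t0 tpi] := tau_bounds p adm.
have s0 : 0 <= sin (tau p) by apply: sin_ge0_pi; rewrite !ltW.
rewrite /gam -[RHS]ger0_norm; last by rewrite mulr_ge0// ltW.
rewrite -sqrtr_sqr; congr Num.sqrt.
rewrite exprMn sin2cos2 cos_tau//; field.
by rewrite gt_eqF.
Qed.

Lemma omegaE p : omega p = radius (delta p) (mu p) (xvar p).
Proof. by []. Qed.

Lemma nu_polar_angle p : admissible p -> nu p = polar_angle (delta p) (mu p) (xvar p).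
Proof.
move=> [_ _ d0 x0]; have o0 := radius_gt0 _ (mu p) d0 (xvar p).
have /andP[N0 _] := polar_angle_bounds (delta p) (mu p) (xvar p).
have Npi : polar_angle (delta p) (mu p) (xvar p) < pi / 2.
  by rewrite /polar_angle ltrBlDr ltrDl -atan0 lt_atan// divr_gt0.
have xm0 : xvar p - mu p != 0 by rewrite gt_eqF.
rewrite /nu -[RHS]tanK; last by rewrite in_itv/= Npi andbT (lt_trans _ N0)// oppr_lt0 divr_gt0// pi_gt0.
rewrite /tan sin_polar_angle// cos_polar_angle//; congr atan; rewrite /xi; field.
by rewrite xm0 gt_eqF.
Qed.

Lemma omega_gt0 p : admissible p -> 0 < omega p.
Proof. by move=> [_ _ d0 _]; exact: radius_gt0. Qed.

Lemma zvar_gt0 p : admissible p -> 0 < zvar p.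
Proof.
by move=> adm; have [a0 _ _ _] := adm; rewrite !mulr_gt0// omega_gt0.
Qed.

Lemma nu_bounds p : admissible p -> 0 < nu p < pi / 2.
Proof.
by move=> [_ _ d0 x0]; rewrite /nu atan_ltpi2 -atan0 lt_atan// divr_gt0.
Qed.

Lemma thetap_bounds p : admissible p -> - (pi / 2) < (nu p - tau p) / 2 < pi / 2.
Proof.
move=> adm; have /andP[t0 tpi] := tau_bounds p adm; have /andP[n0 npi] := nu_bounds p adm.
by apply/andP; split; lra.
Qed.

Lemma thetam_bounds p : admissible p -> 0 < (nu p + tau p) / 2 < 3 * pi / 4.
Proof.
move=> adm; have /andP[t0 tpi] := tau_bounds p adm; have /andP[n0 npi] := nu_bounds p adm.
by apply/andP; split; lra.
Qed.

Lemma FplusE p : admissible p -> Fplus p = angular_cdf (zvar p) ((nu p - tau p) / 2).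
Proof.
move=> adm; have /andP[t0 tpi] := tau_bounds p adm; have /andP[n0 npi] := nu_bounds p adm.
have z0 := zvar_gt0 p adm; have p0 := pi_gt0 R.
rewrite /Fplus; case: ifPn => [tn|_].
  by rewrite Fp_integralE//; apply: sin_gt0_pi; apply/andP; split; lra.
by rewrite Fp_continuationE//; apply/andP; split; lra.
Qed.

Lemma two_gam_delta p : admissible p ->
  2 * gam p * delta p = zvar p * (sin ((nu p + tau p) / 2) ^+ 2 - sin ((nu p - tau p) / 2) ^+ 2).
Proof.
move=> adm; have [a0 _ d0 _] := adm.
by rewrite nu_polar_angle// gamE// /zvar omegaE exponent_difference.
Qed.

Lemma sin_thetam_gt0 p : admissible p -> 0 < sin ((nu p + tau p) / 2).
Proof.
move=> adm; have /andP[t0 tpi] := thetam_bounds p adm; have p0 := pi_gt0 R.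
by apply: sin_gt0_pi; apply/andP; split; lra.
Qed.

Lemma FminusE p : admissible p ->
  Fminus p = expR (2 * gam p * delta p) * angular_cdf (zvar p) ((nu p + tau p) / 2).
Proof.
move=> adm; rewrite /Fminus Fm_integralE ?zvar_gt0 ?sin_thetam_gt0//.
by rewrite two_gam_delta.
Qed.

Lemma FnigE p : admissible p -> Fnig p = Fplus p + Fminus p.
Proof.
move=> adm; have [a0 _ d0 _] := adm.
have /andP[t0 tpi] := tau_bounds p adm.
rewrite FplusE// FminusE// /zvar.
have := integral_nig_density (alpha p) (delta p) (tau p) (mu p) a0 d0 t0 tpi (xvar p).
rewrite /nig_primitive -omegaE -nu_polar_angle// -gamE// => <-.
rewrite /Fnig; congr (_ * _); apply: eq_Rintegral => t _.
rewrite cos_tau// [alpha p * (_ / _)]mulrC mulfVK ?gt_eqF//.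
by rewrite /radius [delta p ^+ 2 + _]addrC.
Qed.
End parameters.

(** * The asymptotic expansion for a fixed angle *)

Section expansion.
Context {R : realType}.
Local Open Scope complex_scope.
Implicit Types (z th : R).

(** For rho = - i sin th with cos th >= 0 the principal root of 1 + rho^2 is
    cos th. *)
Lemma gfunE_imag (s th : R) : 0 <= cos th ->
  gfun s (- 'i%C * (sin th)%:C) = (- (wt s * cos th * (wt s + cos th))^-1)%:C.
Proof.
move=> c0; rewrite /gfun.
have -> : 1 + (- 'i%C * (sin th)%:C) ^+ 2 = (cos th ^+ 2)%:C :> R[i].
  by rewrite imag_sqr_real Re_sqr_imag cos2sin2 rmorphB rmorphN rmorph1.
rewrite sqrtc_sqrtr ?lecR ?sqr_ge0//= sqrtr_sqr ger0_norm// -/(wt s).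
by rewrite rmorphN fmorphV !rmorphM rmorphD.
Qed.

Lemma cos_lt1 th : sin th != 0 -> cos th < 1.
Proof.
move=> s0; rewrite lt_neqAle cos_le1 andbT; apply: contraNneq s0 => c1.
by rewrite -sqrf_eq0 sin2cos2 c1 expr1n subrr.
Qed.

Lemma wt0 : wt (0 : R) = 1.
Proof. by rewrite /wt expr0n addr0 sqrtr1. Qed.

Lemma d_coef_imag th k : 0 < cos th -> sin th != 0 ->
  d_coef (- 'i%C * (sin th)%:C) k = (kernel_coef (cos th) k * pochhammer 2^-1 k)%:C.
Proof.
move=> c0 s0; have c0le := ltW c0; have c01 : 0 < cos th < 1 by rewrite c0 cos_lt1.
rewrite /d_coef [RHS]rmorphM; congr (_ * _).
apply: (c_coefE _ _ (fun s => (1 + cos th) / (wt s * (wt s + cos th)))).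
- rewrite gfunE_imag// wt0 mul1r -(rmorph0 (real_complex R)) (inj_eq (@complexI R)).
  by rewrite oppr_eq0 invr_eq0 mulf_neq0 ?gt_eqF// addr_gt0.
- move=> s s1; rewrite !gfunE_imag// wt0 -rmorphM; congr (_%:C).
  have := wt_gt0 s; move: (wt s) (cos th) c0 => w c c0 w0; field.
  by rewrite !gt_eqF ?addr_gt0.
- move=> s s1; apply/cvgrPdist_le => e e0.
  have : (fun n => (s ^+ 2) ^+ n) @ \oo --> (0 : R).
    by apply: cvg_expr; rewrite normrX exprn_ilt1.
  move=> /cvgr0Pnorm_le/(_ e e0); apply: filterS => n.
  have n0 : 0 <= (s ^+ 2) ^+ n by rewrite exprn_ge0 ?sqr_ge0.
  rewrite (ger0_norm n0); apply: le_trans.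
  have := kernel_expansion_le (cos th) n (s ^+ 2) c01 (sqr_ge0 s).
  by under eq_bigr do rewrite -exprM.
Qed.

Lemma tan_half th : 0 < cos th -> tan (th / 2) = sin th / (1 + cos th).
Proof.
move=> c0; have := sin_double_half th; have := cos_double_half th.
have : cos (th / 2) != 0.
  apply: contraTN c0 => /eqP h; rewrite cos_double_half h expr0n mulr0 sub0r.
  by rewrite -leNgt oppr_le0.
rewrite /tan; move=> h -> ->; field; rewrite h/= addrC subrK.
by rewrite mulf_neq0// expf_neq0.
Qed.

Definition tail_factor z th :=
  - (expR (- z * sin th ^+ 2) * (tan (th / 2) / (2 * Num.sqrt (pi * z)))).

Lemma sqrt_pi_mul z : 0 < z -> Num.sqrt (pi * z) * Num.sqrt (pi / z) = pi.
Proof.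
move=> z0; have p0 := pi_gt0 R; rewrite -sqrtrM ?mulr_ge0 ?ltW//.
have -> : pi * z * (pi / z) = pi ^+ 2.
  by move: (pi : R) p0 => p p0; field; rewrite gt_eqF.
by rewrite sqrtr_sqr gtr0_norm.
Qed.

Lemma tail_factorE z th : 0 < z -> tail_factor z th =
  - (2 * pi)^-1 * (expR (- z * sin th ^+ 2) * tan (th / 2)) * Num.sqrt (pi / z).
Proof.
move=> z0; rewrite /tail_factor.
have := sqrt_pi_mul z z0; have p0 := pi_gt0 R.
have : 0 < Num.sqrt (pi * z) by rewrite sqrtr_gt0 mulr_gt0.
have : 0 < Num.sqrt (pi / z) by rewrite sqrtr_gt0 divr_gt0.
move: (expR _) (tan _) (Num.sqrt (pi * z)) (Num.sqrt (pi / z)) => E t q r r0 q0 e.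
by rewrite -e; field; rewrite !gt_eqF.
Qed.

(** When sin th = 0 the function reduces to its leading term and the factor of
    the series vanishes.  Otherwise 0 < cos th < 1, and the expansion of the
    kernel integral applies because tan(th / 2) = sin th / (1 + cos th). *)
Lemma angular_cdf_expansion z th N : 0 < z -> 0 < cos th ->
  `|(angular_cdf z th)%:C - ((erfc (sin th * Num.sqrt z) / 2)%:C + (tail_factor z th)%:C *
     \sum_(k < N) d_coef (- 'i%C * (sin th)%:C) k / z%:C ^+ k)| <=
  (pochhammer 2^-1 N * (`|tail_factor z th| / z ^+ N))%:C.
Proof.
move=> z0 c0.
have [s0|s0] := eqVneq (sin th) 0.
  have T0 : tail_factor z th = 0 by rewrite /tail_factor tan_half// s0 mul0r mul0r mulr0 oppr0.
  rewrite T0 rmorph0 mul0r addr0 normr0 mul0r mulr0.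
  by rewrite /angular_cdf s0 !mul0r !mulr0 subr0 subrr normr0.
have c01 : 0 < cos th < 1 by rewrite c0 cos_lt1.
have -> : \sum_(k < N) d_coef (- 'i%C * (sin th)%:C) k / z%:C ^+ k =
   (\sum_(k < N) kernel_coef (cos th) k * (pochhammer 2^-1 k / z ^+ k))%:C.
  rewrite rmorph_sum; apply: eq_bigr => k _.
  rewrite d_coef_imag//; move: (kernel_coef _ _) (pochhammer _ _) => a b.
  by rewrite !(rmorphM, fmorphV, rmorphXn)/= mulrA.
rewrite -rmorphM -rmorphD -rmorphB normcR lecR.
set S := \sum_(k < N) _.
have gS : \sum_(k < N) kernel_coef (cos th) k * gauss_moment k z = Num.sqrt (pi / z) * S.
  by rewrite mulr_sumr; apply: eq_bigr => k _; rewrite pochhammer_half// mulrCA.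
pose K := (2 * pi)^-1 * (expR (- z * sin th ^+ 2) * tan (th / 2)).
have TE : tail_factor z th = - K * Num.sqrt (pi / z) by rewrite tail_factorE// /K mulNr.
have -> : angular_cdf z th - (erfc (sin th * Num.sqrt z) / 2 + tail_factor z th * S) =
    - K * ((1 + cos th) * regular_int z (cos th) - Num.sqrt (pi / z) * S).
  rewrite TE /angular_cdf /K tan_half//.
  have := addr_gt0 ltr01 c0; move: (pi_gt0 R).
  move: (erfc _) (expR _) (regular_int _ _) (Num.sqrt (pi / z)) => e E L q.
  move: (pi : R) (sin th) (cos th) => p s c p0 c0'; field.
  by rewrite !gt_eqF.
rewrite TE !normrM -gS normrN (ger0_norm (sqrtr_ge0 _)).
rewrite [leRHS](_ : _ = `|K| * gauss_moment N z); last by rewrite pochhammer_half//; ring.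
by apply: ler_wpM2l => //; exact: regular_int_expansion.
Qed.
End expansion.

(** * The uniform expansions of F+ and F- *)

Section uniform.
Context {R : realType}.
Local Open Scope complex_scope.
Implicit Type p : nig R.

Lemma norm_imag (s : R) : `|- 'i%C * s%:C : R[i]| = `|s|%:C.
Proof. by rewrite normrM normrN normcR normc_def/= expr0n expr1n add0r sqrtr1 mul1r. Qed.

(** The angle th = (nu + tau) / 2 ranges over ]0, 3 pi / 4[.  The bound
    |sin th| <= 1/2 gives cos(2 th) >= 1/2 > 0, which for 2 th in ]0, 3 pi / 2[
    forces 2 th < pi / 2. *)
Lemma cos_thetam_gt0 p : admissible p -> `|sigmam p| <= 2^-1 -> 0 < cos ((nu p + tau p) / 2).
Proof.
move=> adm; have /andP[t0 tpi] := tau_bounds p adm; have /andP[n0 npi] := nu_bounds p adm.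
have -> : 2^-1 = (2^-1 : R)%:C :> R[i] by rewrite fmorphV rmorphD rmorph1.
rewrite /sigmam /sigmam_of norm_imag lecR => s2.
have c2 : 0 < cos (nu p + tau p).
  have := sqr_sin_half (nu p + tau p).
  have : sin ((nu p + tau p) / 2) ^+ 2 <= 2^-1 ^+ 2 by rewrite -real_normK ?num_real// lerXn2r ?nnegrE ?invr_ge0.
  by lra.
apply: cos_gt0_pihalf; apply/andP; split; first by have := pi_gt0 R; lra.
rewrite ltNge; apply/negP => h.
have : 0 <= cos (nu p + tau p - pi) by apply: cos_ge0_pihalf; apply/andP; split; lra.
by rewrite cosB cospi sinpi; lra.
Qed.

Lemma uniform_expansion_eq (D : set (nig R)) f A A' B B' d :
  (forall p, D p -> A p = A' p) -> (forall p, D p -> B p = B' p) ->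
  uniform_expansion D f A B d -> uniform_expansion D f A' B' d.
Proof.
move=> eA eB H N; have [M [Z HZ]] := H N; exists M, Z => p Dp zp.
by rewrite -eA// -eB//; exact: HZ.
Qed.

Lemma sqr_zetap p : admissible p -> zetap p ^+ 2 = zvar p * sin ((nu p - tau p) / 2) ^+ 2.
Proof.
by move=> adm; rewrite /zetap exprMn sqr_sqrtr ?(ltW (zvar_gt0 p adm))// mulrC.
Qed.

Lemma sqr_zetam p : admissible p -> zetam p ^+ 2 = zvar p * sin ((nu p + tau p) / 2) ^+ 2.
Proof.
by move=> adm; rewrite /zetam exprMn sqr_sqrtr ?(ltW (zvar_gt0 p adm))// mulrC.
Qed.

Lemma Fplus_expansion : uniform_expansion
  [set p : nig R | admissible p /\ `|sigmap p| <= 2^-1] Fplus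
  (fun p => erfc (zetap p) / 2)
  (fun p => - (expR (- zetap p ^+ 2) *
     (tan ((nu p - tau p) / 4) / (2 * Num.sqrt (pi * zvar p)))))
  (fun p => d_coef (sigmap p)).
Proof.
move=> N; exists (pochhammer 2^-1 N), 0 => p [adm _] _.
have /cos_gt0_pihalf c0 := thetap_bounds p adm.
have := angular_cdf_expansion (zvar p) ((nu p - tau p) / 2) N (zvar_gt0 p adm) c0.
rewrite /tail_factor FplusE// sqr_zetap// mulNr.
by have -> : (nu p - tau p) / 2 / 2 = (nu p - tau p) / 4 by field.
Qed.

(** The expansion of F- is that of the angular form multiplied by
    e^(2 gam delta), which changes the exponential in the error term from
    e^(-zetam^2) into e^(-zetap^2). *)
Lemma Fminus_expansion : uniform_expansion
  [set p : nig R | admissible p /\ `|sigmam p| <= 2^-1] Fminus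
  (fun p => expR (2 * gam p * delta p) * erfc (zetam p) / 2)
  (fun p => - (expR (- zetap p ^+ 2) *
     (tan ((nu p + tau p) / 4) / (2 * Num.sqrt (pi * zvar p)))))
  (fun p => d_coef (sigmam p)).
Proof.
move=> N; exists (pochhammer 2^-1 N), 0 => p [adm sm] _.
have c0 := cos_thetam_gt0 p adm sm.
have H := angular_cdf_expansion (zvar p) ((nu p + tau p) / 2) N (zvar_gt0 p adm) c0.
pose E := expR (2 * gam p * delta p).
have -> : - (expR (- zetap p ^+ 2) * (tan ((nu p + tau p) / 4) / (2 * Num.sqrt (pi * zvar p)))) =
    E * tail_factor (zvar p) ((nu p + tau p) / 2).
  rewrite /tail_factor mulrN; congr (- _); rewrite [RHS]mulrA.
  have -> : (nu p + tau p) / 2 / 2 = (nu p + tau p) / 4 by field.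
  by congr (_ * _); rewrite -expRD two_gam_delta// sqr_zetap//; congr expR; ring.
move: H; rewrite FminusE// -/E -/(zetam p) -/(sigmam_of _ _) -/(sigmam p).
move: (angular_cdf _ _) (tail_factor _ _) (erfc _) (\sum_(k < N) _) => G T e S H.
have E0 : 0 <= E := expR_ge0 _.
have -> : (E * G)%:C - ((E * e / 2)%:C + (E * T)%:C * S) = E%:C * (G%:C - ((e / 2)%:C + T%:C * S)).
  by rewrite -[E * e / 2]mulrA !rmorphM; ring.
rewrite normrM normcR normrM (ger0_norm E0).
have -> : pochhammer 2^-1 N * (E * `|T| / zvar p ^+ N) = E * (pochhammer 2^-1 N * (`|T| / zvar p ^+ N)).
  by ring.
rewrite [leRHS](rmorphM (real_complex R) E); apply: ler_wpM2l => //.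
by rewrite ler0c.
Qed.

(** As to the sign, x0 - x is a positive multiple of sin(nu - tau), hence of
    sin((nu - tau) / 2), since (nu - tau) / 2 lies in ]- pi / 2, pi / 2[. *)
Lemma zetap_identity p : admissible p ->
  (zetap p)%:C = 'i%C * sigmap p * (Num.sqrt (zvar p))%:C /\
  zetap p = Num.sg (x0 p - xvar p) *
    Num.sqrt (alpha p * omega p - beta p * xi p - gam p * delta p).
Proof.
move=> adm; have [a0 _ d0 _] := adm; split.
  by rewrite /zetap /sigmap /sigmap_of; simpc.
have o0 := omega_gt0 p adm; have z0 := zvar_gt0 p adm.
have := exponent_plus (alpha p) (delta p) (tau p) (mu p) d0 (xvar p).
rewrite -omegaE -nu_polar_angle// -gamE// cos_tau// [alpha p * (_ / _)]mulrC mulfVK ?gt_eqF//.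
rewrite -/(xi p) -/(zvar p) => <-.
rewrite sqrtrM ?ltW// sqrtr_sqr.
have -> : Num.sg (x0 p - xvar p) = Num.sg (sin ((nu p - tau p) / 2)).
  have s0 : 0 < sin (tau p) by apply: sin_gt0_pi; exact: tau_bounds.
  have g0 : 0 < gam p by rewrite gamE// mulr_gt0.
  have := sin_double_half (nu p - tau p).
  rewrite sinB [in LHS]nu_polar_angle// sin_polar_angle// cos_polar_angle// cos_tau// -omegaE -/(xi p) => e.
  have -> : x0 p - xvar p = 2 * alpha p * omega p / gam p * cos ((nu p - tau p) / 2) * sin ((nu p - tau p) / 2).
    rewrite -[RHS]mulrA [X in _ * X]mulrC.
    have -> : 2 * alpha p * omega p / gam p * (sin ((nu p - tau p) / 2) * cos ((nu p - tau p) / 2)) =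
        alpha p * omega p / gam p * (2 * (sin ((nu p - tau p) / 2) * cos ((nu p - tau p) / 2))) by ring.
    rewrite -e (_ : sin (tau p) = gam p / alpha p); last first.
      by rewrite gamE// mulrAC mulfV ?mul1r// gt_eqF.
    rewrite /x0 /xi; field.
    by rewrite !gt_eqF.
  have /cos_gt0_pihalf c0 := thetap_bounds p adm.
  by rewrite sgrM gtr0_sg ?mul1r// !mulr_gt0// invr_gt0.
by rewrite mulrCA -numEsg mulrC.
Qed.

Lemma zetam_identity p : admissible p ->
  (zetam p)%:C = 'i%C * sigmam p * (Num.sqrt (zvar p))%:C /\
  zetam p = Num.sqrt (alpha p * omega p - beta p * xi p + gam p * delta p).
Proof.
move=> adm; have [a0 _ d0 _] := adm; split.
  by rewrite /zetam /sigmam /sigmam_of; simpc.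
have z0 := zvar_gt0 p adm.
have := exponent_plus (alpha p) (delta p) (tau p) (mu p) d0 (xvar p).
rewrite -omegaE -nu_polar_angle// -gamE// cos_tau// [alpha p * (_ / _)]mulrC mulfVK ?gt_eqF//.
rewrite -/(xi p) -/(zvar p) => e; have := two_gam_delta p adm; rewrite mulrBr e => e2.
have -> : alpha p * omega p - beta p * xi p + gam p * delta p = (zetam p) ^+ 2.
  by rewrite sqr_zetam//; lra.
by rewrite sqrtr_sqr ger0_norm// mulr_ge0 ?sqrtr_ge0// ltW// sin_thetam_gt0.
Qed.

End uniform.

Local Open Scope complex_scope.

Theorem theorem4p1 (R : realType) :
  let Dp := [set p : nig R | admissible p /\ `|sigmap p| <= 2^-1] in
  let Dm := [set p : nig R | admissible p /\ `|sigmam p| <= 2^-1] in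
  [/\ forall p : nig R, admissible p ->
        [/\ Fnig p = Fplus p + Fminus p,
            2 * gam p * delta p = zetam p ^+ 2 - zetap p ^+ 2,
            (zetap p)%:C = 'i%C * sigmap p * (Num.sqrt (zvar p))%:C
            /\ zetap p = Num.sg (x0 p - xvar p) *
                 Num.sqrt (alpha p * omega p - beta p * xi p - gam p * delta p)
          & (zetam p)%:C = 'i%C * sigmam p * (Num.sqrt (zvar p))%:C
            /\ zetam p =
                 Num.sqrt (alpha p * omega p - beta p * xi p + gam p * delta p)],
      uniform_expansion Dp Fplus
        (fun p => expR (zvar p * complex.Re (sigmap p ^+ 2)) / (4 * pi) *
           (2 * pi * expR (- zvar p * complex.Re (sigmap p ^+ 2)) *
            erfc (complex.Re ('i%C * sigmap p * (Num.sqrt (zvar p))%:C))))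
        (fun p => expR (zvar p * complex.Re (sigmap p ^+ 2)) / (4 * pi) *
           (- (2 * tan ((nu p - tau p) / 4) * Num.sqrt (pi / zvar p))))
        (fun p => d_coef (sigmap p)),
      uniform_expansion Dm Fminus
        (fun p => expR (zvar p * complex.Re (sigmap p ^+ 2)) / (4 * pi) *
           (2 * pi * expR (- zvar p * complex.Re (sigmam p ^+ 2)) *
            erfc (complex.Re ('i%C * sigmam p * (Num.sqrt (zvar p))%:C))))
        (fun p => expR (zvar p * complex.Re (sigmap p ^+ 2)) / (4 * pi) *
           (- (2 * tan ((nu p + tau p) / 4) * Num.sqrt (pi / zvar p))))
        (fun p => d_coef (sigmam p)),
      uniform_expansion Dp Fplus
        (fun p => erfc (zetap p) / 2)
        (fun p => - (expR (- zetap p ^+ 2) *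
           (tan ((nu p - tau p) / 4) / (2 * Num.sqrt (pi * zvar p)))))
        (fun p => d_coef (sigmap p))
    & uniform_expansion Dm Fminus
        (fun p => expR (2 * gam p * delta p) * erfc (zetam p) / 2)
        (fun p => - (expR (- zetap p ^+ 2) *
           (tan ((nu p + tau p) / 4) / (2 * Num.sqrt (pi * zvar p)))))
        (fun p => d_coef (sigmam p))].
Proof.
have p0 := pi_gt0 R.
have eS (z e t : R) : 0 < z -> - (e * (t / (2 * Num.sqrt (pi * z)))) = e / (4 * pi) * - (2 * t * Num.sqrt (pi / z)).
  move=> z0; have := sqrt_pi_mul z z0.
  have : 0 < Num.sqrt (pi * z) by rewrite sqrtr_gt0 mulr_gt0.
  have : 0 < Num.sqrt (pi / z) by rewrite sqrtr_gt0 divr_gt0.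
  move: (Num.sqrt (pi * z)) (Num.sqrt (pi / z)) => q r r0 q0 <-.
  by field; rewrite !gt_eqF.
have Rp (p : nig R) : complex.Re (sigmap p ^+ 2) = - sin ((nu p - tau p) / 2) ^+ 2 by exact: Re_sqr_imag.
have Rm (p : nig R) : complex.Re (sigmam p ^+ 2) = - sin ((nu p + tau p) / 2) ^+ 2 by exact: Re_sqr_imag.
have eE (x y v : R) : expR x / (4 * pi) * (2 * pi * expR y * v) = expR (x + y) * v / 2.
  rewrite expRD; move: (expR x) (expR y) (pi : R) p0 => a b p p0; field.
  by rewrite gt_eqF.
move=> Dp Dm; split.
- move=> p adm; split; [exact: FnigE| |exact: zetap_identity|exact: zetam_identity].
  by rewrite two_gam_delta// mulrBr sqr_zetap// sqr_zetam.
- apply: uniform_expansion_eq Fplus_expansion => p [adm _].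
    rewrite -(zetap_identity p adm).1 Rp eE /=.
    by rewrite (_ : _ + _ = 0) ?expR0 ?mul1r//; ring.
  by rewrite eS ?zvar_gt0// sqr_zetap// Rp [zvar p * - _]mulrN.
- apply: uniform_expansion_eq Fminus_expansion => p [adm _].
    rewrite -(zetam_identity p adm).1 Rp Rm eE two_gam_delta//.
    by congr (expR _ * _ / _); ring.
  by rewrite eS ?zvar_gt0// sqr_zetap// Rp [zvar p * - _]mulrN.
- exact: Fplus_expansion.
- exact: Fminus_expansion.
Qed.
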